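(* Let $q\ge2$ and $2829\le K\le L\le M$ be integers and impose periodic boundary conditions. Then: (1) The law of the Markov chain $X_\beta(\cdot)$ converges, as $\beta\to\infty$, to the law of the limiting Markov chain $X(\cdot)$ (both started from the same point of $\mathcal{S}$) in the usual Skorokhod topology. (2) For every $t\ge0$, $$\lim_{\beta\to\infty}\max_{\mathbf{s}\in\mathcal{S}}\mathbb{E}_{\mathbf{s}}^{\beta}\Big[\int_0^t\mathbf{1}\{\widehat{\sigma}_\beta(u)\notin\mathcal{S}\}\,du\Big]=0.$$
   Context: $\mathbb{T}_N=\mathbb{Z}/N\mathbb{Z}$, $\Lambda=\mathbb{T}_K\times\mathbb{T}_L\times\mathbb{T}_M$, $S=\{1,\dots,q\}$, $\mathcal{X}=S^\Lambda$, $H(\sigma)=\sum_{\{x,y\}\subseteq\Lambda:x\sim y}\mathbf{1}\{\sigma(x)\ne\sigma(y)\}$ ($x\sim y$: nearest neighbours in the torus). $\mathbf{s}_a$ is the configuration with all spins $a$, $\mathcal{S}=\{\mathbf{s}_1,\dots,\mathbf{s}_q\}$, $\breve{\mathbf{s}}=\mathcal{S}\setminus\{\mathbf{s}\}$. $\{\sigma_\beta(t)\}_{t\ge0}$ is the continuous-time Markov chain on $\mathcal{X}$ which jumps from $\sigma$ to $\zeta$ at rate $e^{-\beta\max\{H(\zeta)-H(\sigma),0\}}$ if $\sigma,\zeta$ differ at exactly one site, and at rate $0$ otherwise; $\mathbb{E}_\sigma^\beta$ is the expectation for the process started at $\sigma$; $\tau$ denotes hitting times. $\Gamma=2KL+2K+2$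 is the energy barrier between ground states. Accelerated process: $\widehat{\sigma}_\beta(t)=\sigma_\beta(e^{\Gamma\beta}t)$. Let $T(t)=\int_0^t\mathbf{1}\{\widehat{\sigma}_\beta(u)\in\mathcal{S}\}du$ and $S(t)=\sup\{u\ge0:T(u)\le t\}$. The (accelerated) trace process on $\mathcal{S}$ is $X_\beta(t)=\widehat{\sigma}_\beta(S(t))$, $t\ge0$; it is a continuous-time irreducible Markov chain on $\mathcal{S}$. Limiting chain: $\{X(t)\}_{t\ge0}$ is the continuous-time Markov chain on $\mathcal{S}$ with jump rate $r_X(\mathbf{s},\mathbf{s}')=\kappa^{-1}$ for all distinct $\mathbf{s},\mathbf{s}'\in\mathcal{S}$, where $\kappa=\kappa(K,L,M)>0$ is the constant (which exists by the paper's Eyring--Kramers law, and is uniquely determined) such that for all distinct $\mathbf{s},\mathbf{s}'\in\mathcal{S}$, as $\beta\to\infty$, $\mathbb{E}_{\mathbf{s}}^\beta[\tau_{\breve{\mathbf{s}}}]=(1+o(1))\frac{\kappa}{q-1}e^{\Gamma\beta}$ and $\mathbb{E}_{\mathbf{s}}^\beta[\tau_{\mathbf{s}'}]=(1+o(1))\kappa e^{\Gamma\beta}$. *)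

(* Defs.v *)
From HB Require Import structures.
From mathcomp Require Import all_boot all_order all_algebra.
From mathcomp Require Import all_classical all_reals all_analysis.

Set Implicit Arguments.
Unset Strict Implicit.
Unset Printing Implicit Defensive.

Import Order.TTheory GRing.Theory Num.Theory.
Import numFieldNormedType.Exports.

Local Open Scope classical_set_scope.
Local Open Scope ring_scope.

(** * The Skorokhod space D([0, oo), T) for a finite (discrete) T *)

(* Time is the half-line [0, oo) of R: the values of a path at negative times
   are irrelevant.  For a discrete state space, having a limit at t amounts to
   being constant on a one-sided punctured neighbourhood of t. *)
Definition cadlag (R : realType) (T : Type) (f : R -> T) : Prop :=
  (forall t, 0 <= t -> \forall u \near t^'+, f u = f t) /\
  (forall t, 0 < t -> exists x, \forall u \near t^'-, f u = x).

Record dpath (R : realType) (T : Type) := DPath {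
  dpath_fun :> R -> T;
  dpath_cadlag : cadlag dpath_fun }.

Lemma cadlag_cst (R : realType) (T : Type) (x : T) :
  cadlag (fun _ : R => x).
Proof.
by split=> t _; [exact: nearW | exists x; exact: nearW].
Qed.

(* Path-valued functionals that are cadlag only almost surely are set to a
   constant path on the exceptional null set. *)
Definition to_dpath (R : realType) (T : Type) (f : R -> T) : dpath R T :=
  match pselect (cadlag f) with
  | left hf => DPath hf
  | right _ => DPath (cadlag_cst R (f 0))
  end.

(* Increasing bijections of [0, oo); they are automatically continuous and
   fix 0. *)
Definition time_change (R : realType) (l : R -> R) : Prop :=
  {in `[0, +oo[ &, {homo l : s t / s < t}} /\
  set_bij `[0, +oo[ `[0, +oo[ l.

(* Skorokhod convergence of x_n to y (Billingsley, Convergence of Probability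
   Measures, Thm 16.1; Jacod-Shiryaev, Thm VI.1.14): there are time changes l_n
   with sup_t |l_n t - t| -> 0 and sup_(t <= m) r(x_n (l_n t), y t) -> 0 for all
   m.  Here r is the discrete metric, so the latter means equality on [0, m]
   for all large n. *)
Definition skorokhod_cvg (R : realType) (T : Type)
    (x : nat -> dpath R T) (y : dpath R T) : Prop :=
  exists l : nat -> R -> R,
    [/\ forall n, time_change (l n),
        forall e : R, 0 < e ->
          \forall n \near \oo, forall t, 0 <= t -> `|l n t - t| <= e &
        forall m : R,
          \forall n \near \oo, forall t, 0 <= t <= m -> x n (l n t) = y t].

(* The Skorokhod topology is metrizable, hence its open sets are exactly the
   sequentially open ones. *)
Definition skorokhod_open (R : realType) (T : Type) (U : set (dpath R T)) :=
  forall (x : nat -> dpath R T) (y : dpath R T),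
    skorokhod_cvg x y -> U y -> \forall n \near \oo, U (x n).

Lemma skorokhod_openT (R : realType) (T : Type) :
  @skorokhod_open R T setT.
Proof. by move=> x y _ _; exact: nearW. Qed.

Lemma skorokhod_openI (R : realType) (T : Type) :
  setI_closed (@skorokhod_open R T).
Proof.
move=> A B oA oB x y xy [Ay By].
by apply: filterI; [exact: oA xy Ay | exact: oB xy By].
Qed.

Lemma skorokhod_open_bigU (R : realType) (T : Type) (I : Type)
    (f : I -> set (dpath R T)) :
  (forall i, skorokhod_open (f i)) -> skorokhod_open (\bigcup_i f i).
Proof.
move=> of_ x y xy [i _ fiy].
by apply: filterS (of_ i x y xy fiy) => n fin; exists i.
Qed.

HB.instance Definition _ (R : realType) (T : Type) :=
  gen_eqMixin (dpath R T).
HB.instance Definition _ (R : realType) (T : Type) :=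
  gen_choiceMixin (dpath R T).
HB.instance Definition _ (R : realType) (T : Type) :=
  @isOpenTopological.Build (dpath R T) (@skorokhod_open R T)
    (@skorokhod_openT R T) (@skorokhod_openI R T) (@skorokhod_open_bigU R T).

(* Convergence in law of the D-valued random elements Y b (under P b) to Z
   (under Q), as b -> oo. *)
Definition cvg_in_law (R : realType) (T : Type)
    (d : R -> measure_display) (Omega : forall b, measurableType (d b))
    (P : forall b, probability (Omega b) R) (Y : forall b, Omega b -> dpath R T)
    (d' : measure_display) (Omega' : measurableType d')
    (Q : probability Omega' R) (Z : Omega' -> dpath R T) : Prop :=
  forall F : dpath R T -> R, continuous F ->
    (exists C : R, forall x, `|F x| <= C) ->
    'E_(P b)[fun w => F (Y b w)]%E @[b --> +oo] --> 'E_Q[fun w => F (Z w)]%E.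

(** * Continuous-time Markov chains on a finite set *)

(* The values r x x are not used. *)
Definition generator (R : realType) (T : finType) (r : T -> T -> R) :
    'M[R]_#|T| :=
  \matrix_(i, j)
    if i == j then - \sum_(k | k != i) r (enum_val i) (enum_val k)
    else r (enum_val i) (enum_val j).

(* The entry (x, y) of exp (t Q), with Q the generator. *)
Definition transition (R : realType) (T : finType) (r : T -> T -> R)
    (t : R) (x y : T) : R :=
  limn (series (fun n =>
    exp_coeff t n * (generator r ^+ n) (enum_rank x) (enum_rank y))).

Fixpoint fdd (R : realType) (T : finType) (r : T -> T -> R)
    (t : R) (x : T) (s : seq (R * T)) : R :=
  if s is (u, y) :: s' then transition r (u - t) x y * fdd r u y s' else 1.

(* X is, under P, a Markov chain with jump rates r started at x: X has cadlag
   paths and P (X_t1 = x1, ..., X_tn = xn) is the product of the transition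
   probabilities, for 0 <= t1 <= ... <= tn.  The single constraint (0, x) gives
   P (X_0 = x) = 1. *)
Definition is_markov_chain (R : realType) (T : finType) (r : T -> T -> R)
    (d : measure_display) (Omega : measurableType d) (P : probability Omega R)
    (X : Omega -> dpath R T) (x : T) : Prop :=
  (forall t y, 0 <= t -> measurable [set w | X w t = y]) /\
  (forall s : seq (R * T), path <=%R 0 (map fst s) ->
     P [set w | forall a, a \in s -> X w a.1 = a.2] = (fdd r 0 x s)%:E).

(* inf of the empty set is +oo *)
Definition hitting_time (R : realType) (T : Type) (A : set T) (f : R -> T) :
    \bar R :=
  ereal_inf [set t%:E | t in [set t : R | 0 <= t /\ A (f t)]].

(* \int_0^t 1{f u \in A} du *)
Definition occupation (R : realType) (T : Type) (A : set T) (f : R -> T)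
    (t : R) : \bar R :=
  (\int[lebesgue_measure]_(u in `[0%R, t]) (\1_A (f u))%:E)%E.

(* S(t) = sup {u >= 0 : T(u) <= t}, with T the occupation time of A.  The set is
   unbounded only when the total time spent in A is at most t, which for an
   irreducible chain is a null event. *)
Definition trace_clock (R : realType) (T : Type) (A : set T) (f : R -> T)
    (t : R) : R :=
  sup [set u : R | 0 <= u /\ (occupation A f u <= t%:E)%E].

(* The trace t |-> f (S(t)) on the subtype of p, when f is cadlag with infinite
   occupation time of p, takes all its values in p; the default value a is then
   not used. *)
Definition trace_path (R : realType) (T : Type) (p : pred T) (a : {x | p x})
    (f : R -> T) : dpath R {x | p x} :=
  to_dpath (fun t => insubd a (f (trace_clock [set x | p x] f t))).

(** * The Potts model with Metropolis dynamics on the 3-d torus *)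

Definition site (K L M : nat) : finType := ('I_K * 'I_L * 'I_M)%type.

Definition config (q K L M : nat) : finType := {ffun site K L M -> 'I_q}.

(* ordS is the cyclic successor i |-> i + 1 mod n *)
Definition cyc_adj (n : nat) (i j : 'I_n) : bool :=
  (j == ordS i) || (i == ordS j).

Definition neighbour (K L M : nat) (x y : site K L M) : bool :=
  let: (x1, x2, x3) := x in
  let: (y1, y2, y3) := y in
  [|| [&& cyc_adj x1 y1, x2 == y2 & x3 == y3],
      [&& x1 == y1, cyc_adj x2 y2 & x3 == y3] |
      [&& x1 == y1, x2 == y2 & cyc_adj x3 y3]].

(* each unordered pair {x, y} with x ~ y occurs once *)
Definition edges (K L M : nat) : {set {set site K L M}} :=
  [set [set p.1; p.2]%SET
     | p : site K L M * site K L M & neighbour p.1 p.2]%SET.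

Definition hamiltonian (q K L M : nat) (s : config q K L M) : nat :=
  \sum_(e in edges K L M) [exists x in e, exists y in e, s x != s y].

Definition single_flip (q K L M : nat) (s z : config q K L M) : bool :=
  #|[set x | s x != z x]%SET| == 1%N.

Definition metropolis_rate (R : realType) (q K L M : nat) (b : R)
    (s z : config q K L M) : R :=
  if single_flip s z then
    expR (- b * Num.max ((hamiltonian z)%:R - (hamiltonian s)%:R) 0)
  else 0.

Definition mono (q K L M : nat) (a : 'I_q) : config q K L M :=
  [ffun => a].

Definition is_ground (q K L M : nat) : pred (config q K L M) :=
  fun s => [exists a, s == mono K L M a].

Definition ground (q K L M : nat) : finType :=
  {s : config q K L M | is_ground s}.

Definition Gamma (K L : nat) : nat := (2 * K * L + 2 * K + 2)%N.

Definition accelerated (R : realType) (T : Type) (K L : nat) (b : R)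
    (f : R -> T) : R -> T :=
  fun t => f (expR ((Gamma K L)%:R * b) * t).

(* f b = (1 + o(1)) g b as b -> oo *)
Definition asymp_eq (R : realType) (f : R -> \bar R) (g : R -> R) : Prop :=
  exists2 o : R -> R, o b @[b --> +oo] --> 0 &
    \forall b \near +oo, f b = ((1 + o b) * g b)%:E.

(* The defining property of kappa; P b s is the law of the chain at inverse
   temperature b started at s. *)
Definition eyring_kramers (R : realType) (q K L M : nat)
    (d : R -> measure_display) (Omega : forall b, measurableType (d b))
    (P : forall b, config q K L M -> probability (Omega b) R)
    (X : forall b, Omega b -> dpath R (config q K L M)) (kappa : R) : Prop :=
  forall s s' : ground q K L M, s != s' ->
    asymp_eq
      (fun b => \int[P b (val s)]_w
         hitting_time [set z | is_ground z /\ z != val s] (X b w))%E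
      (fun b => kappa / (q%:R - 1) * expR ((Gamma K L)%:R * b)) /\
    asymp_eq
      (fun b => \int[P b (val s)]_w hitting_time [set val s'] (X b w))%E
      (fun b => kappa * expR ((Gamma K L)%:R * b)).

(* Main.v *)
(* The Metropolis chain is reversible for mu(s) = exp (- b H(s)), and H >= 1 off
   the ground states, so p_t(s, z) <= exp (- b) for s ground and z not ground; this
   bounds the mean time spent outside the ground states.

   Sample the chain on a grid of mesh h and keep the visits to the ground states.
   Pathwise, as h -> 0, the resulting step paths converge in the Skorokhod topology
   to the trace.  They form a discrete-time Markov chain whose kernel, by colour
   symmetry, has a single off-diagonal value alpha; hence it is the kernel at some
   time theta of the limiting chain, and the step path has the law of the limiting
   chain read at the multiples of theta.  Green's identity gives
   m (q - 1) alpha = 1 + O(exp (- b)), with m the mean number of steps from one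
   ground state to another, and h m tends to the mean hitting time, so the
   Eyring-Kramers law says exactly that theta is asymptotic to the accelerated mesh
   h exp (- Gamma b).  Choosing h small as a function of b, the mean of a functional
   of the trace is close to its mean under a sampling of one fixed process, and that
   sampling converges pathwise. *)
Require Import Defs.
From HB Require Import structures.
From mathcomp Require Import all_boot all_order all_algebra.
From mathcomp Require Import all_classical all_reals all_analysis measurable_realfun.
From mathcomp Require Import perm ring lra.

Set Implicit Arguments.
Unset Strict Implicit.
Unset Printing Implicit Defensive.

Import Order.TTheory GRing.Theory Num.Theory.
Import numFieldNormedType.Exports.

Local Open Scope classical_set_scope.
Local Open Scope ring_scope.

(** * Cadlag paths *)

(** Only finite-dimensional laws are given, while neither a hitting time nor the trace depends on
    finitely many times. The grid makes both limits of functions of finitely many times, so that no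
    stopping time and no generator of the trace is needed, and bounded convergence along convergent
    paths replaces tightness. The price is three truncations: the mesh, the number of recorded
    visits and the horizon. For a fixed mesh the required visits occur within the horizon with
    probability tending to one, so the horizon is chosen last. The equality of kernels is exact:
    [theta] solves [1 - exp (- q theta / kappa) = q alpha], which requires [q alpha < 1] and hence a
    small mesh. However, a visit is held for the accelerated mesh [h'] in the sampled path, whereas
    it stands for a time [theta] of the limiting chain. Sampling is therefore studied with two
    lengths, the mesh and the holding time, whose ratio tends to one; the time changes of the
    Skorokhod topology absorb the discrepancy. Convergence to the trace is proved on the paths of
    infinite occupation time, a measurable set of probability one; the trace itself is not shown to
    be measurable. *)

Lemma at_right_ex (R : realType) (t : R) (P : R -> Prop) :
  (\forall u \near t^'+, P u) ->
  exists2 d : R, 0 < d & forall u, t < u < t + d -> P u.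
Proof.
case=> d /= d0 H; exists d => // u /andP[tu utd].
by apply: H => //=; rewrite distrC gtr0_norm ?subr_gt0 // ltrBlDl.
Qed.

Lemma at_left_ex (R : realType) (t : R) (P : R -> Prop) :
  (\forall u \near t^'-, P u) ->
  exists2 d : R, 0 < d & forall u, t - d < u < t -> P u.
Proof.
case=> d /= d0 H; exists d => // u /andP[tdu ut].
by apply: H => //=; rewrite gtr0_norm ?subr_gt0 //; lra.
Qed.

Lemma ex_at_right (R : realType) (t d : R) (P : R -> Prop) : 0 < d ->
  (forall u, t < u < t + d -> P u) -> \forall u \near t^'+, P u.
Proof.
move=> d0 H; exists d => // u /= + tu.
by rewrite distrC gtr0_norm ?subr_gt0 // ltrBlDl => utd; apply: H; rewrite tu.
Qed.

Lemma ex_at_left (R : realType) (t d : R) (P : R -> Prop) : 0 < d ->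
  (forall u, t - d < u < t -> P u) -> \forall u \near t^'-, P u.
Proof.
move=> d0 H; exists d => // u /= + tu.
by rewrite gtr0_norm ?subr_gt0 // => utd; apply: H; rewrite tu andbT; lra.
Qed.

(* Real induction along the jumps of a path. *)
Lemma cadlag_ind (R : realType) (T : Type) (f : R -> T) (C : R -> Prop) :
  cadlag f -> C 0 ->
  (forall u v, 0 <= u -> u < v -> C u ->
     (forall w, u <= w < v -> f w = f u) -> C v) ->
  forall u, 0 <= u -> C u.
Proof.
move=> [fr fl] C0 CS u0 u0_ge0.
pose E := [set u : R | 0 <= u <= u0 /\ forall w, 0 <= w <= u -> C w].
have E0 : E 0.
  by split=> [|w]; [rewrite lexx | rewrite -eq_le => /eqP <-].
have supE : has_sup E by split; [exists 0 | exists u0 => u [/andP[]]].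
pose s := sup E.
have s0 : 0 <= s by apply: ub_le_sup => //; case: supE.
have su0 : s <= u0.
  by apply: ge_sup => //; [exists 0 | move=> u [/andP[]]].
(* The left limit at the supremum makes the path constant on [[e, s)] for some [e] of [E], so [C]
   passes from [e] to [s]. *)
have Cs : C s.
  have [s_eq0|s_neq0] := eqVneq s 0; first by rewrite s_eq0.
  have s_gt0 : 0 < s by rewrite lt_neqAle eq_sym s_neq0.
  have [x /at_left_ex[d d0 Hd]] := fl _ s_gt0.
  have [e Ee se] := sup_adherent d0 supE.
  have es : e <= s by apply: ub_le_sup => //; case: supE.
  have [/andP[e0 eu0] He] := Ee.
  have [->|nes] := eqVneq s e; first by apply: He; rewrite e0 lexx.
  have lt_es : e < s by rewrite lt_neqAle eq_sym nes.
  apply: (CS e) => //; first by apply: He; rewrite e0 lexx.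
  move=> w /andP[ew ws]; rewrite !Hd //; apply/andP; split => //.
  exact: lt_le_trans ew.
have Cw w : 0 <= w <= s -> C w.
  move=> /andP[w0]; rewrite le_eqVlt => /orP[/eqP -> //|ws].
  have sw : 0 < s - w by rewrite subr_gt0.
  have [e [/andP[e0 eu0] He] se] := sup_adherent sw supE.
  by apply: He; rewrite w0 ltW //; move: se; rewrite /s; lra.
move: su0; rewrite le_eqVlt => /orP[/eqP <- //|su0].
have [d d0 Hd] := at_right_ex (fr _ s0).
pose v := Num.min (s + d / 2) u0.
have sv : s < v by rewrite lt_min su0 andbT; lra.
have vsd : v < s + d by rewrite gt_min; apply/orP; left; lra.
have vu0 : v <= u0 by rewrite ge_min lexx orbT.
have Ev : E v.
  split; first by rewrite vu0 andbT; apply: le_trans (ltW sv).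
  move=> w /andP[w0 wv]; have [ws|sw] := leP w s; first by apply: Cw; rewrite w0.
  apply: (CS s) => // x /andP[]; rewrite le_eqVlt => /orP[/eqP <- //|sx] xw.
  by apply: Hd; rewrite sx /=; apply: lt_trans xw _; apply: le_lt_trans vsd.
have : v <= s by apply: ub_le_sup => //; case: supE.
by rewrite leNgt sv.
Qed.


(** * Occupation time of a set and the clock of the trace *)

Section occupation.
Variables (R : realType) (T : Type) (A : set T) (f : R -> T).
Hypothesis cf : cadlag f.

Let visits : set R := `[0%R, +oo[ `&` f @^-1` A.

(** [T] carries no sigma-algebra: measurability comes from the path being piecewise constant, one
    interval of constancy at a time. *)
Lemma measurable_visits : measurable visits.
Proof.
have H u : 0 <= u -> measurable (`[0%R, u[ `&` f @^-1` A : set R).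
  move: u; apply: (cadlag_ind
    (C := fun u => measurable (`[0%R, u[ `&` f @^-1` A : set R)) cf)
    => [|u v u0 uv mu fuv].
    by rewrite set_itvco0 set0I.
  rewrite (_ : _ `&` _ = (`[0%R, u[ `&` f @^-1` A) `|`
                         (`[u, v[ `&` [set _ | A (f u)])); last first.
    apply/seteqP; split=> w /=; rewrite !in_itv /=.
      case=> /andP[w0 wv] Aw; have [uw|wu] := leP u w; last by left; rewrite w0.
      by right; rewrite wv -(fuv w) ?uw.
    case=> [[/andP[w0 wu] Aw]|[/andP[uw wv] Au]].
      by rewrite w0 (lt_trans wu).
    by rewrite (le_trans u0) // wv (fuv w) ?uw.
  apply: measurableU => //; apply: measurableI => //.
  by have [Au|nAu] := pselect (A (f u));
    [rewrite (_ : [set _ | _] = setT)|rewrite (_ : [set _ | _] = set0)] => //;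
    apply/seteqP; split.
rewrite (_ : visits = \bigcup_(n : nat) (`[0%R, n%:R[ `&` f @^-1` A)).
  by apply: (@bigcupT_measurable _ _ (fun n : nat => `[0%R, n%:R[ `&` f @^-1` A)) => n; apply: H; rewrite ler0n.
apply/seteqP; split=> u /=; rewrite /visits /= in_itv /= andbT.
  move=> [u0 Au]; exists (Num.truncn u).+1 => //=.
  by rewrite in_itv /= u0 truncnS_gt.
by case=> n _ /=; rewrite in_itv /= => -[/andP[]].
Qed.

Lemma occupationE t :
  occupation A f t = lebesgue_measure (visits `&` `[0%R, t]).
Proof.
rewrite /occupation -(integral_indic lebesgue_measure) //; last first.
  exact: measurable_visits.
apply: eq_integral => u; rewrite inE /= in_itv /= => /andP[u0 ut].
rewrite !indicE; congr (nat_of_bool _)%:R%:E; apply/idP/idP; rewrite !inE /visits /=.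
  by rewrite in_itv /= u0.
by case.
Qed.

Definition roccupation t : R := fine (occupation A f t).

Lemma occupation_fin t : 0 <= t -> occupation A f t = (roccupation t)%:E.
Proof.
move=> t0; rewrite /roccupation fineK // ge0_fin_numE ?occupationE //.
apply: (@le_lt_trans _ _ (lebesgue_measure (`[0%R, t]%classic : set R))).
  apply: le_measure; rewrite ?inE //.
  by apply: measurableI => //; exact: measurable_visits.
by rewrite lebesgue_measure_itv /=; case: ifP; rewrite ltry.
Qed.

Lemma roccupation0 : roccupation 0 = 0.
Proof.
rewrite /roccupation occupationE set_itv1.
rewrite (_ : lebesgue_measure _ = 0%E) //; apply/eqP.
rewrite -measure_le0 -(lebesgue_measure_set1 (0 : R)).
apply: le_measure; rewrite ?inE //.
by apply: measurableI => //; exact: measurable_visits.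
Qed.

(** The path may jump at [v], but a point is null, so the interval contributes either its whole
    length or nothing. *)
Lemma roccupation_step u v : 0 <= u -> u <= v ->
  (forall w, u <= w < v -> f w = f u) ->
  roccupation v = roccupation u + (v - u) * \1_A (f u).
Proof.
move=> u0; rewrite le_eqVlt => /orP[/eqP <- _|uv fuv].
  by rewrite subrr mul0r addr0.
have mI (D : set R) : measurable D -> measurable (visits `&` D).
  by move=> mD; apply: measurableI => //; exact: measurable_visits.
have : occupation A f v =
    (occupation A f u + lebesgue_measure (visits `&` `]u, v]))%E.
  rewrite !occupationE -measureU; [|exact: mI|exact: mI|]; last first.
    apply/seteqP; split => // w [[_ /=]] + [_ /=].
    by rewrite !in_itv /= => /andP[_ wu] /andP[/(le_lt_trans wu)]; rewrite ltxx.
  congr (lebesgue_measure _); rewrite -setIUr; congr (_ `&` _).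
  apply/seteqP; split=> w /=; rewrite !in_itv /=.
    by move=> /andP[w0 wv]; case: (leP w u); [left; rewrite w0|right].
  case=> /andP[]; first by move=> -> /le_trans; apply; apply: ltW.
  by move=> uw ->; rewrite andbT (le_trans u0) // ltW.
rewrite !occupation_fin ?(le_trans u0 (ltW uv)) //.
suff -> : lebesgue_measure (visits `&` `]u, v]) = ((v - u) * \1_A (f u))%:E.
  by move=> [].
rewrite indicE; have [Au|Au] := pselect (A (f u)).
  rewrite mem_set // mulr1; apply/eqP; rewrite eq_le; apply/andP; split.
    rewrite (_ : (v - u)%:E = lebesgue_measure (`]u, v]%classic : set R)).
      by apply: le_measure; rewrite ?inE; [exact: mI|by []|] => w [].
    by rewrite lebesgue_measure_itv /= lte_fin uv.
  rewrite (_ : (v - u)%:E = lebesgue_measure (`]u, v[%classic : set R)); last first.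
    by rewrite lebesgue_measure_itv /= lte_fin uv.
  apply: le_measure; rewrite ?inE; [by []|exact: mI|] => w /=; rewrite !in_itv /=.
  move=> /andP[uw wv]; have ltuw := ltW uw; rewrite /visits /= in_itv /= andbT.
  by rewrite uw (ltW wv) (le_trans u0) // (fuv w) ?wv ?ltW.
rewrite memNset // mulr0; apply/eqP; rewrite -measure_le0 -(lebesgue_measure_set1 v).
apply: le_measure; rewrite ?inE; [exact: mI|by []|] => w /= [[_ Aw]]; rewrite in_itv /=.
move=> /andP[uw]; rewrite le_eqVlt => /orP[/eqP //|wv].
by case: Au; rewrite -(fuv w) // wv ltW.
Qed.

Lemma roccupation_homo u v : 0 <= u -> u <= v -> roccupation u <= roccupation v.
Proof.
move=> u0 uv; have v0 := le_trans u0 uv.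
rewrite -lee_fin -!occupation_fin // !occupationE.
apply: le_measure; rewrite ?inE.
- by apply: measurableI => //; exact: measurable_visits.
- by apply: measurableI => //; exact: measurable_visits.
- apply: setIS => w /=; rewrite !in_itv /= => /andP[-> wu].
  exact: le_trans uv.
Qed.

Lemma roccupation_ge0 u : 0 <= roccupation u.
Proof. by rewrite fine_ge0 // occupationE. Qed.

(* On an interval spent in [A], the clock inverts the occupation time
   affinely. *)
Lemma trace_clock_step u v t : 0 <= u -> u < v ->
  (forall w, u <= w < v -> f w = f u) -> A (f u) ->
  roccupation u <= t < roccupation v ->
  trace_clock A f t = u + (t - roccupation u).
Proof.
move=> u0 uv fuv Au /andP[ut tv].
have occ w : u <= w <= v -> roccupation w = roccupation u + (w - u).
  move=> /andP[uw wv]; rewrite (@roccupation_step u w) //.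
    by rewrite indicE mem_set // mulr1.
  by move=> x /andP[ux xw]; apply: fuv; rewrite ux (lt_le_trans xw).
have occv := occ v; rewrite lexx (ltW uv) in occv.
move: tv; rewrite occv // => tv.
pose s := u + (t - roccupation u).
have us : u <= s by rewrite /s; lra.
have sv : s < v by rewrite /s; lra.
rewrite /trace_clock -/s (_ : [set _ | _] = `[0, s]%classic).
  by rewrite sup_itv //=; rewrite bnd_simp; apply: le_trans us.
apply/seteqP; split => w /=; rewrite in_itv /=.
  move=> [w0]; rewrite occupation_fin // lee_fin w0 /= => Hw.
  rewrite leNgt; apply/negP => sw.
  (* The affine formula holds only up to [v]; a later time is cut at [v] and compared by
     monotonicity. *)
  pose w' := Num.min w v.
  have sw' : s < w' by rewrite lt_min sw.
  have : roccupation w' <= roccupation w.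
    by apply: roccupation_homo; rewrite ?ge_min ?lexx // (le_trans _ (ltW sw')) // (le_trans u0).
  rewrite occ; last by rewrite ge_min lexx orbT (le_trans us) // ltW.
  move: sw'; rewrite {1}/s; lra.
move=> /andP[w0 ws]; split => //; rewrite occupation_fin // lee_fin.
apply: (@le_trans _ _ (roccupation s)); first exact: roccupation_homo.
by rewrite occ ?us ?(ltW sv) // /s; lra.
Qed.

End occupation.


(** * Skorokhod convergence *)

Lemma time_change_intro (R : realType) (l : R -> R) :
  (forall s t, 0 <= s -> s < t -> l s < l t) ->
  (forall t, 0 <= t -> 0 <= l t) ->
  (forall y, 0 <= y -> exists2 t, 0 <= t & l t = y) ->
  time_change l.
Proof.
move=> hl l0 sl; split.
  by move=> s t; rewrite !in_itv /= !andbT => s0 _; exact: hl.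
split.
- by move=> t /=; rewrite !in_itv /= !andbT; exact: l0.
- move=> s t; rewrite !inE /= !in_itv /= !andbT => s0 t0 lst.
  case: (ltgtP s t) => // st.
    by have := hl _ _ s0 st; rewrite lst ltxx.
  by have := hl _ _ t0 st; rewrite lst ltxx.
- move=> y /=; rewrite in_itv /= andbT => /sl[t t0 <-].
  by exists t => //=; rewrite in_itv /= andbT.
Qed.

Lemma time_change_homo (R : realType) (l : R -> R) s t :
  time_change l -> 0 <= s -> s < t -> l s < l t.
Proof.
move=> [hl _] s0 st; apply: hl => //; rewrite in_itv /= andbT //.
by rewrite (le_trans s0) // ltW.
Qed.

Lemma time_change_ge0 (R : realType) (l : R -> R) t :
  time_change l -> 0 <= t -> 0 <= l t.
Proof.
by move=> [_ [fl _ _]] t0; have := fl t; rewrite /= !in_itv /= !andbT; exact.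
Qed.

Lemma time_change_surj (R : realType) (l : R -> R) y :
  time_change l -> 0 <= y -> exists2 t, 0 <= t & l t = y.
Proof.
move=> [_ [_ _ sl]] y0; have /sl[t /= + <-] : `[0, +oo[%classic y.
  by rewrite /= in_itv /= andbT.
by rewrite in_itv /= andbT => t0; exists t.
Qed.

Lemma time_change_id (R : realType) : time_change (@id R).
Proof. by apply: time_change_intro => // y y0; exists y. Qed.

Lemma time_change_comp (R : realType) (k l : R -> R) :
  time_change k -> time_change l -> time_change (k \o l).
Proof.
move=> tk tl; apply: time_change_intro.
- move=> s t s0 st /=; apply: time_change_homo => //.
    exact: time_change_ge0.
  exact: time_change_homo.
- by move=> t t0 /=; do 2 apply: time_change_ge0 => //.
- move=> y /(time_change_surj tk)[u u0 <-].
  by have [t t0 <-] := time_change_surj tl u0; exists t.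
Qed.

(** Matches an interval of constancy of the trace, of length [w], with the block of steps of total
    length [r * w] that represents it in the sampled path. Beyond the window it is a translation, so
    that further stretches can be composed. *)
Definition stretch (R : realType) (p w r s : R) : R :=
  if s < p then s else if s < p + w then p + r * (s - p) else s + (r - 1) * w.

Lemma time_change_stretch (R : realType) (p w r : R) :
  0 <= p -> 0 < w -> 0 < r -> time_change (stretch p w r).
Proof.
move=> p0 w0 r0; rewrite /stretch; apply: time_change_intro.
- move=> s t s0 st; do ! case: ifPn; rewrite -?leNgt => *; try nra.
- move=> t t0; do ! case: ifPn; rewrite -?leNgt => *; try nra.
- move=> y y0; have [yp|py] := ltP y p; first by exists y => //; rewrite yp.
  have [yw|wy] := ltP y (p + r * w).
    have z0 : 0 <= (y - p) / r by rewrite divr_ge0 ?subr_ge0 // ltW.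
    exists (p + (y - p) / r); first by rewrite addr_ge0.
    have zw : (y - p) / r < w by rewrite ltr_pdivrMr //; nra.
    rewrite ltNge lerDl z0 /= ltrD2l zw addrAC subrr add0r mulrC divfK ?gt_eqF //.
    by rewrite addrCA subrr addr0.
  exists (y - (r - 1) * w); first nra.
  have -> : (y - (r - 1) * w < p) = false by apply/negbTE; rewrite -leNgt; nra.
  have -> : (y - (r - 1) * w < p + w) = false by apply/negbTE; rewrite -leNgt; nra.
  by rewrite subrK.
Qed.

Lemma stretch_dist (R : realType) (p w r s : R) : 0 < w ->
  `|stretch p w r s - s| <= `|r - 1| * w.
Proof.
move=> w0; rewrite /stretch; case: ifPn => sp.
  by rewrite subrr normr0 mulr_ge0 // ltW.
rewrite -leNgt in sp; case: ifPn => sw.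
  rewrite (_ : _ - s = (r - 1) * (s - p)); last by ring.
  rewrite normrM ler_wpM2l // ger0_norm ?subr_ge0 //; lra.
by rewrite addrAC subrr add0r normrM (gtr0_norm w0).
Qed.

(** A diagonal choice: for each [n], take a time change valid at the largest level [k <= n] for
    which one exists, where level [k] means accuracy [1 / (k + 1)] and equality on [[0, k]]. Levels
    are nested, so it is valid at every lower level too, and each level is eventually available. *)
Lemma skorokhod_crit (R : realType) (T : Type) (x : nat -> dpath R T)
    (y : dpath R T) :
  (forall m e : R, 0 < e -> \forall n \near \oo, exists l : R -> R,
     [/\ time_change l, forall t, 0 <= t -> `|l t - t| <= e &
         forall t, 0 <= t <= m -> x n (l t) = y t]) ->
  skorokhod_cvg x y.
Proof.
move=> H.
pose good n k (l : R -> R) := [/\ time_change l,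
  forall t, 0 <= t -> `|l t - t| <= k.+1%:R^-1 &
  forall t, 0 <= t <= k%:R -> x n (l t) = y t].
have ex_l n : exists l, time_change l /\
    forall k, (k <= n)%N -> (exists l', good n k l') -> good n k l.
  pose P k := (k <= n)%N && `[< exists l', good n k l' >].
  have [exP|nP] := pselect (exists k, P k); last first.
    exists id; split=> [|k kn gk]; first exact: time_change_id.
    by case: nP; exists k; rewrite /P kn; apply/asboolP.
  have bP k : P k -> (k <= n)%N by case/andP.
  case: (ex_maxnP exP bP) => i /andP[lein /asboolP[l gl]] imax.
  exists l; split=> [|k kn gk]; first by case: gl.
  have ki : (k <= i)%N by apply: imax; rewrite /P kn; apply/asboolP.
  case: gl => tl dl xl; split => // t; first move=> t0.
    apply: le_trans (dl _ t0) _.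
    by rewrite lef_pV2 ?posrE ?ltr0n // ler_nat.
  by move=> /andP[t0 tk]; apply: xl; rewrite t0 (le_trans tk) // ler_nat.
have [l Hl] := choice ex_l.
have ev k : \forall n \near \oo, good n k (l n).
  have : \forall n \near \oo, exists l', good n k l'.
    apply: (H k%:R k.+1%:R^-1); first by rewrite invr_gt0 ltr0n.
  move=> Hk; near=> n.
  apply: (Hl n).2; first by near: n; exact: nbhs_infty_ge.
  by near: n.
exists l; split.
- by move=> n; case: (Hl n).
- move=> e e0; pose k := Num.truncn e^-1.
  have ke : k.+1%:R^-1 <= e.
    rewrite -[leRHS]invrK lef_pV2 ?posrE ?ltr0n ?invr_gt0 //.
    by rewrite ltW // truncnS_gt.
  near=> n; have [_ + _] : good n k (l n) by near: n; exact: ev.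
  by move=> d t t0; apply: le_trans ke; apply: d.
- move=> m; pose k := (Num.truncn m).+1.
  have mk : m <= k%:R by rewrite ltW // truncnS_gt.
  near=> n; have [_ _ +] : good n k (l n) by near: n; exact: ev.
  by move=> d t /andP[t0 tm]; apply: d; rewrite t0 (le_trans tm).
Unshelve. all: by end_near.
Qed.

(* Only sequential continuity of [F] is available: the topology is defined
   through convergent sequences. *)
Lemma skorokhod_continuous_cvg (R : realType) (T : Type)
    (F : dpath R T -> R) (x : nat -> dpath R T) (y : dpath R T) :
  continuous F -> skorokhod_cvg x y -> F (x n) @[n --> \oo] --> F y.
Proof.
move=> cF xy V /(cF y); rewrite nbhsE /= => -[U [oU Uy] UV].
have := oU _ _ xy Uy; apply: filterS => n Un; exact: UV.
Qed.


(** * Paths sampled on a grid *)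

Lemma half_exp_gt0 (R : realType) n : 0 < 2^-1 ^+ n :> R.
Proof. by rewrite exprn_gt0 // invr_gt0. Qed.

Lemma half_exp_cvg0 (R : realType) : (2^-1 ^+ n : R) @[n --> \oo] --> 0.
Proof. by apply: cvg_expr; rewrite ger0_norm ?invr_ge0 // invf_lt1 // ltr1n. Qed.

Lemma cvg_divff (R : realType) (h : nat -> R) : (forall n, 0 < h n) ->
  h n / h n @[n --> \oo] --> (1 : R).
Proof.
by move=> h0; under eq_fun do rewrite divff ?gt_eqF //; exact: cvg_cst.
Qed.

(* The number of grid points [j h] below [u]. *)
Definition cells (R : realType) (h u : R) : nat := `|Num.ceil (u / h)|%N.

Lemma cellsP (R : realType) (h u : R) j : 0 < h -> 0 <= u ->
  (j < cells h u)%N = (j%:R * h < u).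
Proof.
move=> h0 u0; rewrite /cells -ltz_nat gez0_abs.
  by rewrite ceil_gt_int ltr_pdivlMr // natz.
by rewrite ceil_ge0 (lt_le_trans _ (divr_ge0 u0 (ltW h0))) // ltrN10.
Qed.

Lemma cells_itv (R : realType) (h u : R) : 0 < h -> 0 <= u ->
  u <= (cells h u)%:R * h < u + h.
Proof.
move=> h0 u0; rewrite leNgt -(cellsP _ h0 u0) ltnn /=.
case E : (cells h u) => [|n]; first by rewrite mul0r ltr_wpDl.
by rewrite -natr1 mulrDl mul1r ltrD2r -(cellsP _ h0 u0) E.
Qed.

Lemma cells_mono (R : realType) (h u v : R) : 0 < h -> 0 <= u -> u <= v ->
  (cells h u <= cells h v)%N.
Proof.
move=> h0 u0 uv; rewrite leqNgt; apply/negP.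
rewrite cellsP // => /lt_le_trans - /(_ _ uv).
by rewrite -cellsP ?ltnn // (le_trans u0).
Qed.

Definition skeleton (R : realType) (T : Type) (f : R -> T) (h : R) (J : nat) :=
  [seq f (j%:R * h) | j <- iota 0 J].

Lemma skeletonD (R : realType) (T : Type) (f : R -> T) h i J : (i <= J)%N ->
  skeleton f h J = skeleton f h i ++ [seq f (j%:R * h) | j <- iota i (J - i)].
Proof. by move=> iJ; rewrite /skeleton -{1}(subnKC iJ) iotaD map_cat. Qed.

Lemma skeleton_step (R : realType) (T : Type) (f : R -> T) h u v :
  0 < h -> 0 <= u -> u <= v -> (forall w, u <= w < v -> f w = f u) ->
  skeleton f h (cells h v) =
  skeleton f h (cells h u) ++ nseq (cells h v - cells h u) (f u).
Proof.
move=> h0 u0 uv fuv; have cuv := cells_mono h0 u0 uv.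
rewrite (skeletonD _ _ cuv); congr cat.
move: (cells h u) (cells h v) cuv (fun j => cellsP j h0 u0)
  (fun j => cellsP j h0 (le_trans u0 uv)) => i k ik Pi Pk.
have : forall j, (i <= j < i + (k - i))%N -> f (j%:R * h) = f u.
  move=> j; rewrite subnKC // => /andP[ij jk]; apply: fuv.
  by rewrite leNgt -Pi -leqNgt ij -Pk.
move: (k - i)%N => m {Pi ik}.
elim: m i => [//|m IH] i H /=; rewrite H; last by rewrite leqnn /= addnS ltnS leq_addr.
congr cons; apply: IH => j /andP[ij jm]; apply: H.
by rewrite (ltnW ij) -addSnnS.
Qed.

Definition step_path (R : realType) (T : Type) (a : T) (h : R) (s : seq T) :
    R -> T :=
  fun t => nth a s (Num.truncn (t / h)).

Lemma cadlag_step_path (R : realType) (T : Type) (a : T) (h : R) (s : seq T) :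
  0 < h -> cadlag (step_path a h s).
Proof.
move=> h0; rewrite /step_path; split=> t.
  move=> t0; have /truncn_itv/andP[kt tk] : 0 <= t / h by rewrite divr_ge0 // ltW.
  set k := Num.truncn _ in kt tk *.
  apply: (@ex_at_right _ _ (k.+1%:R * h - t)).
    by rewrite subr_gt0 -ltr_pdivrMr.
  move=> u /andP[tu uk]; congr nth; apply: truncn_def.
  rewrite (le_trans kt) /=; last by rewrite ler_pM2r ?invr_gt0 // ltW.
  by rewrite ltr_pdivrMr //; lra.
(* [k] is the last index with [k h < t]: at a grid point the left limit is the value held before
   [t]. *)
move=> t0; pose k := (cells h t).-1.
have ck : cells h t = k.+1.
  by rewrite /k prednK // cellsP ?mul0r // ltW.
exists (nth a s k); apply: (@ex_at_left _ _ (t - k%:R * h)).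
  by rewrite subr_gt0 -cellsP ?(ltW t0) // ck.
move=> u /andP[ku ut]; congr nth; apply: truncn_def.
rewrite ler_pdivlMr // ltr_pdivrMr //; apply/andP; split; first lra.
by apply: lt_le_trans ut _; rewrite leNgt -cellsP ?ltW // ck ltnn.
Qed.

(** * Pathwise convergence of the sampled trace *)

Section sampling.
Variables (R : realType) (T : Type) (p : pred T) (f : R -> T).
Hypothesis cf : cadlag f.

Let A : set T := [set x | p x].
Let occ := roccupation A f.
Let cnt h u : nat := count p (skeleton f h (cells h u)).

Variables (h h' : nat -> R).
Hypotheses (h_gt0 : forall n, 0 < h n) (h'_gt0 : forall n, 0 < h' n).
Hypotheses (h_cvg0 : h n @[n --> \oo] --> 0).
Hypotheses (hh' : h' n / h n @[n --> \oo] --> (1 : R)).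

Lemma cvg_cells u : 0 <= u -> h' n * (cells (h n) u)%:R @[n --> \oo] --> u.
Proof.
move=> u0; rewrite (_ : (fun n => _) =
    (fun n => (h' n / h n) * ((cells (h n) u)%:R * h n))); last first.
  by apply/funext => n /=; field; rewrite gt_eqF.
rewrite -{2}[u]mul1r; apply: cvgM => //.
apply: (@squeeze_cvgr _ _ _ _ (fun=> u) (fun n => u + h n)).
- apply: nearW => n; have /andP[-> /ltW ->] // := cells_itv (h_gt0 n) u0.
- exact: cvg_cst.
- by rewrite -[X in _ --> X]addr0; apply: cvgD => //; exact: cvg_cst.
Qed.

Lemma cnt_step u v n : 0 <= u -> u <= v ->
  (forall w, u <= w < v -> f w = f u) ->
  cnt (h n) v = (cnt (h n) u + p (f u) * (cells (h n) v - cells (h n) u))%N.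
Proof.
by move=> u0 uv fuv; rewrite /cnt (skeleton_step (h_gt0 n) u0 uv fuv)
  count_cat count_nseq.
Qed.

(** Grid points are spaced by [h] and each recorded visit lasts [h']. On an interval of constancy
    either all grid points count or none does, so the claim propagates from jump to jump. *)
Lemma cvg_cnt u : 0 <= u -> h' n * (cnt (h n) u)%:R @[n --> \oo] --> occ u.
Proof.
apply: (cadlag_ind (C := fun u => h' n * (cnt (h n) u)%:R @[n --> \oo] --> occ u)
          cf) => {u} [|u v u0 uv IH fuv].
  rewrite /occ roccupation0 // (_ : (fun n => _) = fun=> 0); first exact: cvg_cst.
  apply/funext => n; rewrite /cnt (_ : cells _ _ = 0%N) ?mulr0 //.
  by apply/eqP; rewrite -leqn0 leqNgt cellsP // mul0r ltxx.
have v0 := le_trans u0 (ltW uv).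
rewrite /occ (roccupation_step A cf u0 (ltW uv) fuv) -/occ.
rewrite (_ : (fun n => _) = (fun n => h' n * (cnt (h n) u)%:R +
   (h' n * (cells (h n) v)%:R - h' n * (cells (h n) u)%:R) * (p (f u))%:R)).
  apply: cvgD => //; rewrite indicE.
  rewrite (_ : (f u \in A) = p (f u)); last by apply/idP/idP; rewrite in_setE.
  by apply: cvgM; [apply: cvgB; exact: cvg_cells|exact: cvg_cst].
apply/funext => n; rewrite (cnt_step n u0 (ltW uv) fuv).
rewrite natrD natrM natrB ?cells_mono // ?ltW //; ring.
Qed.

Variables (J M : nat -> nat).
Hypotheses (hJ : forall u, \forall n \near \oo, u <= (J n)%:R * h n).
Hypotheses (hM : forall u, \forall n \near \oo, u <= (M n)%:R * h n).

(** Induction along the jumps of the path. The third clause is the invariant that makes it work: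
    past [occ u] the time change is the translation by the discrepancy accumulated so far, so the
    next interval is treated by composing with one [stretch]. An interval outside [p] changes
    neither the clock nor the list of visits. *)
Lemma sampled_trace_homeo (a : T) u : 0 <= u ->
  forall e, 0 < e -> \forall n \near \oo, exists l : R -> R,
  [/\ time_change l, forall t, 0 <= t -> `|l t - t| <= e,
      forall t, occ u <= t -> l t = t + (h' n * (cnt (h n) u)%:R - occ u) &
      forall t, 0 <= t < occ u ->
        step_path a (h' n) (take (M n) (seq.filter p (skeleton f (h n) (J n)))) (l t)
        = f (trace_clock A f t)].
Proof.
apply: (cadlag_ind (C := fun u => forall e, 0 < e -> \forall n \near \oo,
  exists l : R -> R, [/\ time_change l, forall t, 0 <= t -> `|l t - t| <= e,
      forall t, occ u <= t -> l t = t + (h' n * (cnt (h n) u)%:R - occ u) &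
      forall t, 0 <= t < occ u ->
        step_path a (h' n) (take (M n) (seq.filter p (skeleton f (h n) (J n)))) (l t)
        = f (trace_clock A f t)]) cf) => {u} [|u v u0 uv IH fuv] e e0.
  apply: nearW => n; exists id; rewrite /occ roccupation0 //; split.
  - exact: time_change_id.
  - by move=> t t0; rewrite subrr normr0 ltW.
  - move=> t t0; rewrite /cnt (_ : cells _ _ = 0%N) ?mulr0 ?subr0 ?addr0 //.
    by apply/eqP; rewrite -leqn0 leqNgt cellsP // mul0r ltxx.
  - by move=> t /andP[t0 /(le_lt_trans t0)]; rewrite ltxx.
have v0 := le_trans u0 (ltW uv).
have occv : occ v = occ u + (v - u) * \1_A (f u).
  exact: (roccupation_step A cf u0 (ltW uv) fuv).
have [pu|npu] := boolP (p (f u)); last first.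
  have ouv : occ v = occ u.
    by rewrite occv indicE memNset ?mulr0 ?addr0 //; exact/negP.
  apply: filterS (IH e e0) => n [l [tl dl tail eql]].
  exists l; rewrite ouv (cnt_step n u0 (ltW uv) fuv) (negbTE npu) mul0n addn0.
  by split.
have {}occv : occ v = occ u + (v - u) by rewrite occv indicE mem_set ?mulr1.
have cdiff : h' n * (cnt (h n) v)%:R - h' n * (cnt (h n) u)%:R @[n --> \oo]
     --> v - u.
  rewrite (_ : v - u = occ v - occ u); last by rewrite occv; ring.
  by apply: cvgB; apply: cvg_cnt.
have e2 : 0 < e / 2 by rewrite divr_gt0.
have w0 : 0 < v - u by rewrite subr_gt0.
near=> n.
have [l [tl dl tail eql]] : exists l : R -> R,
   [/\ time_change l, forall t, 0 <= t -> `|l t - t| <= e / 2,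
      forall t, occ u <= t -> l t = t + (h' n * (cnt (h n) u)%:R - occ u) &
      forall t, 0 <= t < occ u ->
        step_path a (h' n) (take (M n) (seq.filter p (skeleton f (h n) (J n)))) (l t)
        = f (trace_clock A f t)].
  near: n; exact: IH.
set q := h' n * (cnt (h n) u)%:R in tail.
set q' := h' n * (cnt (h n) v)%:R.
have dq : `|(v - u) - (q' - q)| <= e / 2.
  by rewrite /q /q'; near: n; move/cvgrPdist_le : cdiff; apply.
have q'q : 0 < q' - q.
  rewrite /q /q'; near: n; move/cvgrPdist_lt : cdiff => /(_ _ w0).
  by apply: filterS => k; rewrite ltr_norml => /andP[_]; lra.
have vJ : v <= (J n)%:R * h n by near: n.
have vM : v <= (M n)%:R * h n by near: n.
(* This slope sends the stay of the trace, of length [v - u], onto the block [[q, q')] of sampled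
   steps. The error [e] is shared equally between the previous time change and this block. *)
pose r := (q' - q) / (v - u).
have r0 : 0 < r by rewrite divr_gt0.
have q0 : 0 <= q by rewrite mulr_ge0 // ltW.
have rw : r * (v - u) = q' - q by rewrite /r divfK ?gt_eqF.
have ou0 : 0 <= occ u by exact: roccupation_ge0.
have lq : l (occ u) = q by rewrite tail //; ring.
exists (stretch q (v - u) r \o l); split.
- by apply: time_change_comp => //; apply: time_change_stretch.
- move=> t t0 /=; rewrite -(subrKA (l t)) (le_trans (ler_normD _ _)) //.
  rewrite [e]splitr lerD ?dl //; apply: le_trans (stretch_dist _ _ _ w0) _.
  rewrite -(gtr0_norm w0) -normrM mulrBl mul1r rw distrC; exact: dq.
- move=> t; rewrite occv => ovt /=.
  rewrite tail; last by apply: le_trans ovt; rewrite lerDl ltW.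
  rewrite /stretch.
  have -> : (t + (q - occ u) < q) = false by apply/negbTE; rewrite -leNgt; lra.
  have -> : (t + (q - occ u) < q + (v - u)) = false.
    by apply/negbTE; rewrite -leNgt; lra.
  by rewrite mulrBl mul1r rw; ring.
move=> t /andP[t0]; rewrite occv => tov /=.
have [tou|out] := ltP t (occ u).
  rewrite /stretch (_ : l t < q); first by apply: eql; rewrite t0.
  by rewrite -lq; exact: time_change_homo.
set s := stretch _ _ _ _.
have sE : s = q + r * (t - occ u).
  rewrite /s tail // /stretch.
  have -> : (t + (q - occ u) < q) = false by apply/negbTE; rewrite -leNgt; lra.
  have -> : (t + (q - occ u) < q + (v - u)) = true by lra.
  by congr (_ + _ * _); ring.
have qs : q <= s by rewrite sE lerDl mulr_ge0 ?subr_ge0 // ltW.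
have sq' : s < q'.
  rewrite sE (_ : q' = q + r * (v - u)); last by rewrite rw; ring.
  by rewrite ltrD2l ltr_pM2l //; lra.
have fS : f (trace_clock A f t) = f u.
  rewrite (trace_clock_step cf u0 uv fuv) //; last first.
    by rewrite -/occ out occv.
  apply: fuv; rewrite -/occ; apply/andP; split; lra.
rewrite fS /step_path.
set i := Num.truncn _.
have s0 : 0 <= s := le_trans q0 qs.
have ci : (cnt (h n) u <= i)%N.
  by rewrite truncn_ge_nat ?(divr_ge0 s0 (ltW (h'_gt0 n))) // ler_pdivlMr // mulrC.
have ic : (i < cnt (h n) v)%N.
  by rewrite truncn_lt_nat ?(divr_ge0 s0 (ltW (h'_gt0 n))) // ltr_pdivrMr // mulrC.
have cJ : (cells (h n) v <= J n)%N by rewrite leqNgt cellsP // -leNgt.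
have cM : (cells (h n) v <= M n)%N by rewrite leqNgt cellsP // -leNgt.
have cvM : (cnt (h n) v <= cells (h n) v)%N.
  by rewrite /cnt (leq_trans (count_size _ _)) // size_map size_iota.
rewrite nth_take; last exact: leq_trans ic (leq_trans cvM cM).
rewrite (skeletonD _ _ cJ) filter_cat nth_cat size_filter ic.
rewrite (skeleton_step (h_gt0 n) u0 (ltW uv) fuv) filter_cat nth_cat.
rewrite size_filter ltnNge ci /= filter_nseq pu mul1n nth_nseq ifT //.
rewrite ltn_subLR //.
by move: ic; rewrite (cnt_step n u0 (ltW uv) fuv) pu mul1n.
Unshelve. all: by end_near.
Qed.

(** The clock is affine during stays in [p] and jumps over the excursions, so the trace is piecewise
    constant. Unbounded occupation makes the stays cover every time [t]. *)
Lemma cadlag_trace (V : Type) (g : T -> V) :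
  (forall m, exists2 u, 0 <= u & m < occ u) ->
  cadlag (fun t => g (f (trace_clock A f t))).
Proof.
move=> unb.
suff H u : 0 <= u ->
  (forall t, 0 <= t < occ u ->
     \forall s \near t^'+, f (trace_clock A f s) = f (trace_clock A f t)) /\
  (forall t, 0 < t <= occ u ->
     exists x, \forall s \near t^'-, f (trace_clock A f s) = x).
  split=> t t0.
    have [u u0 tu] := unb t; have [+ _] := H u u0.
    by move=> /(_ t); rewrite t0 tu => /(_ isT); apply: filterS => s ->.
  have [u u0 tu] := unb t; have [_] := H u u0.
  by move=> /(_ t); rewrite t0 (ltW tu) => /(_ isT)[x xs]; exists (g x);
     apply: filterS xs => s ->.
move: u; apply: (cadlag_ind (C := fun u => (forall t, 0 <= t < occ u ->
     \forall s \near t^'+, f (trace_clock A f s) = f (trace_clock A f t)) /\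
  (forall t, 0 < t <= occ u ->
     exists x, \forall s \near t^'-, f (trace_clock A f s) = x)) cf).
  rewrite /occ roccupation0 //; split=> t /andP[t0].
    by move=> /(le_lt_trans t0); rewrite ltxx.
  by move=> /(lt_le_trans t0); rewrite ltxx.
move=> u v u0 uv [IHr IHl] fuv.
have occv : occ v = occ u + (v - u) * \1_A (f u).
  exact: (roccupation_step A cf u0 (ltW uv) fuv).
have [pu|npu] := boolP (p (f u)); last first.
  by rewrite occv indicE memNset ?mulr0 ?addr0 //; exact/negP.
have {}occv : occ v = occ u + (v - u) by rewrite occv indicE mem_set ?mulr1.
have fS t : occ u <= t < occ v -> f (trace_clock A f t) = f u.
  move=> ot; rewrite (trace_clock_step cf u0 uv fuv) //; apply: fuv.
  by move/andP: ot; rewrite -/occ occv; lra.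
split=> t /andP[t0 tv].
  have [tu|ut] := ltP t (occ u); first by apply: IHr; rewrite t0.
  apply: (@ex_at_right _ _ (occ v - t)); first by rewrite subr_gt0.
  move=> s /andP[ts sv]; rewrite !fS // ?ut //.
  by rewrite (le_trans ut) ?ltW //=; lra.
have [tu|ut] := leP t (occ u); first by apply: IHl; rewrite t0.
exists (f u); apply: (@ex_at_left _ _ (t - occ u)); first by rewrite subr_gt0.
move=> s /andP[us st]; apply: fS; rewrite (lt_le_trans st tv) andbT; lra.
Qed.

Lemma sampled_trace_cvg (V : Type) (g : T -> V) (a : T)
    (x : nat -> dpath R V) (y : dpath R V) :
  (forall m, exists2 u, 0 <= u & m < occ u) ->
  (forall n t, 0 <= t -> x n t = g (step_path a (h' n)
      (take (M n) (seq.filter p (skeleton f (h n) (J n)))) t)) ->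
  (forall t, 0 <= t -> y t = g (f (trace_clock A f t))) ->
  skorokhod_cvg x y.
Proof.
move=> unb xE yE; apply: skorokhod_crit => m e e0.
have [u u0 mu] := unb m.
apply: filterS (sampled_trace_homeo a u0 e0) => n [l [tl dl _ eql]].
exists l; split => // t /andP[t0 tm].
rewrite xE; last exact: time_change_ge0.
by rewrite yE // eql // t0 (le_lt_trans tm).
Qed.

End sampling.


(** * Means over finitely many times *)

Fixpoint seqs (T : finType) (n : nat) : seq (seq T) :=
  if n is n'.+1 then [seq y :: l | y <- enum T, l <- seqs T n'] else [:: [::]].

Lemma seqs_sum (R : pzRingType) (T : finType) (G : seq T -> R) (l : seq T) :
  \sum_(z <- seqs T (size l)) G z * (l == z)%:R = G l.
Proof.
elim: l G => [|x l IH] G /=; first by rewrite big_seq1 eqxx mulr1.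
rewrite big_allpairs_dep /= big_enum /= (bigD1 x) //=.
rewrite [X in _ + X]big1 => [|y yx].
  rewrite addr0 -[RHS](IH (fun l => G (x :: l))); apply: eq_bigr => z _.
  by rewrite eqseq_cons eqxx.
rewrite big1 // => z _; rewrite eqseq_cons.
by rewrite (_ : (x == y) = false) ?mulr0 // eq_sym; exact/negbTE.
Qed.

(* Expectation of [G] at the chain observed at the times [ts], started at time
   [t] from [x]. *)
Fixpoint fdd_mean (R : realType) (T : finType) (r : T -> T -> R) (t : R) (x : T)
    (ts : seq R) (G : seq T -> R) : R :=
  if ts is u :: ts' then
    \sum_y transition r (u - t) x y * fdd_mean r u y ts' (fun l => G (y :: l))
  else G [::].

Lemma fdd_meanE (R : realType) (T : finType) (r : T -> T -> R) t x ts G :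
  fdd_mean r t x ts G = \sum_(z <- seqs T (size ts)) G z * fdd r t x (zip ts z).
Proof.
elim: ts t x G => [|u ts IH] t x G /=; first by rewrite big_seq1 mulr1.
rewrite big_allpairs_dep /= big_enum /=; apply: eq_bigr => y _.
by rewrite IH mulr_sumr; apply: eq_bigr => z _; rewrite mulrCA.
Qed.

Section markov_chain.
Variables (R : realType) (T : finType) (r : T -> T -> R).
Variables (d : measure_display) (Omega : measurableType d).
Variables (P : probability Omega R) (X : Omega -> dpath R T) (x : T).
Hypothesis HX : is_markov_chain r P X x.

Lemma measurable_states (ts : seq R) (B : set (seq T)) :
  all (fun t => 0 <= t) ts -> measurable [set w | B (map (X w) ts)].
Proof.
elim: ts B => [|t ts IH] B /= => [_|/andP[t0 ts0]].
  have [b|nb] := pselect (B [::]).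
    by rewrite (_ : [set _ | _] = setT) //; apply/seteqP; split.
  by rewrite (_ : [set _ | _] = set0) //; apply/seteqP; split.
rewrite (_ : [set _ | _] = \bigcup_(y in [set: T])
   ([set w | X w t = y] `&` [set w | B (y :: map (X w) ts)])).
  apply: fin_bigcup_measurable => // y _; apply: measurableI.
    exact: HX.1.
  exact: (IH (fun l => B (y :: l))).
by apply/seteqP; split => w /=; [exists (X w t)|case=> y _ [/= ->]].
Qed.

Lemma measurable_fun_states (ts : seq R) d' (S : measurableType d')
    (G : seq T -> S) : all (fun t => 0 <= t) ts ->
  measurable_fun setT (fun w => G (map (X w) ts)).
Proof.
move=> ts0 _ B mB; rewrite setTI.
exact: (measurable_states (G @^-1` B)).
Qed.

Lemma prob_states (ts : seq R) (z : seq T) :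
  path <=%R 0 ts -> size z = size ts ->
  P [set w | map (X w) ts = z] = (fdd r 0 x (zip ts z))%:E.
Proof.
move=> pts sz; rewrite -HX.2; last by rewrite -/(unzip1 _) unzip1_zip // sz.
congr (P _); apply/seteqP; split => w /=.
  move=> <- a; elim: ts {pts sz} => //= t ts IH.
  by rewrite inE => /orP[/eqP ->|/IH].
elim: ts z {pts} sz => [|t ts IH] [|y z] //= [sz] H.
congr cons; first by have := H (t, y); rewrite mem_head => /(_ isT).
by apply: IH => // a az; apply: H; rewrite inE az orbT.
Qed.

Lemma path_ge0 (ts : seq R) : path <=%R 0 ts -> all (fun t => 0 <= t) ts.
Proof. by rewrite path_sortedE; [case/andP|exact: le_trans]. Qed.

Lemma integral_states (ts : seq R) (G : seq T -> R) :
  path <=%R 0 ts -> (forall l, 0 <= G l) ->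
  (\int[P]_w (G (map (X w) ts))%:E = (fdd_mean r 0 x ts G)%:E)%E.
Proof.
move=> pts G0; have ts0 := path_ge0 pts.
pose E z := [set w | map (X w) ts = z].
have mE z : measurable (E z) by exact: (measurable_states [set z] _).
under eq_integral => w _.
  rewrite -(seqs_sum G) size_map -sumEFin.
  rewrite (eq_bigr (fun z => (G z * \1_(E z) w)%:E)); last first.
    move=> z _; rewrite indicE; congr (_ * (nat_of_bool _)%:R)%:E.
    by apply/eqP/idP; rewrite in_setE.
  over.
rewrite ge0_integral_sum //; last 2 first.
- by move=> z; apply/measurable_EFinP; apply: measurable_funM => //.
- by move=> z w _; rewrite lee_fin mulr_ge0.
rewrite fdd_meanE -sumEFin; rewrite big_seq_cond [RHS]big_seq_cond.
apply: eq_bigr => z; rewrite andbT => zs.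
have sz : size z = size ts.
  elim: (ts) z zs => [|t ts' IH] z /=; first by rewrite inE => /eqP ->.
  by case/allpairsPdep => y [l [_ /IH <- ->]].
rewrite (integralZl_indic measurableT (fun=> E z)) //; last by rewrite ltNge G0.
by rewrite integral_indic // setIT EFinM -prob_states.
Qed.

End markov_chain.


(** * The transition function *)

Lemma cvgn_unique (R : realType) (u : nat -> R) (a b : R) :
  u n @[n --> \oo] --> a -> u n @[n --> \oo] --> b -> a = b.
Proof. by move=> ua ub; apply: cvg_unique ua ub; exact: Rhausdorff. Qed.

Section transition_series.
Variables (R : realType) (T : finType) (r : T -> T -> R).

Let Q := generator r.

Definition gen_bound : R := \sum_i \sum_j `|Q i j|.

Lemma gen_bound_ge0 : 0 <= gen_bound.
Proof. by apply: sumr_ge0 => i _; apply: sumr_ge0. Qed.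

Lemma generator_expS n i j : (Q ^+ n.+1) i j = \sum_k Q i k * (Q ^+ n) k j.
Proof. by rewrite exprS -[Q * _]/(Q *m _) mxE. Qed.

Lemma generator_exp_le n i j : `|(Q ^+ n) i j| <= gen_bound ^+ n.
Proof.
elim: n i => [|n IH] i.
  by rewrite expr0 -[1]/(1%:M) mxE; case: eqP; rewrite ?normr1 ?normr0.
rewrite generator_expS (le_trans (ler_norm_sum _ _ _)) //.
apply: (@le_trans _ _ (\sum_k `|Q i k| * gen_bound ^+ n)).
  by apply: ler_sum => k _; rewrite normrM ler_wpM2l.
rewrite -mulr_suml exprS ler_wpM2r ?exprn_ge0 ?gen_bound_ge0 //.
rewrite /gen_bound [leRHS](bigD1 i) //= lerDl sumr_ge0 // => k _.
by apply: sumr_ge0.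
Qed.

Lemma transition_cvg t x y :
  series (fun n => exp_coeff t n * (Q ^+ n) (enum_rank x) (enum_rank y))
    @ \oo --> transition r t x y.
Proof.
apply: (@normed_cvg R R^o).
apply: (@series_le_cvg _ _ (exp_coeff (`|t| * gen_bound))) => [n|n|n|] /=.
- exact: normr_ge0.
- by rewrite exp_coeff_ge0 // mulr_ge0 // gen_bound_ge0.
- have -> : exp_coeff (`|t| * gen_bound) n = `|exp_coeff t n| * gen_bound ^+ n.
    rewrite /exp_coeff /= normrM normrX [`|_^-1|]ger0_norm ?invr_ge0 //.
    by rewrite exprMn mulrAC.
  by rewrite normrM ler_wpM2l // generator_exp_le.
- exact: is_cvg_series_exp_coeff.
Qed.

(** For [t <= 1] all powers from the second on are at most [t ^+ 2], so the tail of the series is at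
    most [t ^+ 2] times the exponential series at [gen_bound]. *)
Lemma transition_first_order : exists2 K : R, 0 <= K &
  forall t x y, 0 <= t <= 1 ->
  `|transition r t x y - ((x == y)%:R + t * Q (enum_rank x) (enum_rank y))|
    <= K * t ^+ 2.
Proof.
exists (expR gen_bound); first exact: expR_ge0.
move=> t x y /andP[t0 t1].
pose S := series (fun n => exp_coeff t n * (Q ^+ n) (enum_rank x) (enum_rank y)).
pose c := (x == y)%:R + t * Q (enum_rank x) (enum_rank y).
have SL : `|S n - c| @[n --> \oo] --> `|transition r t x y - c|.
  by apply: cvg_norm; apply: cvgB; [exact: transition_cvg|exact: cvg_cst].
apply: (ler_cvg_to SL (cvg_cst _)); near=> n.
have : (2 <= n)%N by near: n; exact: nbhs_infty_ge.
case: (n) => [|[|k]] // _.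
rewrite /S /series /= !big_nat_recl //= /exp_coeff /= expr0 expr1 !fact0 /=.
rewrite !invr1 !mulr1 mul1r expr0 -[1]/(1%:M) mxE expr1.
rewrite (inj_eq enum_rank_inj) /c addrA (addrC _ (\sum_(_ <= _ < _) _)) addrK.
rewrite (le_trans (ler_norm_sum _ _ _)) //.
apply: (@le_trans _ _ (\sum_(0 <= i < k) t ^+ 2 * exp_coeff gen_bound i.+2)).
  apply: ler_sum => i _.
  rewrite normrM normrM [`|_^-1|]ger0_norm ?invr_ge0 // normrX ger0_norm //.
  rewrite /exp_coeff /= (mulrC (gen_bound ^+ _)) mulrA.
  apply: ler_pM => //; first by rewrite mulr_ge0 ?invr_ge0 ?exprn_ge0.
    by rewrite ler_wpM2r ?invr_ge0 // ler_wiXn2l.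
  exact: generator_exp_le.
rewrite -mulr_sumr mulrC ler_wpM2r ?exprn_ge0 //.
apply: (@le_trans _ _ (series (exp_coeff gen_bound) k.+2)).
  rewrite /series /= !big_nat_recl //= addrA lerDr addr_ge0 // exp_coeff_ge0 //.
    exact: gen_bound_ge0.
  exact: gen_bound_ge0.
apply: nondecreasing_cvgn_le; last exact: is_cvg_series_exp_coeff.
apply: nondecreasing_series => i _ _; apply: exp_coeff_ge0.
exact: gen_bound_ge0.
Unshelve. all: by end_near.
Qed.

Lemma transition0 x y : transition r 0 x y = (x == y)%:R.
Proof.
have [K K0 /(_ 0 x y)] := transition_first_order.
rewrite lexx ler01 expr0n /= mulr0 mul0r addr0 => /(_ isT).
by rewrite normr_le0 subr_eq0 => /eqP.
Qed.

Lemma generator_offdiag x y : x != y -> Q (enum_rank x) (enum_rank y) = r x y.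
Proof.
by move=> xy; rewrite mxE (inj_eq enum_rank_inj) (negbTE xy) !enum_rankK.
Qed.

(** Detailed balance passes from the generator to its powers, and from these to the exponential
    series. *)
Lemma transition_reversible (mu : T -> R) t x y :
  (forall x y, x != y -> mu x * r x y = mu y * r y x) ->
  mu x * transition r t x y = mu y * transition r t y x.
Proof.
move=> Hmu; pose m (i : 'I_#|T|) := mu (enum_val i).
have HQ i j : m i * Q i j = m j * Q j i.
  rewrite /m !mxE; case: (eqVneq i j) => [-> //|ij].
  by rewrite Hmu // (inj_eq enum_val_inj).
have comm n : Q ^+ n.+1 = Q ^+ n *m Q by rewrite exprSr.
have Hn n i j : m i * (Q ^+ n) i j = m j * (Q ^+ n) j i.
  elim: n i j => [|n IH] i j.
    rewrite expr0 -[1]/(1%:M) !mxE eq_sym; case: eqP => [-> //|_].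
    by rewrite !mulr0.
  rewrite generator_expS comm mxE !mulr_sumr; apply: eq_bigr => k _.
  by rewrite mulrA HQ mulrAC IH -!mulrA; congr (_ * _); rewrite mulrC.
pose S x y := series (fun n => exp_coeff t n * (Q ^+ n) (enum_rank x) (enum_rank y)).
have HS (c : R) z w : c * S z w n @[n --> \oo] --> c * transition r t z w.
  by apply: cvgM; [exact: cvg_cst|exact: transition_cvg].
apply: (cvgn_unique (HS (mu x) x y)).
rewrite (_ : (fun n => _) = (fun n => mu y * S y x n)); first exact: HS.
apply/funext => n /=; rewrite /series /= !mulr_sumr; apply: eq_bigr => k _.
by rewrite mulrCA -[mu x](congr1 mu (enum_rankK x)) Hn /m enum_rankK mulrCA.
Qed.

Lemma transition_equivariant (f g : T -> T) t x y :
  cancel f g -> cancel g f ->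
  (forall x y, r (f x) (f y) = r x y) ->
  transition r t (f x) (f y) = transition r t x y.
Proof.
move=> fK gK Hr; pose s (i : 'I_#|T|) : 'I_#|T| := enum_rank (f (enum_val i)).
pose s' (i : 'I_#|T|) : 'I_#|T| := enum_rank (g (enum_val i)).
have sK : cancel s s' by move=> i; rewrite /s /s' enum_rankK fK enum_valK.
have s'K : cancel s' s by move=> i; rewrite /s /s' enum_rankK gK enum_valK.
have bs : bijective s by exists s'.
have HQ i j : Q (s i) (s j) = Q i j.
  rewrite !mxE (inj_eq (can_inj sK)); case: ifP => _; last first.
    by rewrite /s !enum_rankK Hr.
  congr (- _); rewrite (reindex s) /=; last exact: onW_bij.
  apply: eq_big => [k|k _]; first by rewrite (inj_eq (can_inj sK)).
  by rewrite /s !enum_rankK Hr.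
have Hn n i j : (Q ^+ n) (s i) (s j) = (Q ^+ n) i j.
  elim: n i j => [|n IH] i j.
    by rewrite expr0 -[1]/(1%:M) !mxE (inj_eq (can_inj sK)).
  rewrite !generator_expS (reindex s) /=; last exact: onW_bij.
  by apply: eq_bigr => k _; rewrite HQ IH.
rewrite /transition; congr (limn (series _)); apply/funext => n.
by rewrite -[in RHS]Hn /s !enum_rankK.
Qed.

End transition_series.

(** The generator is [c] times the all-one matrix minus [N c] times the identity, hence
    [Q ^+ 2 = - (N c) Q]. All powers are multiples of [Q] and the series sums to a scalar
    exponential. *)
Lemma transition_uniform (R : realType) (T : finType) (c t : R) (x y : T) :
  x != y ->
  transition (fun _ _ : T => c) t x y =
  (1 - expR (- (#|T|%:R * c * t))) / #|T|%:R.
Proof.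
move=> xy; set N := #|T|%:R : R; set Q := generator (fun _ _ : T => c).
have N0 : N != 0.
  by rewrite pnatr_eq0 -lt0n; apply/card_gt0P; exists x.
have M1 i j : (Q ^+ 0) i j = (i == j)%:R.
  by rewrite expr0 -[1]/(1%:M) mxE.
have QE i j : Q i j = c - (i == j)%:R * (N * c).
  rewrite mxE; case: eqVneq => [_|_]; last by rewrite mul0r subr0.
  rewrite sumr_const (cardC1 i) card_ord mul1r -mulr_natl.
  rewrite /N -(@prednK #|T|) ?lt0n -1?(pnatr_eq0 R) //.
  by rewrite -natr1; ring.
have QQ i j : \sum_k Q i k * Q k j = - (N * c) * Q i j.
  under eq_bigr do rewrite QE mulrBl -mulrA.
  rewrite big_split /= sumrN.
  rewrite (bigD1 i) //= -/Q.
  rewrite [X in _ - X](bigD1 i) //= [X in _ - (_ + X)]big1; last first.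
    by move=> k ki; rewrite eq_sym (negbTE ki) mul0r.
  rewrite eqxx mul1r addr0.
  have -> : c * Q i j + \sum_(k | k != i) c * Q k j = c * \sum_k Q k j.
    by rewrite mulr_sumr [RHS](bigD1 i).
  have -> : \sum_k Q k j = 0.
    under eq_bigr do rewrite QE.
    rewrite big_split /= sumrN sumr_const card_ord (bigD1 j) //= big1.
      by rewrite eqxx mul1r addr0 mulr_natl subrr.
    by move=> k /negbTE ->; rewrite mul0r.
  by rewrite mulr0 sub0r mulNr.
have Qn n i j : (Q ^+ n.+1) i j = (- (N * c)) ^+ n * Q i j.
  elim: n i j => [|n IH] i j; first by rewrite expr1 expr0 mul1r.
  rewrite generator_expS; under eq_bigr do rewrite IH mulrCA.
  by rewrite -mulr_sumr QQ exprSr mulrA.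
have S0 : (fun n => (1 - series (exp_coeff (- (N * c * t))) n) / N) @ \oo -->
     (1 - expR (- (N * c * t))) / N.
  apply: cvgM; last exact: cvg_cst.
  apply: cvgB; first exact: cvg_cst.
  exact: is_cvg_series_exp_coeff.
apply: (cvgn_unique (@transition_cvg _ _ _ t x y)).
apply: cvg_trans S0; apply: near_eq_cvg; near=> n.
have : (1 <= n)%N by near: n; exact: nbhs_infty_ge.
case: (n) => // k _.
rewrite /series /= !big_nat_recl //= -/Q M1.
rewrite (inj_eq enum_rank_inj) (negbTE xy) mulr0 add0r.
rewrite {1}/exp_coeff /= expr0 fact0 invr1 mulr1 opprD addrA subrr sub0r.
rewrite mulNr mulr_suml -sumrN; apply: eq_bigr => i _.
rewrite Qn generator_offdiag // /exp_coeff /=.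
rewrite (_ : - (N * c * t) = - (N * c) * t); last by ring.
rewrite exprMn exprS; move: ((- (N * c)) ^+ i) (t ^+ i.+1) => e e'.
have f0 : (i.+1)`!%:R != 0 :> R by rewrite pnatr_eq0 -lt0n fact_gt0.
by move: f0 N0; move: ((i.+1)`!%:R : R) => f f0 N0; field; rewrite ?f0 ?N0.
Unshelve. all: by end_near.
Qed.


(** * The trace of a discrete-time chain *)

(* Expectation of [G] at the first [J] steps (the start [x] excluded) of the
   discrete-time chain with kernel [k]. *)
Fixpoint kmean (R : realType) (T : finType) (k : T -> T -> R) (J : nat) (x : T)
    (G : seq T -> R) : R :=
  if J is J'.+1 then \sum_y k x y * kmean k J' y (fun l => G (y :: l))
  else G [::].

Section kmean.
Variables (R : realType) (T : finType) (k : T -> T -> R).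

Lemma eq_kmean J x (G H : seq T -> R) :
  (forall l, size l = J -> G l = H l) -> kmean k J x G = kmean k J x H.
Proof.
elim: J x G H => [|J IH] x G H GH /=; first exact: GH.
by apply: eq_bigr => y _; congr (_ * _); apply: IH => l sl; apply: GH => /=; rewrite sl.
Qed.

Lemma kmeanZ J x (c : R) (G : seq T -> R) :
  kmean k J x (fun l => c * G l) = c * kmean k J x G.
Proof.
elim: J x G => [//|J IH] x G /=; rewrite mulr_sumr.
by apply: eq_bigr => y _; rewrite IH mulrCA.
Qed.

Lemma kmeanB J x (G H : seq T -> R) :
  kmean k J x (fun l => G l - H l) = kmean k J x G - kmean k J x H.
Proof.
elim: J x G H => [//|J IH] x G H /=; rewrite -sumrB.
by apply: eq_bigr => y _; rewrite IH mulrBr.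
Qed.

Hypothesis k_ge0 : forall x y, 0 <= k x y.

Lemma le_kmean J x (G H : seq T -> R) :
  (forall l, G l <= H l) -> kmean k J x G <= kmean k J x H.
Proof.
elim: J x G H => [|J IH] x G H GH /=; first exact: GH.
by apply: ler_sum => y _; rewrite ler_wpM2l //; apply: IH.
Qed.

Hypothesis k_sum : forall x, \sum_y k x y = 1.

Lemma kmean_cst J x (c : R) : kmean k J x (fun=> c) = c.
Proof.
elim: J x => [//|J IH] x /=; under eq_bigr do rewrite IH.
by rewrite -mulr_suml k_sum mul1r.
Qed.

Lemma kmean_incr J x (G : seq T -> R) :
  (forall l y, G l <= G (rcons l y)) -> kmean k J x G <= kmean k J.+1 x G.
Proof.
elim: J x G => [|J IH] x G HG.
  rewrite /= -[leLHS]mul1r -(k_sum x) mulr_suml; apply: ler_sum => y _.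
  by rewrite ler_wpM2l // (HG [::]).
rewrite [kmean _ _ _ _]/= [leRHS]/=; apply: ler_sum => y _.
by rewrite ler_wpM2l //; apply: IH => l z; rewrite -rcons_cons; exact: HG.
Qed.

End kmean.

(** * First visits, harmonic functions and the trace of a positive kernel *)

Section trace_kernel.
Variables (R : realType) (T : finType) (k : T -> T -> R) (p : pred T).
Hypothesis k_gt0 : forall x y, 0 < k x y.
Hypothesis k_sum : forall x, \sum_y k x y = 1.
Variable a0 : T.
Hypothesis pa0 : p a0.

Let k_ge0 x y : 0 <= k x y := ltW (k_gt0 x y).

(** Maximum principle. A positive maximum would sit outside [p], where it is an average of values
    giving positive weight to the value 0 at [a0]. *)
Lemma harmonic_le0 (u : T -> R) :
  (forall x, p x -> u x = 0) ->
  (forall x, ~~ p x -> u x = \sum_y k x y * u y) -> forall x, u x <= 0.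
Proof.
move=> u0 uh x; case: (Order.TotalTheory.arg_maxP u (erefl : xpredT x)) => z _ zmax.
apply: le_trans (zmax x isT) _; rewrite leNgt; apply/negP => uz.
have npz : ~~ p z by apply/negP => /u0 uz0; rewrite uz0 ltxx in uz.
have : u z < u z; last by rewrite ltxx.
rewrite {1}uh // (bigD1 a0) //= u0 // mulr0 add0r.
apply: (@le_lt_trans _ _ (\sum_(y | y != a0) k z y * u z)).
  by apply: ler_sum => y _; rewrite ler_wpM2l //; exact: zmax.
rewrite -mulr_suml -[ltRHS]mul1r ltr_pM2r // -(k_sum z) [ltRHS](bigD1 a0) //=.
by rewrite ltrDr.
Qed.

Lemma harmonic_unique (u v : T -> R) :
  (forall x, p x -> u x = v x) ->
  (forall x, ~~ p x -> u x = \sum_y k x y * u y) ->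
  (forall x, ~~ p x -> v x = \sum_y k x y * v y) -> u =1 v.
Proof.
move=> uv uh vh.
suff H (f g : T -> R) : (forall x, p x -> f x = g x) ->
    (forall x, ~~ p x -> f x = \sum_y k x y * f y) ->
    (forall x, ~~ p x -> g x = \sum_y k x y * g y) -> forall x, f x <= g x.
  move=> x; apply/eqP; rewrite eq_le H //= H // => y py; exact/esym/uv.
move=> fg fh gh x; rewrite -subr_le0.
apply: (@harmonic_le0 (fun x => f x - g x)) => {x} x px.
  by rewrite fg // subrr.
by rewrite fh // gh // -sumrB; apply: eq_bigr => y _; rewrite mulrBr.
Qed.

(* The value is 0 when [s] visits [p] fewer than [M] times; this makes the mean
   over a horizon [J] nondecreasing in [J] for nonnegative [G]. *)
Definition on_visits (M : nat) (G : seq T -> R) (s : seq T) : R :=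
  if (M <= size [seq z <- s | p z])%N then G (take M [seq z <- s | p z]) else 0.

Lemma on_visits_in M G x s : p x ->
  on_visits M.+1 G (x :: s) = on_visits M (fun l => G (x :: l)) s.
Proof. by rewrite /on_visits /= => ->. Qed.

Lemma on_visits_out M G x s : ~~ p x -> on_visits M G (x :: s) = on_visits M G s.
Proof. by rewrite /on_visits /= => /negbTE ->. Qed.

Lemma on_visits_incr M G s y : (forall l, 0 <= G l) ->
  on_visits M G s <= on_visits M G (rcons s y).
Proof.
move=> G0; rewrite /on_visits -cats1 filter_cat size_cat.
case: ifPn => [Ms|_]; last by case: ifP.
by rewrite (leq_trans Ms (leq_addr _ _)) takel_cat.
Qed.

Lemma on_visits_itv (C : R) M G s : (forall l, 0 <= G l <= C) ->
  0 <= on_visits M G s <= C.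
Proof.
move=> GC; rewrite /on_visits; case: ifP => // _.
by rewrite lexx; case/andP: (GC [::]); exact: le_trans.
Qed.

Definition visits_mean (J M : nat) (x : T) (G : seq T -> R) : R :=
  kmean k J x (fun l => on_visits M G (x :: l)).

Definition visits_lim (M : nat) (x : T) (G : seq T -> R) : R :=
  limn (fun J => visits_mean J M x G).

Lemma visits_mean_in J M x G : p x ->
  visits_mean J.+1 M.+1 x G =
  \sum_y k x y * visits_mean J M y (fun l => G (x :: l)).
Proof.
move=> px; rewrite /visits_mean /=; apply: eq_bigr => y _; congr (_ * _).
by apply: eq_kmean => l _; rewrite on_visits_in.
Qed.

Lemma visits_mean_out J M x G : ~~ p x ->
  visits_mean J.+1 M x G = \sum_y k x y * visits_mean J M y G.
Proof.
move=> px; rewrite /visits_mean /=; apply: eq_bigr => y _; congr (_ * _).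
by apply: eq_kmean => l _; rewrite on_visits_out.
Qed.

Lemma visits_mean1 J x G : p x -> visits_mean J 1 x G = G [:: x].
Proof.
move=> px; rewrite /visits_mean -[RHS](kmean_cst k_sum J x).
apply: eq_kmean => l _; rewrite on_visits_in // /on_visits /=.
by rewrite take0.
Qed.

Lemma cvg_visits (C : R) M x G : (forall l, 0 <= G l <= C) ->
  visits_mean J M x G @[J --> \oo] --> visits_lim M x G.
Proof.
move=> GC; apply: nondecreasing_is_cvgn.
  apply/nondecreasing_seqP => J; apply: kmean_incr => // l y.
  by rewrite -rcons_cons on_visits_incr // => l'; case/andP: (GC l').
exists C => _ [J _ <-]; rewrite -(kmean_cst k_sum J x C).
by apply: le_kmean => // l; case/andP: (on_visits_itv M (x :: l) GC).
Qed.

Arguments cvg_visits {C} M x {G}.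

Lemma visits_lim_ge0 (C : R) M x G : (forall l, 0 <= G l <= C) ->
  0 <= visits_lim M x G.
Proof.
move=> GC; apply: (ler_cvg_to (cvg_cst (0 : R)) (cvg_visits M x GC)).
apply: nearW => J.
rewrite -(kmean_cst k_sum J x 0); apply: le_kmean => // l.
by case/andP: (on_visits_itv M (x :: l) GC).
Qed.

Lemma cvg_kernel_sum (v : nat -> T -> R) (w : T -> R) x :
  (forall y, v J y @[J --> \oo] --> w y) ->
  \sum_y k x y * v J y @[J --> \oo] --> \sum_y k x y * w y.
Proof.
move=> vw; apply: cvg_big => [|y _]; first exact: add_continuous.
by apply: cvgM; [exact: cvg_cst|exact: vw].
Qed.

Lemma visits_lim_in (C : R) M x G : (forall l, 0 <= G l <= C) -> p x ->
  visits_lim M.+1 x G = \sum_y k x y * visits_lim M y (fun l => G (x :: l)).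
Proof.
move=> GC px; have := cvg_visits M.+1 x GC; rewrite -cvg_shiftS => /cvgn_unique.
apply; under eq_fun do rewrite visits_mean_in //.
by apply: cvg_kernel_sum => y; apply: (@cvg_visits C) => l; exact: GC.
Qed.

Lemma visits_lim_out (C : R) M x G : (forall l, 0 <= G l <= C) -> ~~ p x ->
  visits_lim M x G = \sum_y k x y * visits_lim M y G.
Proof.
move=> GC px; have := cvg_visits M x GC; rewrite -cvg_shiftS => /cvgn_unique.
apply; under eq_fun do rewrite visits_mean_out //.
by apply: cvg_kernel_sum => y; apply: (@cvg_visits C) => l; exact: GC.
Qed.

Lemma visits_lim1 x G : p x -> visits_lim 1 x G = G [:: x].
Proof.
move=> px; apply/cvg_lim => //; under eq_fun do rewrite visits_mean1 //.
exact: cvg_cst.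
Qed.

(* The distribution of the first visited point of [p]. *)
Definition first_visit (x a : T) : R :=
  visits_lim 1 x (fun l => (l == [:: a])%:R).

Let indic_itv (a : T) (l : seq T) : 0 <= ((l == [:: a])%:R : R) <= 1.
Proof. by case: eqP; rewrite ?ler01 ?lexx. Qed.

Lemma first_visit_in x a : p x -> first_visit x a = (x == a)%:R.
Proof. by move=> px; rewrite /first_visit visits_lim1 // eqseq_cons andbT. Qed.

Lemma first_visit_out x a : ~~ p x ->
  first_visit x a = \sum_y k x y * first_visit y a.
Proof. exact: visits_lim_out (indic_itv a). Qed.

Lemma first_visit_ge0 x a : 0 <= first_visit x a.
Proof. exact: visits_lim_ge0 (indic_itv a). Qed.

(** Poisson formula: both sides solve the same Dirichlet problem, with values prescribed on [p]. *)
Lemma harmonic_first_visit (v : T -> R) x :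
  (forall x, ~~ p x -> v x = \sum_y k x y * v y) ->
  v x = \sum_(a | p a) first_visit x a * v a.
Proof.
move=> vh; move: x; apply: harmonic_unique => // x px.
  rewrite (bigD1 x) //= first_visit_in // eqxx mul1r big1 ?addr0 //.
  by move=> a /andP[_ ax]; rewrite first_visit_in // eq_sym (negbTE ax) mul0r.
under [RHS]eq_bigr do rewrite mulr_sumr.
rewrite exchange_big /=; apply: eq_bigr => a pa.
by rewrite first_visit_out // mulr_suml; apply: eq_bigr => y _; rewrite mulrA.
Qed.

(** The constant 1 is harmonic, so the Poisson formula says that [p] is reached almost surely. *)
Lemma first_visit_sum x : \sum_(a | p a) first_visit x a = 1.
Proof.
rewrite [RHS](@harmonic_first_visit (fun=> 1) x).
  by apply: eq_bigr => a _; rewrite mulr1.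
by move=> {}x _; rewrite -mulr_suml k_sum mul1r.
Qed.

Lemma first_visit_le1 x a : p a -> first_visit x a <= 1.
Proof.
move=> pa; rewrite -(first_visit_sum x) (bigD1 a) //= lerDl.
by apply: sumr_ge0 => b _; exact: first_visit_ge0.
Qed.

(* The Schur complement [k_AA + k_AB (1 - k_BB)^-1 k_BA], with [A] the set [p] and
   [B] its complement. *)
Definition trace_kernel (a b : T) : R :=
  if p b then \sum_y k a y * first_visit y b else 0.

(** One visit at a time. As a function of the state after [x], the limiting mean is harmonic off
    [p]; the Poisson formula expresses it by its values at the first visited point, which turns a
    step of [k] into a step of [trace_kernel]. *)
Lemma visits_limE (C : R) M x G : (forall l, 0 <= G l <= C) -> p x ->
  visits_lim M.+1 x G = kmean trace_kernel M x (fun l => G (x :: l)).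
Proof.
elim: M x G => [|M IH] x G GC px; first by rewrite visits_lim1.
have GC' l : 0 <= G (x :: l) <= C by exact: GC.
rewrite (visits_lim_in _ GC) //= [RHS](bigID p) /= [X in _ = _ + X]big1; last first.
  by move=> y /negbTE py; rewrite /trace_kernel py mul0r.
rewrite addr0.
have H y := @harmonic_first_visit (fun y => visits_lim M.+1 y (fun l => G (x :: l)))
  y (fun z pz => visits_lim_out M.+1 GC' pz).
under eq_bigr do rewrite H mulr_sumr.
rewrite exchange_big /=; apply: eq_bigr => a pa.
rewrite -(IH a (fun l => G (x :: l))) // /trace_kernel pa mulr_suml.
by apply: eq_bigr => y _; rewrite mulrA.
Qed.

Lemma first_visit_equivariant (f g : T -> T) x a :
  cancel f g -> cancel g f ->
  (forall x, p (f x) = p x) -> (forall x y, k (f x) (f y) = k x y) ->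
  first_visit (f x) (f a) = first_visit x a.
Proof.
move=> fK gK pf kf; move: x; apply: harmonic_unique => x px.
- by rewrite !first_visit_in ?pf // (inj_eq (can_inj fK)).
- rewrite first_visit_out ?pf // (reindex f) /=; last first.
    by apply: onW_bij; exists g.
  by apply: eq_bigr => y _; rewrite kf.
- exact: first_visit_out.
Qed.

Lemma trace_kernel_equivariant (f g : T -> T) a b :
  cancel f g -> cancel g f ->
  (forall x, p (f x) = p x) -> (forall x y, k (f x) (f y) = k x y) ->
  trace_kernel (f a) (f b) = trace_kernel a b.
Proof.
move=> fK gK pf kf; rewrite /trace_kernel pf; case: ifP => // pb.
rewrite (reindex f) /=; last by apply: onW_bij; exists g.
by apply: eq_bigr => y _; rewrite kf (first_visit_equivariant _ _ fK gK pf kf).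
Qed.

Lemma trace_kernel_sum a : \sum_(b | p b) trace_kernel a b = 1.
Proof.
rewrite (eq_bigr (fun b => \sum_y k a y * first_visit y b)); last first.
  by move=> b pb; rewrite /trace_kernel pb.
rewrite exchange_big /= -(k_sum a); apply: eq_bigr => y _.
by rewrite -mulr_sumr first_visit_sum mulr1.
Qed.

(* Green's identity for the reversible kernel between the escape probability
   [first_visit ^~ s] and the mean hitting time [m] of [p] minus [s]. *)
Lemma mean_hitting_trace (mu m : T -> R) s :
  (forall x, 0 < mu x) -> (forall x y, mu x * k x y = mu y * k y x) -> p s ->
  (forall x, p x -> x != s -> m x = 0) ->
  (forall x, ~~ (p x && (x != s)) -> m x = 1 + \sum_y k x y * m y) ->
  m s * (1 - trace_kernel s s) =
  1 + \sum_(x | ~~ p x) mu x / mu s * first_visit x s.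
Proof.
move=> mu0 rev ps m0 m1; pose e x := first_visit x s.
have green : \sum_x mu x * (e x - \sum_y k x y * e y) * m x =
             \sum_x mu x * e x * (m x - \sum_y k x y * m y).
  under eq_bigr do rewrite mulrBr mulrBl.
  under [RHS]eq_bigr do rewrite mulrBr.
  rewrite !big_split /= !sumrN; congr (_ - _).
  transitivity (\sum_x \sum_y mu x * k x y * e y * m x).
    apply: eq_bigr => x _; rewrite mulr_sumr mulr_suml.
    by apply: eq_bigr => y _; rewrite mulrA.
  rewrite exchange_big /=; apply: eq_bigr => y _; rewrite mulr_sumr.
  by apply: eq_bigr => x _; rewrite rev; ring.
(* [e] is harmonic off [p] and [m] vanishes on [p] minus [s], so only [s] contributes. *)
have L : \sum_x mu x * (e x - \sum_y k x y * e y) * m x =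
    mu s * (1 - trace_kernel s s) * m s.
  rewrite (bigD1 s) //= [X in _ + X]big1 ?addr0.
    by rewrite /e first_visit_in // eqxx /trace_kernel ps.
  move=> x xs; have [px|px] := boolP (p x); first by rewrite m0 ?mulr0.
  by rewrite {1}/e first_visit_out // subrr mulr0 mul0r.
(* On the other side [e] vanishes on [p] minus [s], and elsewhere [m] drops by exactly 1 on average
   in one step. *)
have Rs : \sum_x mu x * e x * (m x - \sum_y k x y * m y) =
    mu s + \sum_(x | ~~ p x) mu x * e x.
  have inv x : ~~ (p x && (x != s)) -> m x - \sum_y k x y * m y = 1.
    by move=> H; rewrite m1 // addrK.
  rewrite (bigID p) /=; congr (_ + _).
    rewrite (bigD1 s) //= [X in _ + X]big1 ?addr0.
      by rewrite inv ?eqxx ?andbF // mulr1 /e first_visit_in // eqxx mulr1.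
    move=> x /andP[px xs].
    by rewrite /e first_visit_in // (negbTE xs) mulr0 mul0r.
  by apply: eq_bigr => x px; rewrite inv ?mulr1 // (negbTE px).
have mus : mu s != 0 by rewrite gt_eqF.
apply: (mulfI mus); rewrite [RHS]mulrDr mulr1 mulr_sumr.
rewrite (eq_bigr (fun x => mu x * e x)); last first.
  by move=> x _; rewrite /e; field.
by rewrite -Rs -green L; ring.
Qed.

End trace_kernel.

(** * Survival probabilities and mean hitting times in discrete time *)

Section survival.
Variables (R : realType) (T : finType) (k : T -> T -> R) (D : pred T).
Hypothesis k_gt0 : forall x y, 0 < k x y.
Hypothesis k_sum : forall x, \sum_y k x y = 1.
Variable d0 : T.
Hypothesis Dd0 : D d0.

Definition survival (J : nat) (x : T) : R :=
  kmean k J x (fun l => (all (predC D) (x :: l))%:R).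

(** Tail-sum formula for a mean: [survival J] is the probability that [D] is not met at the steps 0
    to [J]. *)
Definition mean_hitting (x : T) : R := limn (series (survival ^~ x)).

Lemma survivalS J x :
  survival J.+1 x = (~~ D x)%:R * \sum_y k x y * survival J y.
Proof.
rewrite /survival /= mulr_sumr; apply: eq_bigr => y _.
rewrite [RHS]mulrCA -[in RHS]kmeanZ; congr (_ * _); apply: eq_kmean => l _.
by rewrite -natrM mulnb.
Qed.

Lemma survival_in J x : D x -> survival J x = 0.
Proof.
case: J => [|J] Dx; last by rewrite survivalS Dx mul0r.
by rewrite /survival /= Dx.
Qed.

Lemma survival_ge0 J x : 0 <= survival J x.
Proof.
rewrite -(kmean_cst k_sum J x 0); apply: le_kmean => // z y; exact: ltW.
Qed.

(** From every state the next step hits [d0] with probability at least the minimum over [x] of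
    [k x d0], which is positive because [T] is finite. *)
Lemma survival_geometric : exists2 rho : R, 0 <= rho < 1 &
  forall J x, survival J x <= rho ^+ J.
Proof.
have kd0 x : k x d0 <= 1.
  rewrite -(k_sum x) (bigD1 d0) //= lerDl; apply: sumr_ge0 => y _; exact: ltW.
case: (Order.TotalTheory.arg_minP (k ^~ d0) (erefl : xpredT d0)) => z _ zmin.
exists (1 - k z d0); first by rewrite subr_ge0 kd0 ltrBlDr ltrDl k_gt0.
have rho0 : 0 <= 1 - k z d0 by rewrite subr_ge0.
elim=> [|J IH] x.
  by rewrite /survival /= expr0; case: (D x); rewrite ?ler01 ?lexx.
rewrite survivalS; apply: (@le_trans _ _ (\sum_y k x y * survival J y)).
  rewrite ler_piMl ?lern1 ?leq_b1 //.
  by apply: sumr_ge0 => y _; rewrite mulr_ge0 ?survival_ge0 // ltW.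
rewrite (bigD1 d0) //= survival_in // mulr0 add0r.
apply: (@le_trans _ _ (\sum_(y | y != d0) k x y * (1 - k z d0) ^+ J)).
  by apply: ler_sum => y _; rewrite ler_wpM2l // ltW.
rewrite -mulr_suml exprS ler_wpM2r ?exprn_ge0 //.
have := k_sum x; rewrite (bigD1 d0) //= => /(canRL (addKr _)) ->.
by rewrite addrC lerB //; exact: zmin.
Qed.

Lemma mean_hitting_cvg x : series (survival ^~ x) @ \oo --> mean_hitting x.
Proof.
have [rho /andP[rho0 rho1] le_rho] := survival_geometric.
apply: (@series_le_cvg _ _ (geometric 1 rho)) => [n|n|n|] /=.
- exact: survival_ge0.
- by rewrite mul1r exprn_ge0.
- by rewrite mul1r.
- by apply: is_cvg_geometric_series; rewrite ger0_norm.
Qed.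

Lemma mean_hitting_in x : D x -> mean_hitting x = 0.
Proof.
move=> Dx; apply/cvg_lim => //.
rewrite (_ : series _ = fun=> 0); first exact: cvg_cst.
by apply/funext => n; rewrite /series /= big1 // => i _; rewrite survival_in.
Qed.

Lemma mean_hitting_out x : ~~ D x ->
  mean_hitting x = 1 + \sum_y k x y * mean_hitting y.
Proof.
move=> Dx; have := @mean_hitting_cvg x; rewrite -cvg_shiftS => /cvgn_unique; apply.
rewrite (_ : (fun n => _) =
    (fun n => 1 + \sum_y k x y * series (survival ^~ y) n)); last first.
  apply/funext => n; rewrite /series /= big_nat_recl //=; congr (_ + _).
    by rewrite /survival /= Dx.
  under eq_bigr do rewrite survivalS Dx mul1r.
  by rewrite exchange_big /=; apply: eq_bigr => y _; rewrite mulr_sumr.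
apply: cvgD; first exact: cvg_cst.
by apply: cvg_kernel_sum => y; exact: mean_hitting_cvg.
Qed.

End survival.


(** * Bounded convergence *)

Section bounded_convergence.
Variables (R : realType) (d : measure_display) (Omega : measurableType d).
Variable P : probability Omega R.

Import HBNNSimple.

(* No measurability of [f] and [g] is assumed: the integral of a nonnegative
   function is a supremum over simple functions. *)
Lemma ge0_integral_le_null (f g : Omega -> R) (G : set Omega) :
  measurable G -> P (~` G) = 0%E -> (forall w, 0 <= f w) ->
  (forall w, 0 <= g w) -> (forall w, G w -> f w = g w) ->
  (\int[P]_w (f w)%:E <= \int[P]_w (g w)%:E)%E.
Proof.
move=> mG PG f0 g0 fg.
rewrite !ge0_integralTE; [|by move=> w; rewrite lee_fin..].
apply: ge_ereal_sup => _ [h hf <-].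
apply: (@le_trans _ _ (sintegral P (proj_nnsfun h mG))); last first.
  apply: ereal_sup_ubound; exists (proj_nnsfun h mG) => // w.
  rewrite /= mindicE; case: (boolP (w \in G)) => wG /=.
    by rewrite mulr1 -fg ?hf //; exact: set_mem.
  by rewrite mulr0 lee_fin.
rewrite -[leLHS]/(sintegral P h).
have <- : (\int[P]_w (h w)%:E = sintegral P h)%E.
  by rewrite integral_nnsfun // patch_setT.
have <- : (\int[P]_w (proj_nnsfun h mG w)%:E = sintegral P (proj_nnsfun h mG))%E.
  by rewrite integral_nnsfun // patch_setT.
rewrite le_eqVlt; apply/orP; left; apply/eqP.
apply: ge0_ae_eq_integral => //.
- by apply/measurable_EFinP; exact: measurable_funPT.
- by apply/measurable_EFinP; exact: measurable_funPT.
- by move=> w _; rewrite lee_fin; exact: fun_ge0.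
- by move=> w _; rewrite lee_fin; exact: fun_ge0.
exists (~` G); split => //; first exact: measurableC.
move=> w /=; apply: contra_not => Gw _.
by rewrite mindicE mem_set // mulr1.
Qed.

Lemma ge0_integral_eq_null (f g : Omega -> R) (G : set Omega) :
  measurable G -> P (~` G) = 0%E -> (forall w, 0 <= f w) ->
  (forall w, 0 <= g w) -> (forall w, G w -> f w = g w) ->
  (\int[P]_w (f w)%:E = \int[P]_w (g w)%:E)%E.
Proof.
move=> mG PG f0 g0 fg; apply/eqP; rewrite eq_le.
by rewrite !(@ge0_integral_le_null _ _ G) // => w /fg.
Qed.

Lemma bounded_cvg (C : R) (f_ : nat -> Omega -> R) (f : Omega -> R) :
  (forall n, measurable_fun setT (f_ n)) ->
  (forall n w, 0 <= f_ n w <= C) ->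
  (forall w, f_ n w @[n --> \oo] --> f w) ->
  (\int[P]_w (f_ n w)%:E @[n --> \oo] --> \int[P]_w (f w)%:E)%E.
Proof.
move=> mf bf cf.
have := @dominated_convergence _ _ _ P setT measurableT
  (fun n w => (f_ n w)%:E) (fun w => (f w)%:E) (fun=> C%:E).
case => //.
- by move=> n; apply/measurable_EFinP.
- by apply/measurable_EFinP; apply: measurable_fun_cvg mf _ => w _; exact: cf.
- by apply: aeW => w _; apply: cvg_EFin; [exact: nearW|exact: cf].
- exact: finite_measure_integrable_cst.
- apply: aeW => w n _ /=; rewrite lee_fin ger0_norm; by case/andP: (bf n w).
Qed.

(** The limit [f] is not assumed measurable. Multiplying everything by the indicator of [G] changes
    no integral and gives convergence everywhere, hence a measurable limit. *)
Lemma bounded_cvg_on (C : R) (G : set Omega) (f_ : nat -> Omega -> R)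
    (f : Omega -> R) :
  measurable G -> P (~` G) = 0%E ->
  (forall n, measurable_fun setT (f_ n)) ->
  (forall n w, 0 <= f_ n w <= C) -> (forall w, 0 <= f w) ->
  (forall w, G w -> f_ n w @[n --> \oo] --> f w) ->
  (\int[P]_w (f_ n w)%:E @[n --> \oo] --> \int[P]_w (f w)%:E)%E.
Proof.
move=> mG PG mf bf f0 cf.
have C0 : 0 <= C.
  have [w _] : [set: Omega] !=set0.
    by apply/set0P/eqP => E; have := probability_setT P; rewrite E measure0 =>
      -[] /eqP; rewrite eq_sym oner_eq0.
  by case/andP: (bf 0%N w); exact: le_trans.
pose g_ n w := f_ n w * \1_G w; pose g w := f w * \1_G w.
have ind0 w : 0 <= \1_G w :> R by rewrite indicE.
have E1 n : (\int[P]_w (f_ n w)%:E = \int[P]_w (g_ n w)%:E)%E.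
  apply: (ge0_integral_eq_null mG PG) => w; first by case/andP: (bf n w).
    by rewrite mulr_ge0 //; case/andP: (bf n w).
  by move=> Gw; rewrite /g_ indicE mem_set // mulr1.
have E2 : (\int[P]_w (f w)%:E = \int[P]_w (g w)%:E)%E.
  apply: (ge0_integral_eq_null mG PG) => w; first exact: f0.
    by rewrite mulr_ge0.
  by move=> Gw; rewrite /g indicE mem_set // mulr1.
rewrite E2; under eq_fun do rewrite E1.
apply: (@bounded_cvg C).
- by move=> n; apply: measurable_funM => //.
- move=> n w; rewrite /g_ indicE; case: (w \in G) => /=.
    by rewrite mulr1.
  by rewrite mulr0 lexx.
- move=> w; rewrite /g_ /g indicE; case: (boolP (w \in G)) => wG /=.
    by apply: cvgM; [apply: cf; exact: set_mem|exact: cvg_cst].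
  by rewrite mulr0; under eq_fun do rewrite mulr0; exact: cvg_cst.
Qed.

Lemma integral_prob_cst (c : R) : (\int[P]_w c%:E = c%:E)%E.
Proof.
rewrite -[RHS]mule1 -(probability_setT P).
exact: (integral_cst P measurableT c%:E).
Qed.

End bounded_convergence.


(** * Finite chains in continuous time *)

Section chain.
Variables (R : realType) (T : finType) (r : T -> T -> R).
Variables (d : measure_display) (Omega : measurableType d).
Variables (P : T -> probability Omega R) (X : Omega -> dpath R T).
Hypothesis HX : forall x, is_markov_chain r (P x) X x.

Let tr := transition r.

(** Positivity, unit row sums and the semigroup law are read off the probabilities of the process
    rather than the exponential series. *)
Lemma transition_ge0 t x y : 0 <= t -> 0 <= tr t x y.
Proof.
move=> t0; rewrite -lee_fin.
have := @prob_states _ _ _ _ _ _ _ _ (HX x) [:: t] [:: y].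
by rewrite /= t0 subr0 mulr1 => /(_ isT erefl) <-.
Qed.

Lemma transition_sum t x : 0 <= t -> \sum_y tr t x y = 1.
Proof.
move=> t0; have := @integral_states _ _ _ _ _ _ _ _ (HX x) [:: t] (fun=> 1).
rewrite /= t0 subr0 => /(_ isT (fun=> ler01)).
by rewrite integral_prob_cst => -[] ->; apply: eq_bigr => y _; rewrite mulr1.
Qed.

(** Computes the law of the state at time [s + t] in two ways, with and without an observation at
    time [s]. *)
Lemma transitionD s t x z : 0 <= s -> 0 <= t ->
  tr (s + t) x z = \sum_y tr s x y * tr t y z.
Proof.
move=> s0 t0; have st0 : 0 <= s + t by rewrite addr_ge0.
have := @integral_states _ _ _ _ _ _ _ _ (HX x) [:: s; s + t]
  (fun l => (nth x l 1 == z)%:R).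
rewrite /= s0 lerDl t0 subr0 => /(_ isT (fun=> ler0n _ _)).
have := @integral_states _ _ _ _ _ _ _ _ (HX x) [:: s + t]
  (fun l => (nth x l 0 == z)%:R).
rewrite /= st0 subr0 => /(_ isT (fun=> ler0n _ _)) -> [].
have sum1 (f : T -> R) : \sum_y f y * (y == z)%:R = f z.
  rewrite (bigD1 z) //= eqxx mulr1 big1 ?addr0 // => y /negbTE ->.
  by rewrite mulr0.
rewrite -/tr sum1 => ->; apply: eq_bigr => y _; congr (_ * _).
by rewrite sum1 addrAC subrr add0r.
Qed.

Lemma grid_ge0 (h : R) J : 0 <= h ->
  all (fun t => 0 <= t) [seq j%:R * h | j <- iota 0 J].
Proof. by move=> h0; apply/allP => _ /mapP[j _ ->]; rewrite mulr_ge0. Qed.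

Lemma integral_skeleton (h : R) J x (G : seq T -> R) : 0 <= h ->
  (forall l, 0 <= G l) ->
  (\int[P x]_w (G (skeleton (X w) h J.+1))%:E =
   (kmean (tr h) J x (fun l => G (x :: l)))%:E)%E.
Proof.
move=> h0 G0.
have skE w : skeleton (X w) h J.+1 = map (X w) [seq j%:R * h | j <- iota 0 J.+1].
  by rewrite -map_comp.
under eq_integral do rewrite skE.
rewrite (integral_states (HX x)) //; last first.
  rewrite (path_sortedE le_trans); apply/andP; split; first exact: grid_ge0.
  rewrite sorted_map.
  apply: (sub_sorted _ (iota_ltn_sorted 0 J.+1)) => i j ij /=.
  by rewrite ler_wpM2r // ler_nat ltnW.
congr _%:E; rewrite /= mul0r subr0 (bigD1 x) //= transition0 eqxx mul1r.
rewrite [X in _ + X]big1 ?addr0; last first.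
  by move=> y yx; rewrite transition0 eq_sym (negbTE yx) mul0r.
(* The induction needs a grid that starts at an arbitrary multiple [i h]; the transitions see only
   differences of times. *)
rewrite -[in LHS](mul0r h) -[0]/(0%:R).
elim: J 0%N x (fun l => G (x :: l)) {G0 skE} => [//|J IH] i x H /=.
apply: eq_bigr => y _; rewrite IH; congr (_ * _).
by rewrite /tr -natr1; congr (transition r _ _ _); ring.
Qed.

Lemma measurable_skeleton (h : R) J d' (S : measurableType d') (G : seq T -> S) :
  0 <= h -> measurable_fun setT (fun w => G (skeleton (X w) h J)).
Proof.
move=> h0; have [x _|noT] := pickP T; last first.
  rewrite (_ : (fun w => _) = fun=> G [::]) //; apply/funext => w.
  by have := noT (X w 0).
rewrite (_ : (fun w => _) = fun w => G (map (X w) [seq j%:R * h | j <- iota 0 J])).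
  exact: (measurable_fun_states (HX x) G (grid_ge0 J h0)).
by apply/funext => w; rewrite -map_comp.
Qed.

(** * Strict positivity of the transition probabilities *)

Section positivity.
Hypothesis conn : forall x y,
  connect [rel x y | (x != y) && (0 < r x y)] x y.

(** Holds for short times by the first-order expansion, then for all times by staying put over [N]
    short steps. *)
Lemma transition_diag_gt0 t x : 0 <= t -> 0 < tr t x x.
Proof.
move=> t0; have [K K0 HK] := transition_first_order r.
pose q := generator r (enum_rank x) (enum_rank x).
(* For [s <= c] the loss [s |q| + K s ^ 2] is at most 1/2. *)
pose c := (1 + K + `|q|)^-1 / 2.
have c1 : 0 < 1 + K + `|q| by rewrite -addrA ltr_pwDl // addr_ge0.
have small s : 0 <= s <= c -> 0 < tr s x x.
  move=> /andP[s0 sc]; have s1 : s * (1 + K + `|q|) <= 2^-1.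
    by rewrite (le_trans (ler_wpM2r (ltW c1) sc)) // /c mulrAC mulVf ?mul1r ?gt_eqF.
  have sle1 : s <= 1 by have := normr_ge0 q; nra.
  have := HK s x x; rewrite s0 sle1 eqxx => /(_ isT); rewrite -/tr -/q.
  rewrite ler_norml => /andP[+ _].
  have h1 : 0 <= s * (`|q| + q).
    by rewrite mulr_ge0 // -lerBlDr sub0r -normrN ler_norm.
  have h2 : K * s ^+ 2 <= K * s by rewrite ler_wpM2l // expr2 ler_piMl.
  by move: s1 h1 h2; rewrite !mulrDr (mulrC K s) mulr1 /=; lra.
have c0 : 0 < c by rewrite divr_gt0 ?invr_gt0.
pose N := (Num.truncn (t / c)).+1.
have N0 : 0 < N%:R :> R by rewrite ltr0n.
have tN : t / N%:R <= c.
  by rewrite ler_pdivrMr // mulrC -ler_pdivrMr // ltW // truncnS_gt.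
have tN0 : 0 <= t / N%:R by rewrite divr_ge0 // ltW.
have pos n : 0 < tr (n%:R * (t / N%:R)) x x.
  elim: n => [|n IH]; first by rewrite mul0r small // lexx ltW.
  rewrite -natr1 mulrDl mul1r transitionD ?mulr_ge0 // (bigD1 x) //=.
  apply: ltr_pwDl; first by rewrite mulr_gt0 // small // tN0.
  by apply: sumr_ge0 => y _; rewrite mulr_ge0 ?transition_ge0 ?mulr_ge0.
by have := pos N; rewrite mulrC divfK ?gt_eqF.
Qed.

(** Follows a path of positive rates: one jump within a time [c] so short that [c r] exceeds the
    error [K c ^ 2], then the rest of the path in the remaining time. *)
Lemma transition_gt0 t x y : 0 < t -> 0 < tr t x y.
Proof.
have [K K0 HK] := transition_first_order r.
case/connectP: (conn x y) => s xs -> {y}.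
elim: s x xs t => [|y s IH] x /= => [_ t t0|/andP[/andP[xy rxy] ys] t t0].
  by rewrite transition_diag_gt0 // ltW.
pose c := Num.min (Num.min (t / 2) 1) (r x y / (K + 1) / 2).
have K1 : 0 < K + 1 by rewrite ltr_wpDl.
have c0 : 0 < c.
  by rewrite /c !lt_min ltr01 !divr_gt0.
have ct : c < t by rewrite /c !gt_min; apply/orP; left; apply/orP; left; lra.
have c1 : c <= 1 by rewrite /c !ge_min lexx orbT.
have cr : c * (K + 1) <= r x y / 2.
  rewrite -ler_pdivlMr // mulrAC /c; by rewrite ge_min lexx orbT.
have trc : 0 < tr c x y.
  have := HK c x y; rewrite c1 (ltW c0) (negbTE xy) add0r generator_offdiag //.
  by move=> /(_ isT); rewrite -/tr ler_norml => /andP[+ _]; nra.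
rewrite -(subrKC c t) transitionD ?(ltW c0) ?subr_ge0 ?(ltW ct) //.
rewrite (bigD1 y) //=; apply: ltr_pwDl.
  by rewrite mulr_gt0 // IH // subr_gt0.
by apply: sumr_ge0 => z _; rewrite mulr_ge0 // transition_ge0 // ?subr_ge0 ltW.
Qed.

(** * Almost surely infinite occupation time *)

Section recurrence.
Variable p : pred T.
Variable a0 : T.
Hypothesis pa0 : p a0.

Let occ w u : R := roccupation [set x | p x] (X w) u.
Let h n : R := 2^-1 ^+ n.

Let h_gt0 n : 0 < h n.
Proof. exact: half_exp_gt0. Qed.

Let h_cvg0 : h n @[n --> \oo] --> 0.
Proof. exact: half_exp_cvg0. Qed.

Let cells_h n j : cells (h n) j%:R = (j * 2 ^ n)%N.
Proof.
rewrite /cells /h exprVn invrK -natrX -natrM -[X in Num.ceil X]/((j * 2 ^ n)%:R).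
by rewrite -[_%:R]/((Posz (j * 2 ^ n))%:~R) intrKceil.
Qed.

(* At [g = exp (- h)] this is the mean of [exp (- h * number of visits to p)] over
   the first [J] steps; it is submultiplicative in [J], so that
   [E (exp (- T (j))) <= C ^ j] with [C < 1] for the occupation time [T] of [p]. *)
Let laplace (g : R) :=
  fix L (J : nat) (k : T -> T -> R) (x : T) : R :=
  if J is J'.+1 then g ^+ (p x) * \sum_y k x y * L J' k y else 1.

Let laplaceS g J k x :
  laplace g J.+1 k x = g ^+ (p x) * \sum_y k x y * laplace g J k y.
Proof. by []. Qed.

Let laplace_mean g h' J x : 0 <= h' -> 0 <= g ->
  (\int[P x]_w (g ^+ count p (skeleton (X w) h' J))%:E =
   (laplace g J (tr h') x)%:E)%E.
Proof.
move=> h0 g0; case: J => [|J].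
  under eq_integral do rewrite /= expr0.
  by rewrite integral_prob_cst.
rewrite (@integral_skeleton h' J x (fun l => g ^+ count p l)) //; last first.
  by move=> l; rewrite exprn_ge0.
congr _%:E; elim: J x => [|J IH] x.
  rewrite /= addn0; under eq_bigr do rewrite mulr1.
  by rewrite transition_sum // mulr1.
rewrite laplaceS mulr_sumr [LHS]/=; apply: eq_bigr => y _.
rewrite -[laplace g J.+1 _ y]IH [RHS]mulrCA -[in RHS]kmeanZ; congr (_ * _).
by apply: eq_kmean => l _; rewrite exprD.
Qed.

Let laplace_submul g h' N C j x : 0 <= h' -> 0 <= g -> 0 <= C ->
  (forall x, laplace g N (tr h') x <= C) ->
  laplace g (j * N) (tr h') x <= C ^+ j.
Proof.
move=> h0 g0 C0 LC.
have step a b D : 0 <= D -> (forall x, laplace g b (tr h') x <= D) ->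
    forall x, laplace g (a + b) (tr h') x <= D * laplace g a (tr h') x.
  move=> D0 LD; elim: a => [|a IH] z; first by rewrite mulr1.
  rewrite /= mulrCA ler_wpM2l ?exprn_ge0 // mulr_sumr; apply: ler_sum => y _.
  by rewrite mulrCA ler_wpM2l // transition_ge0.
elim: j x => [|j IH] x; first by rewrite expr0.
rewrite mulSn (le_trans (step _ _ (C ^+ j) _ IH x)) ?exprn_ge0 //.
by rewrite exprSr ler_wpM2l ?exprn_ge0.
Qed.

Let expocc j w : R := expR (- occ w j%:R).

Let expcnt n j w : R := expR (- h n) ^+ count p (skeleton (X w) (h n) (j * 2 ^ n)).

Let hh : h n / h n @[n --> \oo] --> (1 : R).
Proof. exact: cvg_divff. Qed.

Let cnt_cvg j w :
  h n * (count p (skeleton (X w) (h n) (j * 2 ^ n)))%:R @[n --> \oo] --> occ w j%:R.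
Proof.
have := cvg_cnt (p := p) (dpath_cadlag (X w)) h_gt0 h_cvg0 hh (ler0n _ j).
by under eq_fun do rewrite cells_h.
Qed.

Let expcnt_cvg j w : expcnt n j w @[n --> \oo] --> expocc j w.
Proof.
rewrite (_ : (fun n => _) = fun n =>
  expR (- (h n * (count p (skeleton (X w) (h n) (j * 2 ^ n)))%:R))); last first.
  by apply/funext => n; rewrite /expcnt -expRM_natl mulrN mulrC.
apply: continuous_cvg; first exact: continuous_expR.
by apply: cvgN; exact: cnt_cvg.
Qed.

Lemma measurable_occ (j : nat) : measurable_fun setT (fun w => occ w j%:R).
Proof.
apply: (@measurable_fun_cvg _ _ _ _ (fun n w =>
  h n * (count p (skeleton (X w) (h n) (j * 2 ^ n)))%:R)); last first.
  by move=> w _; exact: cnt_cvg.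
move=> n.
exact: (@measurable_skeleton (h n) (j * 2 ^ n) _ _ (fun l => h n * (count p l)%:R) (ltW (h_gt0 n))).
Qed.

Let expocc_itv j w : 0 <= expocc j w <= 1.
Proof.
rewrite expR_ge0 -expR0 ler_expR oppr_le0 roccupation_ge0 //.
exact: dpath_cadlag.
Qed.

Let expcnt_itv n j w : 0 <= expcnt n j w <= 1.
Proof.
rewrite exprn_ge0 ?expR_ge0 // exprn_ile1 ?expR_ge0 // -expR0 ler_expR.
by rewrite oppr_le0 ltW.
Qed.

Let measurable_expocc j : measurable_fun setT (expocc j).
Proof.
apply: measurableT_comp; first exact: measurable_expR.
exact: (measurable_funN (measurable_occ j)).
Qed.

Let expcnt_mean j x :
  ((laplace (expR (- h n)) (j * 2 ^ n) (tr (h n)) x)%:E @[n --> \oo] -->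
  \int[P x]_w (expocc j w)%:E)%E.
Proof.
under eq_fun do rewrite -laplace_mean ?expR_ge0 ?(ltW (h_gt0 _)) //.
apply: (@bounded_cvg _ _ _ _ 1 (expcnt ^~ j)) => //.
move=> n.
exact: (@measurable_skeleton (h n) (j * 2 ^ n) _ _ (fun l => expR (- h n) ^+ count p l) (ltW (h_gt0 n))).
Qed.

(** An interior time such as 1/2 leaves room for right-continuity to produce a stay of positive
    length before time 1. *)
Let occ_gt0 w : X w 2^-1 = a0 -> 0 < occ w 1.
Proof.
move=> Xa; have cX := dpath_cadlag (X w).
have half0 : 0 <= 2^-1 :> R by rewrite invr_ge0.
have [e e0 He] := at_right_ex (cX.1 _ half0).
pose v := Num.min (2^-1 + e / 2) 1 : R.
have v1 : v <= 1 by rewrite ge_min lexx orbT.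
have hv : 2^-1 < v by rewrite lt_min; apply/andP; split; lra.
have ve : v < 2^-1 + e by rewrite gt_min; apply/orP; left; lra.
have fv u : 2^-1 <= u < v -> X w u = X w 2^-1.
  move=> /andP[]; rewrite le_eqVlt => /orP[/eqP <- //|hu] uv.
  by apply: He; rewrite hu /= (lt_trans uv).
apply: (@lt_le_trans _ _ (occ w v)); last first.
  by apply: roccupation_homo => //; rewrite (le_trans half0) // ltW.
rewrite /occ (roccupation_step _ cX half0 (ltW hv) fv).
rewrite indicE mem_set ?mulr1 /=; last by rewrite Xa.
have := @roccupation_ge0 _ _ [set x | p x] _ cX 2^-1; lra.
Qed.

(** A mean equal to 1 would force zero occupation almost surely up to time 1, although the chain is
    at [a0] at time 1/2 with positive probability. *)
Let expocc_lt1 x : (\int[P x]_w (expocc 1 w)%:E < 1)%E.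
Proof.
rewrite ltNge; apply/negP => I1.
have split1 : (\int[P x]_w (1 - expocc 1 w)%:E + \int[P x]_w (expocc 1 w)%:E = 1)%E.
  rewrite -ge0_integralD //=.
  - rewrite -[RHS](integral_prob_cst (P x) 1); apply: eq_integral => w _.
    by rewrite -EFinD subrK.
  - by move=> w _; rewrite lee_fin subr_ge0; case/andP: (expocc_itv 1 w).
  - by apply/measurable_EFinP; apply: measurable_funB.
  - by move=> w _; rewrite lee_fin; case/andP: (expocc_itv 1 w).
  - by apply/measurable_EFinP.
have f0 w : (0 <= (1 - expocc 1 w)%:E)%E.
  by rewrite lee_fin subr_ge0; case/andP: (expocc_itv 1 w).
have I0 : (\int[P x]_w (1 - expocc 1 w)%:E = 0)%E.
  apply/eqP; rewrite eq_le integral_ge0 // andbT leNgt; apply/negP => Ipos.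
  have : (1 < \int[P x]_w (1 - expocc 1 w)%:E + \int[P x]_w (expocc 1 w)%:E)%E.
    by rewrite -[ltLHS]add0e; apply: lte_leD.
  by rewrite split1 ltxx.
have : ae_eq (P x) setT (fun w => (1 - expocc 1 w)%:E) (cst 0%E).
  apply/ae_eq_integral_abs => //.
    by apply/measurable_EFinP; apply: measurable_funB.
  by under eq_integral do rewrite gee0_abs //.
case=> N [mN N0 subN].
have := transition_gt0 x a0 (_ : 0 < 2^-1 :> R).
rewrite invr_gt0 ltr0n => /(_ isT).
have half0 : 0 <= 2^-1 :> R by rewrite invr_ge0.
have mB : measurable [set w | X w 2^-1 = a0] by exact: (HX x).1.
have := @prob_states _ _ _ _ _ _ _ _ (HX x) [:: 2^-1] [:: a0].
rewrite /= half0 subr0 mulr1 => /(_ isT erefl) PB.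
have E : [set w | [:: X w 2^-1] = [:: a0]] = [set w | X w 2^-1 = a0].
  by apply/seteqP; split=> w /=; [case|move->].
rewrite -lte_fin -PB E; set B := [set w | _] => PB0.
have : (P x B <= P x N)%E.
  apply: le_measure; rewrite ?inE // => w /= Xa; apply: subN => /= /(_ I) [] /eqP.
  rewrite subr_eq0 => /eqP H.
  have /expR_inj/eqP : expR (- occ w 1%:R) = expR 0 by rewrite expR0; exact: (esym H).
  by rewrite oppr_eq0 gt_eqF //; exact: (occ_gt0 Xa).
by rewrite N0 leNgt PB0.
Qed.

Let expocc_geometric : exists2 C : R, 0 <= C < 1 &
  forall x j, (\int[P x]_w (expocc j w)%:E <= (C ^+ j)%:E)%E.
Proof.
pose I x := fine (\int[P x]_w (expocc 1 w)%:E).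
have IE x : (\int[P x]_w (expocc 1 w)%:E = (I x)%:E)%E.
  rewrite fineK // ge0_fin_numE; last first.
    by apply: integral_ge0 => w _; rewrite lee_fin expR_ge0.
  exact: lt_trans (expocc_lt1 x) (ltry _).
have I1 x : I x < 1 by rewrite -lte_fin -IE expocc_lt1.
case: (Order.TotalTheory.arg_maxP I (erefl : xpredT a0)) => z _ zmax.
(* [C] lies strictly above every [I x], so the grid approximations are eventually below it from all
   starting points. Submultiplicativity is applied on the grid and then passed to the limit. *)
pose C := Num.max 0 ((1 + I z) / 2).
have C1 : C < 1 by rewrite gt_max ltr01 /=; have := I1 z; lra.
have C0 : 0 <= C by rewrite le_max lexx.
exists C; first by rewrite C0.
have IC x : I x < C.
  rewrite lt_max; apply/orP; right.
  by have := zmax x isT; have := I1 z; rewrite /=; lra.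
have ev : \forall n \near \oo, forall x, laplace (expR (- h n)) (2 ^ n) (tr (h n)) x <= C.
  apply: filter_forall => x.
  have := expcnt_mean (j := 1) (x := x); rewrite IE => /fine_cvgP[_ /=].
  move/cvgr_lt => /(_ _ (IC x)); apply: filterS => n /=.
  by rewrite mul1n => /ltW.
move=> x j; have := expcnt_mean (j := j) (x := x).
move/lee_cvg_to; apply; first exact: cvg_cst.
apply: filterS ev => n H; rewrite lee_fin.
by apply: laplace_submul; [exact: ltW|exact: expR_ge0|exact: C0|exact: H].
Qed.

Definition recurrent : set Omega :=
  \bigcap_m \bigcup_j [set w | m%:R < occ w j%:R].

Let measurable_occ_gt (m j : nat) : measurable [set w | m%:R < occ w j%:R].
Proof.
rewrite (_ : [set w | _] = setT `&` (fun w => occ w j%:R) @^-1` `]m%:R, +oo[%classic).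
  by apply: measurable_occ => //; exact: measurable_itv.
by rewrite setTI; apply/seteqP; split=> w /=; rewrite in_itv /= andbT.
Qed.

Lemma measurable_recurrent : measurable recurrent.
Proof.
apply: bigcapT_measurable => m; apply: bigcupT_measurable => j.
exact: measurable_occ_gt.
Qed.

Lemma recurrent_unbounded w : recurrent w ->
  forall m, exists2 u, 0 <= u & m < occ w u.
Proof.
move=> Rw m; have [j _ /= Hj] := Rw (Num.truncn m).+1 I.
by exists j%:R => //; apply: lt_trans Hj; exact: truncnS_gt.
Qed.

(** Exponential Markov inequality: occupation at most [m] up to time [j] has probability at most
    [exp m * C ^ j], which vanishes as [j] grows. *)
Lemma prob_recurrent x : P x (~` recurrent) = 0%E.
Proof.
have [C /andP[C0 C1] HC] := expocc_geometric.
pose U (m : nat) : set Omega := \bigcup_j [set w | m%:R < occ w j%:R].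
have mU m : measurable (U m).
  by apply: bigcupT_measurable => j; exact: measurable_occ_gt.
have N0 m : P x (~` U m) = 0%E.
  apply/eqP; rewrite -measure_le0.
  have le j : (P x (~` U m)
     <= (expR m%:R * C ^+ j)%:E)%E.
    set B := ~` _; have mB : measurable B by exact: measurableC.
    have H : ((expR (- m%:R))%:E * P x B <= (C ^+ j)%:E)%E.
      apply: le_trans (HC x j).
      rewrite -[B in P x B]setIT -(integral_indic (P x) measurableT mB).
      rewrite -ge0_integralZl ?lee_fin ?expR_ge0 //; last first.
        by apply/measurable_EFinP.
      apply: ge0_le_integral => //.
      - by apply/measurable_EFinP; apply: measurable_funM => //.
      - by apply/measurable_EFinP.
      move=> w _; rewrite -EFinM lee_fin indicE; case: (boolP (w \in B)) => wB.
        rewrite mulr1 ler_expR lerN2 leNgt; apply/negP => mo.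
        by have /set_mem := wB; apply; exists j.
      by rewrite mulr0 expR_ge0.
    have finB : P x B \is a fin_num by exact: fin_num_measure.
    move: H; rewrite -(fineK finB) -EFinM !lee_fin expRN.
    by rewrite ler_pdivrMl ?expR_gt0.
  have lim0 : ((expR m%:R * C ^+ j)%:E @[j --> \oo] --> 0)%E.
    apply: cvg_EFin; first exact: nearW.
    rewrite -(mulr0 (expR m%:R)); apply: cvgM; first exact: cvg_cst.
    by apply: cvg_expr; rewrite ger0_norm.
  by apply: (lee_cvg_to (cvg_cst _) lim0); exact: nearW.
apply: measure_negligible; first exact/measurableC/measurable_recurrent.
rewrite /recurrent setC_bigcap; apply: negligible_bigcup => m.
by apply/negligibleP; [apply: measurableC; exact: mU|exact: N0].
Qed.

End recurrence.
End positivity.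
End chain.


(** * Hitting times *)

Section sampled_hitting.
Variables (R : realType) (T : Type) (D : pred T).

(* [h] times the number of grid points before the first hit of [D]. *)
Definition sampled_hitting (h : R) (f : R -> T) : \bar R :=
  (\sum_(0 <= J <oo) (h * (all (predC D) (skeleton f h J.+1))%:R)%:E)%E.

Lemma all_skeletonP (f : R -> T) h J :
  reflect (forall j, (j < J)%N -> ~~ D (f (j%:R * h)))
    (all (predC D) (skeleton f h J)).
Proof.
rewrite all_map; apply: (iffP allP) => H j.
  by move=> jJ; apply: H; rewrite mem_iota.
by rewrite mem_iota /= add0n => /H.
Qed.

Lemma sampled_hitting_le h f j : 0 < h -> D (f (j%:R * h)) ->
  (sampled_hitting h f <= (j%:R * h)%:E)%E.
Proof.
move=> h0 Dj; apply: lime_le.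
  by apply: is_cvg_nneseries => n _ _; rewrite lee_fin mulr_ge0 // ltW.
apply: nearW => N; rewrite sumEFin lee_fin -mulr_sumr mulrC ler_wpM2r ?(ltW h0) //.
rewrite -natr_sum ler_nat big_mkord.
apply: (@leq_trans (\sum_(i < N) (i < j)%N)).
  apply: leq_sum => i _; case: ltnP => ij; first exact: leq_b1.
  case: all_skeletonP => // H.
  by have := H j; rewrite ltnS ij Dj => /(_ isT).
elim: N => [|N IH]; first by rewrite big_ord0.
have [Nj|jN] := leqP N.+1 j.
  rewrite (leq_trans _ Nj) // -[leqRHS](card_ord N.+1) -sum1_card.
  by apply: leq_sum => i _; exact: leq_b1.
rewrite big_ord_recr /= (_ : (N < j)%N = false) ?addn0 //.
by apply/negbTE; rewrite -leqNgt -ltnS.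
Qed.

Lemma sampled_hitting_ge h f t : 0 < h -> 0 <= t ->
  (forall s, 0 <= s -> D (f s) -> t <= s) ->
  (t%:E <= sampled_hitting h f)%E.
Proof.
move=> h0 t0 H; apply: (@le_trans _ _ ((cells h t)%:R * h)%:E).
  by rewrite lee_fin; case/andP: (cells_itv h0 t0).
have := @nneseries_lim_ge R
  (fun J => (h * (all (predC D) (skeleton f h J.+1))%:R)%:E) xpredT 0 (cells h t).
move=> /(_ (fun n _ _ => _)) H'; apply: le_trans (H' _); last first.
  by move=> n; rewrite lee_fin mulr_ge0 // ltW.
rewrite sumEFin lee_fin (eq_big_nat _ _ (F2 := fun=> h)).
  by rewrite sumr_const_nat subn0 mulr_natl.
move=> J Jc; suff -> : all (predC D) (skeleton f h J.+1) by rewrite mulr1.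
apply/all_skeletonP => j jJ; apply/negP => Dj.
have := H _ _ Dj; rewrite mulr_ge0 ?(ltW h0) // => /(_ isT).
by rewrite leNgt -cellsP // (leq_ltn_trans _ Jc).
Qed.

(** Sampling can only delay the hit. By right-continuity the path remains in [D] just after any hit,
    so a fine enough grid sees it within one mesh; without any hit both sides are infinite. *)
Lemma sampled_hitting_cvg (h : nat -> R) (f : R -> T) : cadlag f ->
  (forall n, 0 < h n) -> h n @[n --> \oo] --> 0 ->
  (sampled_hitting (h n) f @[n --> \oo] --> hitting_time [set x | D x] f)%E.
Proof.
move=> cf h0 hc; set tau := hitting_time _ f.
have tau_le s : 0 <= s -> D (f s) -> (tau <= s%:E)%E.
  by move=> s0 Ds; apply: ereal_inf_lbound; exists s.
have tau0 : (0 <= tau)%E.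
  by apply: le_ereal_inf_tmp => _ [s [s0 _] <-]; rewrite lee_fin.
have ge_tau t : 0 <= t -> (t%:E <= tau)%E ->
    forall n, (t%:E <= sampled_hitting (h n) f)%E.
  move=> t0 tt n; apply: sampled_hitting_ge => // s s0 Ds.
  by rewrite -lee_fin; apply: le_trans tt (tau_le _ s0 Ds).
case E : tau tau0 => [t| |] // t0; last first.
  rewrite (_ : (fun n => _) = fun=> +oo%E); first exact: cvg_cst.
  apply/funext => n; apply/eqyP => M M0.
  by apply: ge_tau; [exact: ltW|rewrite E leey].
rewrite lee_fin in t0.
have up e : 0 < e -> \forall n \near \oo,
    (sampled_hitting (h n) f <= (t + e)%:E)%E.
  move=> e0; have e2 : 0 < e / 2 by rewrite divr_gt0.
  have [|_ [s [s0 Ds] <-]] := @lb_ereal_inf_adherent R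
    [set t%:E | t in [set t : R | 0 <= t /\ [set x | D x] (f t)]] _ e2.
    by rewrite -/(hitting_time _ _) -/tau E.
  rewrite -/(hitting_time _ _) -/tau E -EFinD lte_fin => ste.
  have [c c0 Hc] := at_right_ex (cf.1 _ s0).
  near=> n.
  have hc' : h n < c by near: n; exact: (cvgr_lt _ hc).
  have he : h n < e / 2 by near: n; exact: (cvgr_lt _ hc).
  have /andP[c1 c2] := cells_itv (h0 n) s0.
  apply: (@le_trans _ _ ((cells (h n) s)%:R * h n)%:E).
    apply: sampled_hitting_le => //.
    move: c1; rewrite le_eqVlt => /orP[/eqP <- //|c1].
    by rewrite Hc // c1 /=; lra.
  by rewrite lee_fin; lra.
have lo n : (t%:E <= sampled_hitting (h n) f)%E by apply: ge_tau; rewrite ?E.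
apply/fine_cvgP; split.
  apply: filterS (up 1 ltr01) => n u1.
  rewrite fin_numE -ltNye -lteey.
  by rewrite (lt_le_trans (ltNyr t)) // (le_lt_trans u1) ?ltry.
apply/cvgrPdist_le => e e0; apply: filterS (up e e0) => n ue /=.
have : sampled_hitting (h n) f \is a fin_num.
  by rewrite fin_numE -ltNye -lteey (lt_le_trans (ltNyr t)) // (le_lt_trans ue) ?ltry.
move=> /fineK fE; have := lo n; move: ue; rewrite -fE !lee_fin => ue lot.
by rewrite distrC ger0_norm ?subr_ge0 // lerBlDl.
Unshelve. all: by end_near.
Qed.

End sampled_hitting.

(** * Mean hitting times as limits over dyadic grids *)

Section hitting_mean.
Variables (R : realType) (T : finType) (r : T -> T -> R).
Variables (d : measure_display) (Omega : measurableType d).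
Variables (P : T -> probability Omega R) (X : Omega -> dpath R T).
Hypothesis HX : forall x, is_markov_chain r (P x) X x.
Hypothesis conn : forall x y,
  connect [rel x y | (x != y) && (0 < r x y)] x y.
Variables (D : pred T) (d0 : T).
Hypothesis Dd0 : D d0.

Lemma integral_sampled_hitting h x : 0 < h ->
  (\int[P x]_w sampled_hitting D h (X w) =
   (h * mean_hitting (transition r h) D x)%:E)%E.
Proof.
move=> h0; have hge := ltW h0.
rewrite integral_nneseries //; last 2 first.
- move=> J; apply/measurable_EFinP.
  exact: (measurable_skeleton HX _ (fun l => h * (all (predC D) l)%:R) hge).
- by move=> J w _; rewrite lee_fin mulr_ge0.
apply/cvg_lim => //.
have tr0 y z : 0 < transition r h y z by exact: (transition_gt0 HX).
have tr1 z : \sum_y transition r h z y = 1 by exact: (transition_sum HX).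
rewrite (_ : (fun n => _) =
    fun n => (h * series (survival (transition r h) D ^~ x) n)%:E).
  apply: cvg_EFin; first exact: nearW.
  apply: cvgM; first exact: cvg_cst.
  exact: (mean_hitting_cvg tr0 tr1 Dd0).
apply/funext => n; rewrite /series /= mulr_sumr -sumEFin; apply: eq_bigr => J _.
rewrite (@integral_skeleton _ _ _ _ _ _ _ HX h J x
  (fun l => h * (all (predC D) l)%:R)) //; last by move=> l; rewrite mulr_ge0.
by rewrite kmeanZ.
Qed.

(** Dominated convergence. Dyadic grids contain the integers, so every sampled time is at most the
    one of mesh 1, whose mean is finite by geometric survival. *)
Lemma hitting_time_mean x :
  ((2^-1 ^+ n * mean_hitting (transition r (2^-1 ^+ n)) D x)%:E @[n --> \oo] -->
   \int[P x]_w hitting_time [set x | D x] (X w))%E.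
Proof.
have h0 n : 0 < 2^-1 ^+ n :> R by exact: half_exp_gt0.
have hc : (2^-1 ^+ n : R) @[n --> \oo] --> 0
    by exact: half_exp_cvg0.
under eq_fun do rewrite -integral_sampled_hitting //.
have mS n : measurable_fun setT (fun w => sampled_hitting D (2^-1 ^+ n) (X w)).
  apply: (@ge0_emeasurable_sum _ _ _ _ _ xpredT) => [J w _ _|J _].
    by rewrite lee_fin mulr_ge0 // ltW.
  apply/measurable_EFinP.
  exact: (measurable_skeleton HX _
    (fun l => (2^-1 ^+ n : R) * (all (predC D) l)%:R) (ltW (h0 n))).
have cS w := sampled_hitting_cvg (D := D) (dpath_cadlag (X w)) h0 hc.
have S0 n w : (0 <= sampled_hitting D (2^-1 ^+ n) (X w))%E.
  by apply: nneseries_ge0 => J _ _; rewrite lee_fin mulr_ge0 // ltW.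
have := @dominated_convergence _ _ _ (P x) setT measurableT
  (fun n w => sampled_hitting D (2^-1 ^+ n) (X w))
  (fun w => hitting_time [set x | D x] (X w))
  (fun w => sampled_hitting D 1 (X w)).
case => //.
- by apply: emeasurable_fun_cvg mS _ => w _; exact: cS.
- by apply: aeW => w _; exact: cS.
- apply/integrableP; split; first by have := mS 0%N; rewrite expr0.
  under eq_integral do rewrite gee0_abs ?(S0 0%N) //.
  by rewrite integral_sampled_hitting // ltry.
apply: aeW => w n _; rewrite gee0_abs //.
have [[j Dj]|nD] := pselect (exists j : nat, D (X w j%:R)); last first.
  rewrite (_ : sampled_hitting D 1 (X w) = +oo%E) ?leey //.
  apply/eqyP => M M0.
  have := @nneseries_lim_ge R
    (fun J => (1 * (all (predC D) (skeleton (X w) 1 J.+1))%:R)%:E) xpredT 0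
    (Num.truncn M).+1.
  move=> H; apply: le_trans (H _); last first.
    by move=> k _ _; rewrite lee_fin mul1r.
  rewrite sumEFin lee_fin (eq_bigr (fun=> 1)).
    by rewrite sumr_const_nat subn0 ltW // truncnS_gt.
  move=> J _; rewrite mul1r.
  suff -> : all (predC D) (skeleton (X w) 1 J.+1) by [].
  by apply/all_skeletonP => j _; apply/negP => Dj; apply: nD; exists j; rewrite mulr1 in Dj.
have := @ex_minnP (fun j => D (X w j%:R)) (ex_intro _ j Dj).
case=> {Dj} k Dk kmin.
apply: (@le_trans _ _ k%:R%:E).
  rewrite (_ : k%:R = (k * 2 ^ n)%:R * 2^-1 ^+ n :> R); last first.
    by rewrite natrM natrX exprVn mulfK // expf_neq0 // pnatr_eq0.
  apply: sampled_hitting_le => //.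
  by rewrite natrM natrX exprVn mulfK // expf_neq0 // pnatr_eq0.
have := @nneseries_lim_ge R
    (fun J => (1 * (all (predC D) (skeleton (X w) 1 J.+1))%:R)%:E) xpredT 0 k.
move=> H; apply: le_trans (H _); last first.
  by move=> i _ _; rewrite lee_fin mul1r.
rewrite sumEFin lee_fin (eq_big_nat _ _ (F2 := fun=> 1)).
  by rewrite sumr_const_nat subn0.
move=> J Jk; rewrite mul1r.
suff -> : all (predC D) (skeleton (X w) 1 J.+1) by [].
apply/all_skeletonP => i iJ; apply/negP; rewrite mulr1 => /kmin.
by rewrite leqNgt (leq_ltn_trans _ Jk).
Qed.

End hitting_mean.


(** * The Potts model *)

Lemma cyclic_const (n : nat) (U : Type) (f : 'I_n -> U) :
  (forall i, f (ordS i) = f i) -> forall i j, f i = f j.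
Proof.
case: n f => [f _ []//|n f fS].
suff H (m : nat) (mn : (m < n.+1)%N) : f (Ordinal mn) = f ord0.
  have E i : f i = f ord0.
    by rewrite -(H _ (ltn_ord i)); congr f; exact: val_inj.
  by move=> i j; rewrite !E.
elim: m mn => [|m IH] mn; first by congr f; exact: val_inj.
rewrite -(IH (ltnW mn)) -[RHS]fS; congr f; apply: val_inj => /=.
by rewrite modn_small.
Qed.

Section potts.
Variables (R : realType) (q K L M : nat).
Implicit Types s z : config q K L M.

Lemma neighbourP s (x y : site K L M) : neighbour x y ->
  hamiltonian s = 0%N -> s x = s y.
Proof.
move=> xy /eqP; rewrite /hamiltonian sum_nat_eq0 => /forallP /(_ [set x; y]%SET).
have -> : [set x; y]%SET \in edges K L M by apply/imsetP; exists (x, y); rewrite ?inE.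
rewrite /= eqb0 => H; apply/eqP; apply: contraNT H => nxy.
apply/existsP; exists x; rewrite !inE eqxx /=.
by apply/existsP; exists y; rewrite !inE eqxx orbT.
Qed.

Lemma hamiltonian_mono (a : 'I_q) : hamiltonian (mono K L M a) = 0%N.
Proof.
apply: big1 => e _; apply/eqP; rewrite eqb0; apply/existsP => -[x /andP[_]].
by case/existsP => y /andP[_]; rewrite !ffunE eqxx.
Qed.

(** Zero energy forces equal spins across every edge, and any site is joined to the corner by moving
    around the three cyclic directions in turn. *)
Lemma hamiltonian_gt0 s : (0 < K)%N -> (0 < L)%N -> (0 < M)%N ->
  ~~ is_ground s -> (0 < hamiltonian s)%N.
Proof.
move=> K0 L0 M0; rewrite lt0n; apply: contraNN => /eqP H0.
pose x0 := (Ordinal K0, Ordinal L0, Ordinal M0) : site K L M.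
apply/existsP; exists (s x0); apply/eqP/ffunP => -[[i j] k]; rewrite ffunE.
have adj n (l : 'I_n) : cyc_adj (ordS l) l by rewrite /cyc_adj eqxx orbT.
transitivity (s (Ordinal K0, j, k)).
  apply: (@cyclic_const _ _ (fun i => s (i, j, k))) => {}i.
  by apply: neighbourP => //=; rewrite ?adj ?eqxx ?orbT.
transitivity (s (Ordinal K0, Ordinal L0, k)).
  apply: (@cyclic_const _ _ (fun j => s (Ordinal K0, j, k))) => {}j.
  by apply: neighbourP => //=; rewrite ?adj ?eqxx ?orbT.
apply: (@cyclic_const _ _ (fun k => s (Ordinal K0, Ordinal L0, k))) => {}k.
by apply: neighbourP => //=; rewrite ?adj ?eqxx ?orbT.
Qed.

Definition gibbs (b : R) s : R := expR (- b * (hamiltonian s)%:R).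

Lemma gibbs_gt0 b s : 0 < gibbs b s. Proof. exact: expR_gt0. Qed.

Lemma gibbs_ground b s : is_ground s -> gibbs b s = 1.
Proof.
by case/existsP => a /eqP ->; rewrite /gibbs hamiltonian_mono mulr0 expR0.
Qed.

Lemma gibbs_excited b s : 0 <= b -> (0 < K)%N -> (0 < L)%N -> (0 < M)%N ->
  ~~ is_ground s -> gibbs b s <= expR (- b).
Proof.
move=> b0 K0 L0 M0 ns; rewrite ler_expR mulNr lerN2 ler_peMr // ler1n.
exact: hamiltonian_gt0.
Qed.

Lemma single_flipC s z : single_flip s z = single_flip z s.
Proof.
by rewrite /single_flip; congr (#|pred_of_set _| == _); apply/setP => x; rewrite !inE eq_sym.
Qed.

(** For a single flip both sides are [exp (- b max (H s) (H z))]. *)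
Lemma metropolis_reversible (b : R) s z :
  gibbs b s * metropolis_rate b s z = gibbs b z * metropolis_rate b z s.
Proof.
rewrite /metropolis_rate single_flipC; case: ifP => _; last by rewrite !mulr0.
rewrite /gibbs -!expRD; congr expR.
have [sz|zs] := leP ((hamiltonian s)%:R : R) (hamiltonian z)%:R.
  rewrite max_l ?subr_ge0 // max_r ?subr_le0 //; ring.
by rewrite max_r ?subr_le0 ?max_l ?subr_ge0 ?(ltW zs) //; ring.
Qed.

(** Induction on the number of sites where [s] and [z] differ: every single flip has a positive
    rate, and one of them corrects a site. *)
Lemma metropolis_connected (b : R) s z :
  connect [rel s z : config q K L M | (s != z) && (0 < metropolis_rate b s z)] s z.
Proof.
have [n] := ubnP #|[set x | s x != z x]%SET|; elim: n s => // n IH s.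
have [/setP E0 _|] := eqVneq [set x | s x != z x]%SET finset.set0.
  rewrite (_ : s = z) ?connect0 //; apply/ffunP => x.
  by have := E0 x; rewrite !inE => /negbFE/eqP.
case/finset.set0Pn => x; rewrite inE => sxz cn.
pose s' : config q K L M := [ffun y => if y == x then z x else s y].
have flip : single_flip s s'.
  rewrite /single_flip (_ : [set y | _]%SET = [set x]%SET) ?cards1 //.
  apply/setP => y; rewrite !inE ffunE; case: (eqVneq y x) => [->//|_].
  by rewrite eqxx.
apply: (@connect_trans _ _ s').
  apply: connect1 => /=; rewrite /metropolis_rate flip expR_gt0 andbT.
  by apply/eqP => /ffunP/(_ x); rewrite ffunE eqxx; exact/eqP.
apply: IH; rewrite -ltnS (leq_trans _ cn) // ltnS.
apply: proper_card; apply/properP; split.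
  apply/fintype.subsetP => y; rewrite !inE ffunE; case: (eqVneq y x) => [->|//].
  by rewrite eqxx.
by exists x; rewrite !inE ?ffunE ?eqxx.
Qed.

Definition recolour (f : 'I_q -> 'I_q) s : config q K L M := [ffun x => f (s x)].

Lemma recolourK f g : cancel f g -> cancel (recolour f) (recolour g).
Proof. by move=> fK s; apply/ffunP => x; rewrite !ffunE fK. Qed.

Lemma recolour_mono f a : recolour f (mono K L M a) = mono K L M (f a).
Proof. by apply/ffunP => x; rewrite !ffunE. Qed.

Lemma hamiltonian_recolour f s : injective f ->
  hamiltonian (recolour f s) = hamiltonian s.
Proof.
move=> fI; apply: eq_bigr => e _; congr (nat_of_bool _); apply: eq_existsb => x.
congr (_ && _); apply: eq_existsb => y; congr (_ && _).
by rewrite !ffunE (inj_eq fI).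
Qed.

Lemma metropolis_recolour (b : R) f s z : injective f ->
  metropolis_rate b (recolour f s) (recolour f z) = metropolis_rate b s z.
Proof.
move=> fI; rewrite /metropolis_rate !hamiltonian_recolour //.
rewrite (_ : single_flip _ _ = single_flip s z) // /single_flip.
congr (#|pred_of_set _| == _); apply/setP => x.
by rewrite !inE !ffunE (inj_eq fI).
Qed.

Lemma is_ground_recolour f g s : cancel f g -> cancel g f ->
  is_ground (recolour f s) = is_ground s.
Proof.
move=> fK gK; apply/existsP/existsP => -[a /eqP E].
  by exists (g a); rewrite -recolour_mono -E recolourK.
by exists (f a); rewrite E recolour_mono.
Qed.

Lemma mono_ground (a : 'I_q) : is_ground (mono K L M a).
Proof. by apply/existsP; exists a. Qed.

Lemma mono_inj : (0 < K)%N -> (0 < L)%N -> (0 < M)%N -> injective (@mono q K L M).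
Proof.
move=> K0 L0 M0 a b /ffunP /(_ (Ordinal K0, Ordinal L0, Ordinal M0)).
by rewrite !ffunE.
Qed.

Lemma card_ground : (0 < K)%N -> (0 < L)%N -> (0 < M)%N -> #|ground q K L M| = q.
Proof.
move=> K0 L0 M0; rewrite card_sig -[RHS]card_ord -(card_codom (mono_inj K0 L0 M0)).
apply: eq_card => s; rewrite inE; apply/existsP/codomP => -[a].
  by move=> /eqP ->; exists a.
by move=> ->; exists a.
Qed.

End potts.


(** * The law of the trace process *)

Lemma kmean_sub (R : realType) (T : finType) (p : pred T) (k : T -> T -> R)
    (k' : {x | p x} -> {x | p x} -> R) M (x : {x | p x}) (G : seq T -> R) :
  (forall x y, k (val x) (val y) = k' x y) ->
  (forall x y, p x -> ~~ p y -> k x y = 0) ->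
  kmean k M (val x) G = kmean k' M x (G \o map val).
Proof.
move=> kk' k0; elim: M x G => [//|M IH] x G /=.
rewrite (bigID p) /= [X in _ + X]big1 ?addr0; last first.
  by move=> y py; rewrite k0 ?mul0r //; exact: (valP x).
rewrite (big_sub p (fun y => k (val x) y * kmean k M y (fun l => G (y :: l)))).
by apply: eq_bigr => y _; rewrite kk' IH.
Qed.

(** * Change of time scale *)

Section acceleration.
Variables (R : realType) (T : Type) (f : R -> T) (c : R).
Hypothesis c0 : 0 < c.

Let fc u := f (c * u).

Lemma cadlag_accel : cadlag f -> cadlag fc.
Proof.
move=> [fr fl]; split=> t t0.
  have [e e0 He] := at_right_ex (fr (c * t) (mulr_ge0 (ltW c0) t0)).
  apply: (@ex_at_right _ _ (e / c)); first by rewrite divr_gt0.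
  move=> u /andP[tu ue]; apply: He; rewrite ltr_pM2l // tu /=.
  by move: ue; rewrite -(ltr_pM2l c0) mulrDr (mulrC c (e / c)) divfK ?gt_eqF.
have [x xs] := fl (c * t) (mulr_gt0 c0 t0); exists x.
have [e e0 He] := at_left_ex xs.
apply: (@ex_at_left _ _ (e / c)); first by rewrite divr_gt0.
move=> u /andP[ue ut]; apply: He; rewrite ltr_pM2l // ut andbT.
by move: ue; rewrite -(ltr_pM2l c0) mulrBr (mulrC c (e / c)) divfK ?gt_eqF.
Qed.

Lemma skeleton_accel h J : skeleton fc (h / c) J = skeleton f h J.
Proof. by apply: eq_map => j; rewrite /fc; congr f; field; rewrite gt_eqF. Qed.

Lemma cells_accel h u : cells (h / c) u = cells h (c * u).
Proof. by rewrite /cells invf_div mulrA (mulrC u). Qed.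

(** The accelerated path on mesh [h / c] meets the same points as the path on mesh [h]. The grid
    counts agree, and only the factor [c^-1] remains. *)
Lemma roccupation_accel (p : pred T) u : cadlag f -> 0 <= u ->
  roccupation [set x | p x] fc u = c^-1 * roccupation [set x | p x] f (c * u).
Proof.
move=> cf u0; pose h (n : nat) : R := 2^-1 ^+ n.
have h0 n : 0 < h n by exact: half_exp_gt0.
have hc : h n @[n --> \oo] --> 0
    by exact: half_exp_cvg0.
have h0' n : 0 < h n / c by rewrite divr_gt0.
have hc' : h n / c @[n --> \oo] --> 0.
  by rewrite -[X in _ --> X](mul0r c^-1); apply: cvgM => //; exact: cvg_cst.
have hh (k : nat -> R) : (forall n, 0 < k n) -> k n / k n @[n --> \oo] --> (1 : R)
    by exact: cvg_divff.
have := cvg_cnt (p := p) (cadlag_accel cf) h0' hc' (hh _ h0') u0.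
move/cvgn_unique; apply.
have := cvg_cnt (p := p) cf h0 hc (hh _ h0) (mulr_ge0 (ltW c0) u0).
move=> /(cvgM (cvg_cst c^-1)); apply: cvg_trans.
rewrite (_ : (fun n => _) = (fun=> c^-1) \* (fun n => h n *
  (count p (skeleton f (h n) (cells (h n) (c * u))))%:R)) //.
by apply/funext => n /=; rewrite skeleton_accel cells_accel mulrAC mulrA mulrC mulrA.
Qed.

End acceleration.

Definition path_of (R : realType) (T V : Type) (g : T -> V) (a : T) (h : R)
    (l : seq T) : dpath R V :=
  to_dpath (fun t => g (step_path a h l t)).

Lemma path_ofE (R : realType) (T V : Type) (g : T -> V) (a : T) (h : R)
    (l : seq T) t : 0 < h -> path_of g a h l t = g (step_path a h l t).
Proof.
move=> h0; rewrite /path_of /to_dpath; case: pselect => // nc; case: nc.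
have [sr sl] := cadlag_step_path a l h0; split=> u u0.
  by apply: filterS (sr u u0) => v ->.
by have [y ys] := sl u u0; exists (g y); apply: filterS ys => v ->.
Qed.

(** * Means of occupation times and of functionals of the trace *)

Section sampled_law.
Variables (R : realType) (T : finType) (r : T -> T -> R).
Variables (d : measure_display) (Omega : measurableType d).
Variables (P : T -> probability Omega R) (X : Omega -> dpath R T).
Hypothesis HX : forall x, is_markov_chain r (P x) X x.

Section mean_occupation.
Variables (p : pred T) (B : R) (x : T).
Hypothesis HB : forall t, 0 <= t -> \sum_(y | p y) transition r t x y <= B.

Lemma integral_indic_state t : 0 <= t ->
  (\int[P x]_w (p (X w t))%:R%:E <= B%:E)%E.
Proof.
move=> t0; have := @integral_states _ _ _ _ _ _ _ _ (HX x) [:: t]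
  (fun l => (p (head x l))%:R).
rewrite /= t0 subr0 => /(_ isT (fun=> ler0n _ _)) ->; rewrite lee_fin.
rewrite (le_trans _ (HB t0)) // [leRHS]big_mkcond /=; apply: ler_sum => y _.
by case: (p y); rewrite ?mulr1 ?mulr0.
Qed.

(** The occupation time is the limit of the mesh times the number of grid visits, and each grid time
    contributes at most [B] in mean. *)
Lemma mean_occupation_le (c t : R) : 0 < c -> 0 <= t ->
  (\int[P x]_w occupation [set y | p y] (fun u => X w (c * u)%R) t <= (t * B)%:E)%E.
Proof.
move=> c0 t0; pose h (n : nat) : R := 2^-1 ^+ n.
have h0 n : 0 < h n by exact: half_exp_gt0.
have h1 n : h n <= 1 by rewrite exprn_ile1 ?invr_ge0 // invf_le1 // ler1n.
have hc : h n @[n --> \oo] --> 0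
    by exact: half_exp_cvg0.
have hh : h n / h n @[n --> \oo] --> (1 : R)
    by exact: cvg_divff.
have cX w := cadlag_accel c0 (dpath_cadlag (X w)).
under eq_integral do rewrite occupation_fin //.
have skE n J w : skeleton (fun u => X w (c * u)) (h n) J = skeleton (X w) (c * h n) J.
  by rewrite -(skeleton_accel (X w) c0) mulrAC divff ?mul1r // gt_eqF.
have chn n : 0 <= c * h n by rewrite mulr_ge0 // ltW.
(* The sums are at most [t + h n], and [h n <= 1]; hence the bound [t + 1]. *)
have lim := @bounded_cvg _ _ _ (P x) (t + 1)
  (fun n w => h n * (count p (skeleton (fun u => X w (c * u)) (h n) (cells (h n) t)))%:R)
  (fun w => roccupation [set y | p y] (fun u => X w (c * u)) t) _ _
  (fun w => cvg_cnt (p := p) (cX w) h0 hc hh t0).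
have lim2 : ((h n * (cells (h n) t)%:R * B)%:E @[n --> \oo] --> (t * B)%:E)%E.
  apply: cvg_EFin; first exact: nearW.
  by apply: cvgM; [exact: cvg_cells|exact: cvg_cst].
apply: (lee_cvg_to (lim _ _) lim2) => [n|n w|].
- under eq_fun do rewrite skE.
  exact: (measurable_skeleton HX _ (fun l => h n * (count p l)%:R) (chn n)).
- rewrite mulr_ge0 ?(ltW (h0 n)) //=.
  have /andP[_ c2] := cells_itv (h0 n) t0.
  apply: (@le_trans _ _ (h n * (cells (h n) t)%:R)).
    rewrite ler_wpM2l ?(ltW (h0 n)) // ler_nat (leq_trans (count_size _ _)) //.
    by rewrite size_map size_iota.
  by have := h1 n; rewrite mulrC; lra.
apply: nearW => n.
under eq_integral => w _.
  rewrite skE -sum1_count big_map big_mkcond /= natr_sum mulr_sumr -sumEFin.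
  over.
rewrite ge0_integral_sum //; last 2 first.
- move=> j; apply/measurable_EFinP; apply: measurable_funM => //.
  have jc : 0 <= j%:R * (c * h n) by rewrite mulr_ge0.
  have jc' : all (fun t => 0 <= t) [:: j%:R * (c * h n)] by rewrite /= jc.
  exact: (measurable_fun_states (HX x)
    (fun l => (if p (head x l) then 1%N else 0%N)%:R : R) jc').
- by move=> j w _; rewrite lee_fin mulr_ge0 ?(ltW (h0 n)).
apply: (@le_trans _ _ (\sum_(j <- iota 0 (cells (h n) t)) (h n * B)%:E)%E); last first.
  by rewrite sumEFin lee_fin big_const_seq count_predT size_iota iter_addr_0
    -[leLHS]mulr_natr [leLHS]mulrAC.
apply: lee_sum => j _.
have jc : 0 <= j%:R * (c * h n) by rewrite mulr_ge0.
under eq_integral do rewrite EFinM.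
rewrite ge0_integralZl ?lee_fin ?(ltW (h0 n)) //.
- rewrite EFinM lee_wpmul2l ?lee_fin ?(ltW (h0 n)) //.
  apply: le_trans (integral_indic_state jc); rewrite le_eqVlt; apply/orP; left.
  by apply/eqP; apply: eq_integral => w _; case: (p _).
- apply/measurable_EFinP.
  have jc' : all (fun t => 0 <= t) [:: j%:R * (c * h n)] by rewrite /= jc.
  exact: (measurable_fun_states (HX x)
    (fun l => (if p (head x l) then 1%N else 0%N)%:R : R) jc').
- by move=> w _; rewrite lee_fin.
Qed.

End mean_occupation.

Section trace_law.
Hypothesis conn : forall x y,
  connect [rel x y | (x != y) && (0 < r x y)] x y.
Variables (p : pred T) (a0 : T).
Hypothesis pa0 : p a0.

(** When fewer than [M.+1] visits occur, [on_visits] vanishes while [take] keeps a shorter list. The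
    two means thus differ by at most [C] times the probability of that event, which tends to 0 by
    the case of the constant functional 1. *)
Lemma trace_skeleton_mean (C h : R) M x (G : seq T -> R) :
  0 < h -> p x -> (forall l, 0 <= G l <= C) ->
  kmean (transition r h) J x
     (fun l => G (take M.+1 [seq z <- x :: l | p z])) @[J --> \oo] -->
  kmean (trace_kernel (transition r h) p) M x (fun l => G (x :: l)).
Proof.
move=> h0 px GC; set k := transition r h.
have k0 y z : 0 < k y z by exact: (transition_gt0 HX).
have k1 z : \sum_y k z y = 1 by exact: (transition_sum HX z (ltW h0)).
have kge y z : 0 <= k y z := ltW (k0 y z).
have one l : 0 <= (fun=> 1 : R) (l : seq T) <= 1 by rewrite ler01 lexx.
have VG := cvg_visits (p := p) (M := M.+1) (x := x) k0 k1 GC.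
rewrite (visits_limE k0 k1 pa0 M GC px) in VG.
have V1 := cvg_visits (p := p) (M := M.+1) (x := x) k0 k1 one.
rewrite (visits_limE k0 k1 pa0 M one px) in V1.
rewrite kmean_cst in V1; last first.
  move=> z; rewrite -(trace_kernel_sum k0 k1 pa0 z) [RHS]big_mkcond /=.
  by apply: eq_bigr => y _; rewrite /trace_kernel; case: ifP.
pose lo J := visits_mean k p J M.+1 x G.
pose up J := lo J + C * (1 - visits_mean k p J M.+1 x (fun=> 1)).
apply: (@squeeze_cvgr _ _ _ _ lo up) => //; last first.
  rewrite -[X in _ --> X]addr0; apply: cvgD => //.
  rewrite -(mulr0 C); apply: cvgM; first exact: cvg_cst.
  by rewrite -(subrr 1); apply: cvgB => //; exact: cvg_cst.
apply: nearW => J; apply/andP; split.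
  apply: le_kmean => // l; rewrite /on_visits; case: ifP => // _.
  by case/andP: (GC (take M.+1 [seq z <- x :: l | p z])).
rewrite /up -lerBlDl /lo /visits_mean -kmeanB.
have -> : 1 - kmean k J x (fun l => on_visits p M.+1 (fun=> 1) (x :: l)) =
    kmean k J x (fun l => 1 - on_visits p M.+1 (fun=> 1) (x :: l)).
  by rewrite kmeanB (kmean_cst k1).
rewrite -kmeanZ; apply: le_kmean => // l; rewrite /on_visits; case: ifP => _.
  by rewrite !subrr mulr0.
by rewrite !subr0 mulr1; case/andP: (GC (take M.+1 [seq z <- x :: l | p z])).
Qed.

Section trace_functional.
Variables (V : Type) (g : T -> V) (c C : R) (F : dpath R V -> R) (x : T).
Hypothesis c0 : 0 < c.
Hypothesis Fcont : continuous F.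
Hypothesis F_itv : forall y, 0 <= F y <= C.

Lemma accel_unbounded w : recurrent X p w ->
  forall m, exists2 u, 0 <= u & m < roccupation [set z | p z] (fun u => X w (c * u)) u.
Proof.
move=> Rw m; have [u u0 mu] := recurrent_unbounded Rw (c * m).
exists (u / c); first by rewrite divr_ge0 // ltW.
rewrite roccupation_accel //; last 2 first.
- exact: dpath_cadlag.
- by rewrite divr_ge0 // ltW.
by rewrite (mulrC c (u / c)) divfK ?gt_eqF // ltr_pdivlMl.
Qed.

Lemma trace_functional_cvg (a : T) (h : nat -> R) (J M : nat -> nat) :
  (forall n, 0 < h n) -> h n @[n --> \oo] --> 0 ->
  (forall u, \forall n \near \oo, u <= (J n)%:R * h n) ->
  (forall u, \forall n \near \oo, u <= (M n)%:R * h n) ->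
  (\int[P x]_w (F (path_of g a (h n / c)
      (take (M n) [seq z <- skeleton (X w) (h n) (J n) | p z])))%:E @[n --> \oo] -->
   \int[P x]_w (F (to_dpath (fun t =>
      g (X w (c * trace_clock [set z | p z] (fun u => X w (c * u)) t)%R))))%:E)%E.
Proof.
move=> h0 hc hJ hM.
apply: (@bounded_cvg_on _ _ _ (P x) C (recurrent X p)) => //.
- exact: (measurable_recurrent HX).
- exact: (prob_recurrent HX conn pa0).
- move=> n.
  exact: (measurable_skeleton HX _
    (fun l => F (path_of g a (h n / c) (take (M n) [seq z <- l | p z]))) (ltW (h0 n))).
- by move=> w; case/andP: (F_itv
    (to_dpath (fun t => g (X w (c * trace_clock [set z | p z] (fun u => X w (c * u)) t))))).
move=> w Rw; apply: skorokhod_continuous_cvg => //.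
have cX := cadlag_accel c0 (dpath_cadlag (X w)).
have unb := accel_unbounded Rw.
have h0' n : 0 < h n / c by rewrite divr_gt0.
have hc' : h n / c @[n --> \oo] --> 0.
  by rewrite -[X in _ --> X](mul0r c^-1); apply: cvgM => //; exact: cvg_cst.
have hh' : (h n / c) / (h n / c) @[n --> \oo] --> (1 : R)
    by exact: cvg_divff.
have growth (N : nat -> nat) :
    (forall u, \forall n \near \oo, u <= (N n)%:R * h n) ->
    forall u, \forall n \near \oo, u <= (N n)%:R * (h n / c).
  move=> HN u; apply: filterS (HN (u * c)) => n un.
  by rewrite mulrA ler_pdivlMr.
apply: (@sampled_trace_cvg _ _ _ _ cX _ _ h0' h0' hc' hh' J M (growth _ hJ)
  (growth _ hM) _ g a) => //.
- by move=> n t _; rewrite path_ofE // skeleton_accel.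
- move=> t _; rewrite /to_dpath; case: pselect => // nc; case: nc.
  exact: (cadlag_trace (p := p) cX g unb).
Qed.

End trace_functional.
End trace_law.
End sampled_law.


(** * Calibration of the limiting chain *)

(* [alpha] is the off-diagonal entry of the trace kernel for mesh [h] and [theta]
   the time at which the limiting chain has the same transition matrix; [c] is the
   acceleration, [m] the mean number of steps to the next ground state. *)
Lemma rate_bounds (R : realType) (q kappa c h m alpha delta B o e : R) :
  2 <= q -> 0 < kappa -> 0 < c -> 0 < h -> 0 < alpha ->
  m * ((q - 1) * alpha) = 1 + delta -> 0 <= delta <= B ->
  q * alpha <= e -> e < 1 -> e < 1 + o ->
  `|h * m - (1 + o) * (kappa / (q - 1) * c)| <= e * (kappa / (q - 1) * c) ->
  let theta := - (kappa / q) * ln (1 - q * alpha) in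
  [/\ expR (- (q * kappa^-1 * theta)) = 1 - q * alpha,
      0 < theta, theta * (1 - e) <= kappa * alpha &
      (1 + o - e) * (1 - e) / (1 + B) <= h / c / theta <= 1 + o + e].
Proof.
move=> q2 k0 c0 h0 a0 mE /andP[d0 dB] qae e1 eo xE theta.
have q0 : 0 < q by lra.
have q1 : 0 < q - 1 by lra.
have qa0 : 0 < q * alpha by rewrite mulr_gt0.
have y0 : 0 < 1 - q * alpha by lra.
have e0 : 0 < 1 - e by lra.
have kq0 : 0 < kappa / q by rewrite divr_gt0.
(* With [x = q alpha], the bounds [x <= - ln (1 - x) <= x / (1 - x)] show that [theta] is
   [kappa alpha] up to a factor between 1 and [1 / (1 - e)]. *)
have lnu : ln (1 - q * alpha) <= - (q * alpha).
  by apply: le_ln1Dx; lra.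
have lnl : - ln (1 - q * alpha) <= q * alpha / (1 - q * alpha).
  have E : (1 - q * alpha)^-1 = 1 + q * alpha / (1 - q * alpha).
    by field; rewrite gt_eqF.
  rewrite -lnV ?posrE // [in leLHS]E; apply: le_ln1Dx.
  by apply: (@lt_le_trans _ _ 0); rewrite ?ltrN10 // divr_ge0 // ltW.
have thl : kappa * alpha <= theta.
  rewrite (_ : kappa * alpha = - (kappa / q) * - (q * alpha)); last first.
    by field; rewrite gt_eqF.
  by rewrite /theta !mulNr lerN2 ler_pM2l.
have th0 : 0 < theta by apply: lt_le_trans thl; rewrite mulr_gt0.
have thu : theta * (1 - q * alpha) <= kappa * alpha.
  rewrite (_ : kappa * alpha = (kappa / q) * (q * alpha)); last first.
    by field; rewrite gt_eqF.
  rewrite (_ : theta * _ = (kappa / q) *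
      (- ln (1 - q * alpha) * (1 - q * alpha))); last by rewrite /theta; ring.
  by rewrite ler_pM2l // -ler_pdivlMr.
have the : theta * (1 - e) <= kappa * alpha.
  by apply: le_trans thu; rewrite ler_pM2l //; lra.
split => //.
- rewrite (_ : - (q * kappa^-1 * theta) = ln (1 - q * alpha)).
    by rewrite lnK // posrE.
  by rewrite /theta; field; rewrite !gt_eqF.
clearbody theta; set D := kappa / (q - 1) * c in xE.
have D0 : 0 < D by rewrite mulr_gt0 // divr_gt0.
(* Here [h m] is close to [D] and [D (q - 1) = kappa c], so [h / c] is close to [kappa alpha], hence
   to [theta]. *)
have hE : h * (1 + delta) = h * m * (q - 1) * alpha by rewrite -mE; ring.
have DE : D * (q - 1) = kappa * c by rewrite /D; field; rewrite gt_eqF.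
move: xE; rewrite ler_norml => /andP[xl xu].
have {}xl : (1 + o - e) * D <= h * m by lra.
have {}xu : h * m <= (1 + o + e) * D by lra.
have d1 : 0 < 1 + delta by lra.
have hpos : 0 < h * m by apply: lt_le_trans xl; rewrite mulr_gt0 // subr_gt0.
have ca0 : 0 < (q - 1) * alpha by rewrite mulr_gt0.
have oe0 : 0 < 1 + o + e.
  by have := lt_le_trans hpos xu; rewrite pmulr_lgt0.
have lo : (1 + o - e) * c * (kappa * alpha) <= h * (1 + delta).
  rewrite hE -[leRHS]mulrA.
  rewrite (_ : _ * _ * _ = (1 + o - e) * D * ((q - 1) * alpha)).
    by rewrite ler_pM2r.
  by rewrite [RHS]mulrA -(mulrA _ D) DE; ring.
have up : h * (1 + delta) <= (1 + o + e) * c * (kappa * alpha).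
  rewrite hE -[leLHS]mulrA.
  rewrite (_ : (1 + o + e) * c * _ = (1 + o + e) * D * ((q - 1) * alpha)).
    by rewrite ler_pM2r.
  by rewrite [RHS]mulrA -(mulrA _ D) DE; ring.
apply/andP; split.
  rewrite ler_pdivrMr ?(lt_le_trans d1) ?lerD2l // -(mulrA h) -invfM mulrAC.
  rewrite ler_pdivlMr ?mulr_gt0 //.
  apply: (@le_trans _ _ (h * (1 + delta))); last by rewrite ler_pM2l // lerD2l.
  apply: le_trans lo.
  rewrite (_ : _ * (c * theta) = (1 + o - e) * c * (theta * (1 - e))); last by ring.
  by rewrite ler_pM2l // mulr_gt0 // subr_gt0.
rewrite ler_pdivrMr // ler_pdivrMr //.
apply: (@le_trans _ _ (h * (1 + delta))); first by rewrite ler_peMr ?(ltW h0) // lerDl.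
by apply: le_trans up _; rewrite mulrAC ler_pM2r // ler_pM2l.
Qed.


(** * The Metropolis chain and its trace kernel on the ground states *)

Section metropolis_chain.
Variables (R : realType) (q K L M : nat) (b : R).
Hypotheses (K0 : (0 < K)%N) (L0 : (0 < L)%N) (M0 : (0 < M)%N) (b0 : 0 < b).
Variables (d : measure_display) (Omega : measurableType d).
Variables (P : config q K L M -> probability Omega R).
Variable (X : Omega -> dpath R (config q K L M)).
Let r := @metropolis_rate R q K L M b.
Hypothesis HX : forall s, is_markov_chain r (P s) X s.

Let conn : forall s z, connect [rel s z | (s != z) && (0 < r s z)] s z.
Proof. exact: metropolis_connected. Qed.

Let rev t s z : gibbs b s * transition r t s z = gibbs b z * transition r t z s.
Proof. by apply: transition_reversible => x y _; exact: metropolis_reversible. Qed.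

(* Reversibility: [mu s * p_t s z = mu z * p_t z s <= mu z]. *)
Lemma transition_excited t s z : is_ground s -> ~~ is_ground z -> 0 <= t ->
  transition r t s z <= expR (- b).
Proof.
move=> gs nz t0; have := rev t s z; rewrite gibbs_ground // mul1r => ->.
have z1 : transition r t z s <= 1.
  rewrite -(transition_sum HX z t0) (bigD1 s) //= lerDl.
  by apply: sumr_ge0 => y _; exact: (transition_ge0 HX).
apply: le_trans (gibbs_excited (ltW b0) K0 L0 M0 nz).
by rewrite ler_piMr // ltW // gibbs_gt0.
Qed.

Lemma excited_occupation_le c t s : is_ground s -> 0 < c -> 0 <= t ->
  (\int[P s]_w occupation [set z | ~~ is_ground z] (fun u => X w (c * u)%R) t
    <= (t * (#|config q K L M|%:R * expR (- b)))%:E)%E.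
Proof.
move=> gs c0 t0.
apply: (mean_occupation_le HX (p := fun z => ~~ is_ground z)) => // u u0.
apply: (@le_trans _ _ (\sum_(y | ~~ is_ground y) expR (- b))).
  by apply: ler_sum => y ny; exact: transition_excited.
rewrite sumr_const -[leLHS]mulr_natl ler_wpM2r ?expR_ge0 // ler_nat.
exact: max_card.
Qed.

Section kernel.
Variable h : R.
Hypothesis h0 : 0 < h.

Let k := transition r h.
Let k0 x y : 0 < k x y. Proof. exact: (transition_gt0 HX). Qed.
Let k1 x : \sum_y k x y = 1. Proof. exact: (transition_sum HX x (ltW h0)). Qed.

Let tk := trace_kernel k (@is_ground q K L M).

(* Colour permutations act transitively on pairs of distinct ground states. *)
Lemma trace_kernel_colour (a a' c c' : 'I_q) : a != a' -> c != c' ->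
  tk (mono K L M a) (mono K L M a') = tk (mono K L M c) (mono K L M c').
Proof.
move=> aa' cc'.
(* [f1] moves [a] to [c]; then [f2] moves the image of [a'] to [c'] and fixes [c], which differs
   from both. *)
pose f1 := tperm a c; pose f2 := tperm (f1 a') c'.
have f1a : f1 a = c by exact: tpermL.
have f2c : f2 c = c.
  rewrite tpermD // 1?eq_sym //.
  by rewrite eq_sym -[X in _ != X]f1a (inj_eq perm_inj) eq_sym.
pose f := f2 \o f1; pose g := f1 \o f2.
have fK : cancel f g by move=> x; rewrite /f /g /= !tpermK.
have gK : cancel g f by move=> x; rewrite /f /g /= !tpermK.
have fa : f a = c by rewrite /f /= tpermL f2c.
have fa' : f a' = c' by rewrite /f /= tpermL.
rewrite -fa -fa' -!recolour_mono; apply/esym.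
apply: (trace_kernel_equivariant k0 k1 (mono_ground K L M a) _ _ (recolourK fK)
  (recolourK gK)).
  by move=> x; exact: is_ground_recolour fK gK.
move=> x y; apply: (transition_equivariant h x y (recolourK fK) (recolourK gK)).
by move=> {}x {}y; apply: metropolis_recolour; exact: can_inj fK.
Qed.

Lemma trace_kernel_cst (x x' y y' : ground q K L M) : x != x' -> y != y' ->
  tk (val x) (val x') = tk (val y) (val y').
Proof.
have E (z : ground q K L M) : exists a, val z = mono K L M a.
  by have /existsP[a /eqP] := valP z; exists a.
have [a ea] := E x; have [a' ea'] := E x'.
have [c ec] := E y; have [c' ec'] := E y'.
rewrite -!val_eqE /= ea ea' ec ec' => xx' yy'.
apply: trace_kernel_colour.
  by apply: contraNneq xx' => ->.
by apply: contraNneq yy' => ->.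
Qed.

Variables s s' : ground q K L M.
Hypothesis ss' : s != s'.
Let alpha := tk (val s) (val s').

Lemma trace_kernel_diag (x : ground q K L M) :
  tk (val x) (val x) = 1 - (q%:R - 1) * alpha.
Proof.
have := trace_kernel_sum k0 k1 (valP s) (val x).
rewrite (big_sub (@is_ground q K L M) (fun y => tk (val x) y)) (bigD1 x) //=.
rewrite (eq_bigr (fun=> alpha)) => [|y yx]; last first.
  by apply: trace_kernel_cst => //; rewrite eq_sym.
have q0 : (0 < q)%N by have /existsP[a _] := valP s; exact: leq_ltn_trans (ltn_ord a).
rewrite sumr_const (cardC1 x) card_ground // -[alpha *+ _]mulr_natl.
by rewrite -subn1 natrB // => H; apply/eqP; rewrite eq_sym subr_eq H.
Qed.

Lemma trace_kernel_escape_gt0 : 0 < alpha.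
Proof.
rewrite /alpha /tk /trace_kernel (valP s').
rewrite (bigD1 (val s')) //= first_visit_in ?(valP s') // eqxx mulr1.
apply: ltr_pwDl => //; apply: sumr_ge0 => y _.
by apply: mulr_ge0; [exact: ltW|exact: first_visit_ge0].
Qed.

(** In Green's identity the escape probability is [(q - 1) alpha] by colour symmetry. [delta] sums
    first-visit probabilities of excited states against their weights, each at most [exp (- b)]
    relative to the weight 1 of [s]. *)
Lemma hitting_escape : exists2 delta,
  mean_hitting k (fun z => is_ground z && (z != val s)) (val s)
    * ((q%:R - 1) * alpha) = 1 + delta &
  0 <= delta <= #|config q K L M|%:R * expR (- b).
Proof.
pose D : pred (config q K L M) := fun z => is_ground z && (z != val s).
have Ds' : D (val s') by rewrite /D (valP s') /= val_eqE eq_sym.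
have := @mean_hitting_trace _ _ k _ k0 k1 (gibbs b)
  (mean_hitting k D) (val s) (gibbs_gt0 b) (rev h) (valP s).
rewrite -/tk trace_kernel_diag subKr => ->; first last.
- by move=> x nDx; apply: (mean_hitting_out k0 k1 Ds').
- by move=> x gx xs; apply: mean_hitting_in; rewrite /D gx.
eexists; first by [].
have fs1 x : first_visit k (@is_ground q K L M) x (val s) <= 1.
  exact: (first_visit_le1 k0 k1 (valP s) x (valP s)).
have fs0 x : 0 <= first_visit k (@is_ground q K L M) x (val s).
  exact: first_visit_ge0.
apply/andP; split.
  apply: sumr_ge0 => x _; rewrite mulr_ge0 // divr_ge0 // ltW // gibbs_gt0 //.
apply: (@le_trans _ _ (\sum_(x | ~~ is_ground x) expR (- b))).
  apply: ler_sum => x nx; rewrite (gibbs_ground b (valP s)) divr1.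
  apply: (@le_trans _ _ (gibbs b x)).
    by rewrite ler_piMr // ltW // gibbs_gt0.
  exact: (gibbs_excited (ltW b0) K0 L0 M0 nx).
rewrite sumr_const -[leLHS]mulr_natl ler_wpM2r ?expR_ge0 // ler_nat.
exact: max_card.
Qed.

(** The equation for [theta] equates the off-diagonal entries of the two kernels; the diagonals then
    agree because rows sum to 1. *)
Lemma kmean_trace_uniform (kappa theta : R) (d' : measure_display)
    (Omega' : measurableType d') (Q : ground q K L M -> probability Omega' R)
    (Z : Omega' -> dpath R (ground q K L M)) N (G : seq (config q K L M) -> R) :
  (forall x, is_markov_chain (fun _ _ => kappa^-1) (Q x) Z x) -> 0 <= theta ->
  expR (- (q%:R * kappa^-1 * theta)) = 1 - q%:R * alpha ->
  kmean tk N (val s) G =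
  kmean (transition (fun _ _ => kappa^-1) theta) N s (G \o map val).
Proof.
move=> HZ th0 thE.
have q0 : (q%:R : R) != 0.
  rewrite pnatr_eq0 -lt0n.
  by have /existsP[a _] := valP s; exact: leq_ltn_trans (ltn_ord a).
have off (x y : ground q K L M) : x != y ->
    transition (fun _ _ => kappa^-1) theta x y = alpha.
  move=> xy; rewrite transition_uniform // card_ground // thE.
  by rewrite subKr mulrAC divff // mul1r.
apply: kmean_sub; last first.
  by move=> x y _ /negbTE ny; rewrite /tk /trace_kernel ny.
move=> x y; have [<-|xy] := eqVneq x y; last first.
  by rewrite off //; exact: (trace_kernel_cst xy ss').
rewrite trace_kernel_diag.
have := transition_sum HZ x th0; rewrite (bigD1 x) //=.
rewrite (eq_bigr (fun=> alpha)) => [|y' yx]; last by rewrite off // eq_sym.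
rewrite sumr_const (cardC1 x) card_ground // -[alpha *+ _]mulr_natl.
have q0' : (0 < q)%N by rewrite lt0n -(pnatr_eq0 R).
by rewrite -subn1 natrB // => H; apply/eqP; rewrite subr_eq H.
Qed.

End kernel.
End metropolis_chain.


Lemma path_of_val (R : realType) (T : Type) (p : pred T) (s : {x | p x})
    (h : R) (l : seq {x | p x}) :
  path_of (insubd s) (val s) h (map val l) = path_of id s h l.
Proof.
rewrite /path_of; congr to_dpath; apply/funext => t; rewrite /step_path.
have [il|li] := ltnP (Num.truncn (t / h)) (size l).
  by rewrite (nth_map s) // valKd.
by rewrite !nth_default ?size_map // valKd.
Qed.

(** The mesh shrinks like [2 ^ - n] while [4 ^ n] steps still span a time [2 ^ n]. *)
Lemma dyadic_growth (R : realType) (u : R) :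
  \forall n \near \oo, u <= (4 ^ n).+1%:R * 2^-1 ^+ n.
Proof.
near=> n.
apply: (@le_trans _ _ (2 ^+ n)); last first.
  rewrite exprVn ler_pdivlMr ?exprn_gt0 // -natrX -natrM ler_nat.
  by rewrite -expnMn // ltnW.
apply: (@le_trans _ _ n%:R).
  rewrite ltW // (lt_le_trans (truncnS_gt u)) // ler_nat.
  by near: n; exact: nbhs_infty_ge.
by rewrite -natrX ler_nat ltnW // ltn_expl.
Unshelve. all: by end_near.
Qed.

(** * Approximation of the trace at a fixed temperature *)

Section trace_approximation.
Variables (R : realType) (q K L M : nat) (b : R).
Hypotheses (K0 : (0 < K)%N) (L0 : (0 < L)%N) (M0 : (0 < M)%N) (b0 : 0 < b).
Variables (d : measure_display) (Omega : measurableType d).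
Variables (P : config q K L M -> probability Omega R).
Variable (X : Omega -> dpath R (config q K L M)).
Hypothesis HX : forall s, is_markov_chain (metropolis_rate b) (P s) X s.
Variables (kappa : R) (d' : measure_display) (Omega' : measurableType d').
Variables (Q : ground q K L M -> probability Omega' R).
Variable (Z : Omega' -> dpath R (ground q K L M)).
Hypothesis HZ : forall x, is_markov_chain (fun _ _ => kappa^-1) (Q x) Z x.
Variables (C : R) (F : dpath R (ground q K L M) -> R).
Hypothesis Fcont : continuous F.
Hypothesis F_itv : forall y, 0 <= F y <= C.

(** The limiting chain is read at the multiples of [theta], but each value is held for [h'], as in
    the sampled trace. The trivial filter keeps the form of a sampled trace, with all states
    retained. *)
Definition sampled_limit (s : ground q K L M) (h' theta : R) (N : nat) w :
    dpath R (ground q K L M) :=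
  path_of id s h' (take N [seq z <- skeleton (Z w) theta N | predT z]).

Lemma integral_sampled_limit s h' theta N : 0 <= theta ->
  (\int[Q s]_w (F (sampled_limit s h' theta N.+1 w))%:E =
   (kmean (transition (fun _ _ => kappa^-1) theta) N s
     (fun l => F (path_of id s h' (s :: l))))%:E)%E.
Proof.
move=> th0; rewrite /sampled_limit.
rewrite (@integral_skeleton _ _ _ _ _ _ _ HZ theta N s (fun l =>
  F (path_of id s h' (take N.+1 [seq z <- l | predT z])))) //; last first.
  by move=> l; case/andP: (F_itv (path_of id s h' (take N.+1 [seq z <- l | predT z]))).
congr _%:E; apply: eq_kmean => l sl.
by rewrite filter_predT take_oversize //= sl.
Qed.

Lemma trace_approx (c e o : R) (s s' : ground q K L M) : s != s' ->
  2 <= q%:R :> R -> 0 < kappa -> 0 < c -> 0 < e -> e < 1 -> e < 1 + o ->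
  (\int[P (val s)]_w
     hitting_time [set z | is_ground z && (z != val s)] (X w) =
   ((1 + o) * (kappa / (q%:R - 1) * c))%:E)%E ->
  exists h' theta N, [/\ 0 < h' <= e, 0 < theta <= e,
    e^-1 <= N%:R * h' /\ e^-1 <= N%:R * theta,
    (1 + o - e) * (1 - e) / (1 + #|config q K L M|%:R * expR (- b))
      <= h' / theta <= 1 + o + e &
    let I := (\int[P (val s)]_w (F (to_dpath (fun t => insubd s
      (X w (c * trace_clock [set z | is_ground z] (fun u => X w (c * u)%R) t)%R))))%:E)%E in
    I \is a fin_num /\
    `| fine I - fine (\int[Q s]_w (F (sampled_limit s h' theta N w))%:E)%E | <= e].
Proof.
move=> ss' q2 kap0 c0 e0 e1 eo EK.
pose h (n : nat) : R := 2^-1 ^+ n.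
have h0 n : 0 < h n by exact: half_exp_gt0.
have hc : h n @[n --> \oo] --> 0
    by exact: half_exp_cvg0.
set B := #|_|%:R * _.
have B0 : 0 <= B by rewrite mulr_ge0 // expR_ge0.
have conn := @metropolis_connected R q K L M b.
pose D : pred (config q K L M) := fun z => is_ground z && (z != val s).
have Ds' : D (val s') by rewrite /D (valP s') /= val_eqE eq_sym.
pose k n := transition (metropolis_rate b) (h n) : config q K L M -> _ -> R.
pose m n := mean_hitting (k n) D (val s).
pose D' := kappa / (q%:R - 1) * c.
have q0 : 0 < q%:R :> R by lra.
have q1 : 0 < q%:R - 1 :> R by lra.
have D'0 : 0 < D' by rewrite mulr_gt0 // divr_gt0.
have hm : h n * m n @[n --> \oo] --> (1 + o) * D'.
  have := hitting_time_mean (x := val s) HX conn Ds'.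
  by rewrite EK => /fine_cvgP[].
pose al n := trace_kernel (k n) (@is_ground q K L M) (val s) (val s').
have al0 n : 0 < al n := trace_kernel_escape_gt0 HX (h0 n) s s'.
pose g := insubd s : config q K L M -> ground q K L M.
pose G n l := F (path_of g (val s) (h n / c) l).
have GC n l : 0 <= G n l <= C by exact: F_itv.
have e2 : 0 < e / 2 by rewrite divr_gt0.
(* The horizon is chosen after the mesh and the number of visits: long enough for the finite-horizon
   mean to be close to its limit, and at least [4 ^ n] so that the grid covers growing times. *)
have exJ n : exists j, ((4 ^ n)%N <= j)%N /\
    `|kmean (k n) j (val s)
        (fun l => G n (take (4 ^ n).+1 [seq z <- val s :: l | is_ground z]))
      - kmean (trace_kernel (k n) (@is_ground q K L M)) (4 ^ n) (val s)
          (fun l => G n (val s :: l))| <= e / 2.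
  have := trace_skeleton_mean (M := (4 ^ n)%N) HX conn (valP s) (h0 n) (valP s) (GC n).
  move=> /cvgrPdist_le /(_ _ e2) H; near \oo => j; exists j; split.
    by near: j; exact: nbhs_infty_ge.
  by rewrite distrC; near: j.
have [J HJ] := choice exJ.
have growJ u : \forall n \near \oo, u <= (J n).+1%:R * h n.
  apply: filterS (dyadic_growth u) => n /le_trans; apply.
  by rewrite ler_pM2r // ler_nat ltnS; case: (HJ n).
have cvgF := trace_functional_cvg (x := val s) (g := g) HX conn
  (valP s) c0 Fcont F_itv (val s) h0 hc growJ (@dyadic_growth R).
set IY := (\int[P (val s)]_w _)%E in cvgF *.
have IYE n : (\int[P (val s)]_w (F (path_of g (val s) (h n / c)
      (take (4 ^ n).+1 [seq z <- skeleton (X w) (h n) (J n).+1 | is_ground z])))%:E =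
   (kmean (k n) (J n) (val s)
        (fun l => G n (take (4 ^ n).+1 [seq z <- val s :: l | is_ground z])))%:E)%E.
  apply: (@integral_skeleton _ _ _ _ _ _ _ HX (h n) (J n) (val s)
    (fun l => G n (take (4 ^ n).+1 [seq z <- l | is_ground z]))).
    exact: ltW.
  by move=> l; case/andP: (GC n (take (4 ^ n).+1 [seq z <- l | is_ground z])).
have IYfin : IY \is a fin_num.
  rewrite ge0_fin_numE; last first.
    by apply: integral_ge0 => w _; rewrite lee_fin;
       case/andP: (F_itv (to_dpath (fun t => insubd s
       (X w (c * trace_clock [set z | is_ground z] (fun u => X w (c * u)%R) t)%R)))).
  apply: le_lt_trans (ltry C); apply: (lee_cvg_to cvgF (cvg_cst C%:E)).
  apply: nearW => n; rewrite IYE lee_fin.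
  rewrite -[leRHS](kmean_cst (k := k n) _ (J n) (val s) C); last first.
    by move=> x; exact: (transition_sum HX x (ltW (h0 n))).
  apply: le_kmean => [x y|l]; first exact: (transition_ge0 HX _ _ (ltW (h0 n))).
  by case/andP: (GC n (take (4 ^ n).+1 [seq z <- val s :: l | is_ground z])).
have {}cvgF : kmean (k n) (J n) (val s)
    (fun l => G n (take (4 ^ n).+1 [seq z <- val s :: l | is_ground z]))
    @[n --> \oo] --> fine IY.
  move: cvgF; rewrite -{1}(fineK IYfin) => /fine_cvgP[_].
  by under eq_fun do rewrite /= IYE /=.
pose oe := 1 + o + e.
have oe0 : 0 < oe by rewrite /oe; lra.
have e1' : 0 < 1 - e by rewrite subr_gt0.
have oe1 : 0 < 1 + o - e by rewrite subr_gt0.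
(* A bound on [alpha] giving both [q alpha <= e], required by the calibration, and
   [kappa alpha <= e (1 - e)], hence [theta <= e]. *)
pose eta := Num.min (e / q%:R) (e * (1 - e) / kappa).
have eta0 : 0 < eta.
  by rewrite lt_min; apply/andP; split; apply: divr_gt0 => //; apply: mulr_gt0.
(* Green's identity gives [alpha = h (1 + delta) / ((q - 1) h m)]; with [h m >= (1 + o - e) D'] and
   [delta <= B], a mesh below [h1] forces [alpha <= eta]. *)
pose h1 := eta * ((q%:R - 1) * ((1 + o - e) * D')) / (1 + B).
have B1 : 0 < 1 + B by lra.
have h10 : 0 < h1 by apply: divr_gt0 => //; do 2 (apply: mulr_gt0 => //); apply: mulr_gt0.
near \oo => n.
have hn1 : h n <= h1 by near: n; exact: (cvgr_le _ hc).
have hn2 : h n <= e * c by near: n; apply: (cvgr_le _ hc); rewrite mulr_gt0.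
have xE : `|h n * m n - (1 + o) * D'| <= e * D'.
  by near: n; move/cvgrPdistC_le : hm; apply; rewrite mulr_gt0.
have [delta mE dB] := hitting_escape K0 L0 M0 b0 HX (h0 n) ss'.
rewrite -/(k n) -/D -/(m n) -/(al n) -/B in mE dB.
have alE : al n * ((q%:R - 1) * (h n * m n)) = h n * (1 + delta).
  by rewrite -mE; ring.
have al_le : al n <= eta.
  have H1 : (1 + o - e) * D' <= h n * m n.
    by move: xE; rewrite ler_norml => /andP[+ _]; lra.
  have D1 : 0 < (q%:R - 1) * ((1 + o - e) * D').
    by apply: mulr_gt0 => //; apply: mulr_gt0.
  rewrite -(ler_pM2r D1).
  apply: (@le_trans _ _ (h n * (1 + delta))).
    by rewrite -alE ler_pM2l // ler_pM2l.
  apply: (@le_trans _ _ (h n * (1 + B))).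
    by rewrite ler_pM2l // lerD2l; case/andP: dB.
  by rewrite -ler_pdivlMr.
have qal : q%:R * al n <= e.
  rewrite mulrC -ler_pdivlMr //; apply: le_trans al_le _.
  by rewrite ge_min lexx.
have kal : kappa * al n <= e * (1 - e).
  rewrite mulrC -ler_pdivlMr //; apply: le_trans al_le _.
  by rewrite ge_min lexx orbT.
have := rate_bounds q2 kap0 c0 (h0 n) (al0 n) mE dB qal e1 eo xE.
set theta := (- _ * _) => -[thE th0 thu ratio].
have theta_e : theta <= e.
  by rewrite -(ler_pM2r e1') (le_trans thu).
(* Bounds [theta] below by a multiple of the mesh that is fixed in [n], so the same number of steps
   covers the time [1 / e] on both scales. *)
have hth : h n / c / oe <= theta.
  rewrite ler_pdivrMr // [leRHS]mulrC -ler_pdivrMr //.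
  by case/andP: ratio => _; rewrite -/oe.
exists (h n / c), theta, (4 ^ n).+1; split.
- by rewrite divr_gt0 // ler_pdivrMr.
- by rewrite th0.
- split.
    rewrite mulrA ler_pdivlMr //.
    by near: n; exact: dyadic_growth.
  apply: (@le_trans _ _ ((4 ^ n).+1%:R * (h n / c / oe))); last by rewrite ler_pM2l.
  rewrite !mulrA !ler_pdivlMr //.
  by near: n; exact: dyadic_growth.
- exact: ratio.
split; first exact: IYfin.
rewrite integral_sampled_limit ?(ltW th0) //=.
rewrite [X in _ - X](_ : _ = kmean (trace_kernel (k n) (@is_ground q K L M))
   (4 ^ n) (val s) (fun l => G n (val s :: l))); last first.
  rewrite (kmean_trace_uniform K0 L0 M0 HX (h0 n) ss' _ _ HZ (ltW th0) thE).
  by apply: eq_kmean => l _; rewrite /= /G -path_of_val.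
rewrite [e]splitr -(subrKA (kmean (k n) (J n) (val s)
    (fun l => G n (take (4 ^ n).+1 [seq z <- val s :: l | is_ground z])))).
rewrite (le_trans (ler_normD _ _)) // lerD //; last by case: (HJ n).
by near: n; move/cvgrPdist_le : cvgF; apply.
Unshelve. all: by end_near.
Qed.

End trace_approximation.


(** * Convergence *)

Section full_occupation.
Variables (R : realType) (T : Type) (f : R -> T).
Hypothesis cf : cadlag f.

Lemma roccupation_predT u : 0 <= u -> roccupation [set x | predT x] f u = u.
Proof.
move=> u0; rewrite /roccupation occupationE //.
have -> : (lebesgue_measure (`[0%R, +oo[ `&` f @^-1` [set x | predT x] `&` `[0%R, u])
    = lebesgue_measure (`[0%R, u]%classic : set R))%E; last first.
  rewrite lebesgue_measure_itv /= lte_fin; case: ltP => //= [_|u0']; first by rewrite subr0.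
  by apply/eqP; rewrite eq_le u0 u0'.
congr (lebesgue_measure _).
apply/seteqP; split=> v /=; rewrite !in_itv /= ?andbT; first by case.
by move=> /andP[v0 vu]; rewrite v0 vu.
Qed.

(** Makes plain sampling of the limiting chain a case of the sampled trace. *)
Lemma trace_clock_predT t : 0 <= t -> trace_clock [set x | predT x] f t = t.
Proof.
move=> t0; rewrite /trace_clock (_ : [set _ | _] = `[0, t]%classic).
  by rewrite sup_itv //=; rewrite bnd_simp.
apply/seteqP; split=> v /=; rewrite in_itv /=.
  by case=> v0; rewrite occupation_fin // lee_fin roccupation_predT // v0.
by case/andP=> v0 vt; rewrite occupation_fin // lee_fin roccupation_predT.
Qed.

End full_occupation.

(** * Passage to the limit in the temperature *)

Section potts_main.
Variables (R : realType) (q K L M : nat).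
Hypotheses (q2 : (2 <= q)%N) (K0 : (0 < K)%N) (L0 : (0 < L)%N) (M0 : (0 < M)%N).
Variables (d : R -> measure_display) (Omega : forall b : R, measurableType (d b)).
Variable P : forall b : R, config q K L M -> probability (Omega b) R.
Variable sigma : forall b : R, Omega b -> dpath R (config q K L M).
Hypothesis Hsigma : forall (b : R) (s : config q K L M), 0 < b ->
  is_markov_chain (metropolis_rate b) (P b s) (@sigma b) s.

Lemma excited_time_cvg t : 0 <= t ->
  (\big[maxe/-oo]_(s : ground q K L M)
    \int[P b (val s)]_w
      occupation [set z | ~~ is_ground z] (accelerated K L b (@sigma b w)) t)%E
    @[b --> +oo] --> 0%E.
Proof.
move=> t0.
apply: (@squeeze_cvge _ _ _ _ (fun=> 0%E) _
  (fun b => (t * (#|config q K L M|%:R * expR (- b)))%:E)).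
- near=> b; have b0 : 0 < b by near: b; exact: nbhs_pinfty_gt.
  apply/andP; split.
    (* The maximum starts from [-oo]; a ground state is exhibited to bound it below by 0. *)
    pose s0 : ground q K L M := Sub _ (mono_ground K L M (Ordinal (ltnW q2))).
    apply: le_trans (le_bigmax _ _ s0).
    by apply: integral_ge0 => w _; apply: integral_ge0 => u _; rewrite lee_fin indicE.
  apply: bigmax_le => [|s _]; first exact: leNye.
  apply: (excited_occupation_le K0 L0 M0 b0 (fun s => Hsigma s b0)) => //.
    exact: valP.
  exact: expR_gt0.
- exact: cvg_cst.
- apply: cvg_EFin; first exact: nearW.
  rewrite -[X in _ --> X](mulr0 t); apply: cvgM; first exact: cvg_cst.
  rewrite -[X in _ --> X](mulr0 #|config q K L M|%:R).
  by apply: cvgM; [exact: cvg_cst|exact: cvgr_expR].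
Unshelve. all: by end_near.
Qed.

Variable kappa : R.
Hypothesis kappa0 : 0 < kappa.
Hypothesis EK : eyring_kramers P (@sigma) kappa.
Variables (d' : measure_display) (Omega' : measurableType d').
Variables (Q : ground q K L M -> probability Omega' R).
Variable (Z : Omega' -> dpath R (ground q K L M)).
Hypothesis HZ : forall x, is_markov_chain (fun _ _ => kappa^-1) (Q x) Z x.
Variable s : ground q K L M.

(** Both the mesh [theta] and the holding time [h'] vary with [n]. Since their ratio tends to 1, the
    sampled paths converge to the path of [Z] itself, for every outcome. *)
Lemma sampled_limit_cvg (F : dpath R (ground q K L M) -> R) (C : R)
    (h' theta : nat -> R) (N : nat -> nat) :
  continuous F -> (forall y, 0 <= F y <= C) ->
  (forall n, 0 < h' n) -> (forall n, 0 < theta n) ->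
  theta n @[n --> \oo] --> 0 -> h' n / theta n @[n --> \oo] --> (1 : R) ->
  (forall u, \forall n \near \oo, u <= (N n)%:R * theta n) ->
  (\int[Q s]_w (F (sampled_limit Z s (h' n) (theta n) (N n) w))%:E @[n --> \oo] -->
   \int[Q s]_w (F (Z w))%:E)%E.
Proof.
move=> cF FC h0 th0 thc ratio growth.
apply: (@bounded_cvg _ _ _ _ C) => [n|n w|w].
- exact: (measurable_skeleton HZ _ (fun l => F (path_of id s (h' n)
    (take (N n) [seq z <- l | predT z]))) (ltW (th0 n))).
- exact: FC.
apply: skorokhod_continuous_cvg => //.
have cZ := dpath_cadlag (Z w).
apply: (@sampled_trace_cvg _ _ predT _ cZ _ _ th0 h0 thc ratio N N growth growth
  _ id s) => //.
- move=> m; exists (Num.max 0 (m + 1)); first by rewrite le_max lexx.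
  rewrite roccupation_predT ?le_max ?lexx // lt_max; apply/orP; right; lra.
- by move=> n t _; rewrite /sampled_limit path_ofE.
- by move=> t t0; rewrite trace_clock_predT.
Qed.

(** Along any sequence of inverse temperatures tending to infinity, the tolerance at the [n]-th one
    tends to 0. The mean for the trace is then asymptotic to a mean over samplings of the fixed
    process [Z], which converges. *)
Lemma trace_law_cvg_ge0 (F : dpath R (ground q K L M) -> R) (C : R) :
  continuous F -> (forall y, 0 <= F y <= C) ->
  (\int[Q s]_w (F (Z w))%:E)%E \is a fin_num /\
  (\int[P b (val s)]_w
     (F (trace_path s (accelerated K L b (@sigma b w))))%:E)%E @[b --> +oo] -->
  (\int[Q s]_w (F (Z w))%:E)%E.
Proof.
move=> cF FC.
have Zfin : (\int[Q s]_w (F (Z w))%:E)%E \is a fin_num.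
  have half0 n : 0 < 2^-1 ^+ n :> R by exact: half_exp_gt0.
  have halfc : (2^-1 ^+ n : R) @[n --> \oo] --> 0
    by exact: half_exp_cvg0.
  have halfr : (2^-1 ^+ n / 2^-1 ^+ n : R) @[n --> \oo] --> (1 : R)
    by exact: cvg_divff.
  have ZC := sampled_limit_cvg cF FC half0 half0 halfc halfr (@dyadic_growth R).
  rewrite ge0_fin_numE; last first.
    by apply: integral_ge0 => w _; rewrite lee_fin; case/andP: (FC (Z w)).
  apply: le_lt_trans (ltry C); apply: (lee_cvg_to ZC (cvg_cst _)).
  apply: nearW => n; rewrite (integral_sampled_limit HZ FC) ?(ltW (half0 n)) // lee_fin.
  rewrite -[leRHS](kmean_cst (k := transition (fun _ _ => kappa^-1) (2^-1 ^+ n))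
    _ (4 ^ n) s C); last by move=> x; exact: (transition_sum HZ x (ltW (half0 n))).
  apply: le_kmean => [x y|l]; first exact: (transition_ge0 HZ _ _ (ltW (half0 n))).
  by case/andP: (FC (path_of id s (2^-1 ^+ n) (s :: l))).
split=> //; apply/cvge_pinftyP => u uoo.
have [s' ss'] : exists s', s != s'.
  have : (1 < #|ground q K L M|)%N by rewrite card_ground.
  move=> c1; have : (0 < #|predC1 s|)%N by rewrite cardC1 -ltnS prednK // ltnW.
  by case/card_gt0P => s'; rewrite !inE eq_sym => ss'; exists s'.
have [[om omc omE] _] := EK ss'.
have {}omc : om (u n) @[n --> \oo] --> 0 by move/cvg_pinftyP : omc; apply.
(* The shift by two keeps the tolerance strictly below 1 already at [n = 0], as the calibration
   requires. *)
pose e (n : nat) : R := n.+2%:R^-1.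
have e0 n : 0 < e n by rewrite invr_gt0 ltr0n.
have e1 n : e n < 1 by rewrite invf_lt1 ?ltr0n // ltr1n.
have ec : e n @[n --> \oo] --> 0.
  have := @cvg_harmonic R; rewrite -(cvg_shiftS (@harmonic R)).
  by apply: cvg_trans; apply: near_eq_cvg; apply: nearW.
pose B n : R := #|config q K L M|%:R * expR (- u n).
have Bc : B n @[n --> \oo] --> 0.
  rewrite -[X in _ --> X](mulr0 #|config q K L M|%:R).
  apply: cvgM; first exact: cvg_cst.
  by have /cvg_pinftyP := @cvgr_expR R; apply.
pose I b := (\int[P b (val s)]_w
     (F (trace_path s (accelerated K L b (@sigma b w))))%:E)%E.
pose good n (x : R * R * nat) := [/\ 0 < x.1.1 <= e n, 0 < x.1.2 <= e n,
    (e n)^-1 <= x.2%:R * x.1.1 /\ (e n)^-1 <= x.2%:R * x.1.2,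
    (1 + om (u n) - e n) * (1 - e n) / (1 + B n)
      <= x.1.1 / x.1.2 <= 1 + om (u n) + e n &
    I (u n) \is a fin_num /\
    `| fine (I (u n)) - fine (\int[Q s]_w
        (F (sampled_limit Z s x.1.1 x.1.2 x.2 w))%:E)%E | <= e n].
have q2' : 2 <= q%:R :> R by rewrite ler_nat.
have ex_good : \forall n \near \oo, exists x, good n x.
  near=> n.
  have u0 : 0 < u n by near: n; move/cvgryPgt : uoo; apply.
  have eo : e n < 1 + om (u n).
    suff : e n - om (u n) < 1 by lra.
    near: n; apply: (cvgr_lt 0) => //; rewrite -[X in _ --> X](subrr 0).
    exact: cvgB.
  have EKn : (\int[P (u n) (val s)]_w hitting_time
      [set z | is_ground z && (z != val s)] (@sigma (u n) w) =
    ((1 + om (u n)) * (kappa / (q%:R - 1) * expR ((Gamma K L)%:R * u n)))%:E)%E.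
    rewrite (_ : [set z | is_ground z && _] = [set z | is_ground z /\ z != val s]).
      by near: n; move: omE => /uoo.
    by apply/seteqP; split=> z /=; [case/andP|case=> -> ->].
  have [h' [theta [N H]]] := trace_approx K0 L0 M0 u0 (fun s => Hsigma s u0) HZ cF FC
    ss' q2' kappa0 (expR_gt0 _) (e0 n) (e1 n) eo EKn.
  by exists (h', theta, N).
(* The approximation exists only for large [n]; the default [(1, 1, 0)] keeps mesh and holding time
   positive for every [n]. *)
have exx n : exists x : R * R * nat,
    [/\ 0 < x.1.1, 0 < x.1.2 & (exists y, good n y) -> good n x].
  have [[y gy]|ng] := pselect (exists y, good n y).
    by exists y; split=> //; case: gy => /andP[? _] /andP[? _].
  by exists (1, 1, 0%N); split.
have [x Hx] := choice exx.
have gx : \forall n \near \oo, good n (x n).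
  by apply: filterS ex_good => n; have [_ _] := Hx n; exact.
have thc : (x n).1.2 @[n --> \oo] --> 0.
  apply: (@squeeze_cvgr _ _ _ _ (fun=> 0) e) => //; last exact: cvg_cst.
  by apply: filterS gx => n [_ /andP[/ltW -> ->]].
have ratio : (x n).1.1 / (x n).1.2 @[n --> \oo] --> (1 : R).
  apply: (@squeeze_cvgr _ _ _ _
    (fun n => (1 + om (u n) - e n) * (1 - e n) / (1 + B n))
    (fun n => 1 + om (u n) + e n)).
  - by apply: filterS gx => n [].
  - rewrite -[X in _ --> X](_ : (1 + 0 - 0) * (1 - 0) / (1 + 0) = 1); last first.
      by rewrite !addr0 !subr0 mulr1 divr1.
    apply: cvgM; last apply: cvgV; rewrite ?addr0 ?oner_neq0 //.
      apply: cvgM; last by apply: cvgB => //; exact: cvg_cst.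
      by apply: cvgB => //; rewrite -[X in _ --> X]addr0; apply: cvgD => //; exact: cvg_cst.
    by rewrite -[X in _ --> X]addr0; apply: cvgD => //; exact: cvg_cst.
  - rewrite -[X in _ --> X](_ : 1 + 0 + 0 = 1); last by rewrite !addr0.
    by apply: cvgD => //; apply: cvgD => //; exact: cvg_cst.
have growth v : \forall n \near \oo, v <= (x n).2%:R * (x n).1.2.
  near=> n; have [_ _ [_ vn] _ _] : good n (x n) by near: n.
  apply: le_trans vn; rewrite /e invrK.
  rewrite ltW // (lt_le_trans (truncnS_gt v)) // ler_nat.
  apply: (leq_trans _ (leq_trans (leqnSn n) (leqnSn _))).
  by near: n; exact: nbhs_infty_ge.
pose J n := (\int[Q s]_w (F (sampled_limit Z s (x n).1.1 (x n).1.2 (x n).2 w))%:E)%E.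
have Jc : J @ \oo --> (\int[Q s]_w (F (Z w))%:E)%E.
  apply: (@sampled_limit_cvg F C (fun n => (x n).1.1) (fun n => (x n).1.2)
    (fun n => (x n).2)) => // n; by have [] := Hx n.
rewrite -(fineK Zfin); apply/fine_cvgP; split.
  by apply: filterS gx => n [_ _ _ _ []].
have Jc' : fine (J n) @[n --> \oo] --> fine (\int[Q s]_w (F (Z w))%:E)%E.
  by move: Jc; rewrite -{1}(fineK Zfin) => /fine_cvgP[].
rewrite -[X in _ --> X]add0r.
rewrite (_ : fine \o _ = (fun n => (fine (I (u n)) - fine (J n)) + fine (J n))); last first.
  by apply/funext => n /=; rewrite subrK.
apply: cvgD => //; apply/cvgrPdist_le => eps eps0; near=> n.
rewrite sub0r normrN.
have [_ _ _ _ [_]] : good n (x n) by near: n.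
move=> /le_trans; apply.
by near: n; exact: (cvgr_le _ ec).
Unshelve. all: by end_near.
Qed.

Lemma trace_law_cvg :
  cvg_in_law (fun b => P b (val s))
    (fun b w => trace_path s (accelerated K L b (@sigma b w))) (Q s) Z.
Proof.
move=> F cF [C FC].
(* The expectation is by definition the difference of the integrals of the positive and negative
   parts. Treating these separately avoids linearity of the integral, for which measurability along
   the trace would have to be established. *)
pose Fp y := Num.max (F y) 0; pose Fm y := Num.max (- F y) 0.
have maxC (G : dpath R (ground q K L M) -> R) : continuous G ->
    continuous (fun y => Num.max (G y) 0).
  move=> cG y; rewrite (_ : (fun y => _) = (fun y => (G y + `|G y|) / 2)); last first.
    by apply/funext => z; rewrite maxr_absE addr0 subr0.
  have H : (G z + `|G z|) / 2 @[z --> y] --> (G y + `|G y|) / 2.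
    apply: (@cvgM _ _ (nbhs y) _ (fun z => G z + `|G z|) (fun=> 2^-1)); last exact: cvg_cst.
    apply: (@cvgD _ _ _ (nbhs y) _ G (fun z => `|G z|)); first exact: cG.
    by apply: (@cvg_norm _ _ _ (nbhs y) _ G); exact: cG.
  exact: H.
have maxB (G : dpath R (ground q K L M) -> R) : (forall y, `|G y| <= C) ->
    forall y, 0 <= Num.max (G y) 0 <= C.
  move=> GC y; rewrite le_max lexx orbT ge_max (le_trans (ler_norm _) (GC y)) /=.
  by rewrite (le_trans _ (GC y)).
have Ep (d0 : measure_display) (U : measurableType d0) (mu : probability U R)
    (Y : U -> dpath R (ground q K L M)) :
    ('E_mu[fun w => F (Y w)] =
     \int[mu]_w (Fp (Y w))%:E - \int[mu]_w (Fm (Y w))%:E)%E.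
  rewrite unlock integralE; congr (_ - _)%E; apply: eq_integral => w _.
    by rewrite funeposE /Fp EFin_max.
  by rewrite funenegE /Fm EFin_max EFinN.
rewrite Ep; under eq_fun do rewrite Ep.
have Bp := maxB F FC.
have Bm : forall y, 0 <= Fm y <= C.
  by apply: (maxB (fun y => - F y)) => y; rewrite normrN.
apply: cvgeB.
- by apply: fin_num_adde_defr; exact: (trace_law_cvg_ge0 (maxC F cF) Bp).1.
- exact: (trace_law_cvg_ge0 (maxC F cF) Bp).2.
- apply: (@trace_law_cvg_ge0 Fm C _ Bm).2; apply: (maxC (fun y => - F y)) => y.
  by apply: (@cvgN _ _ _ (nbhs y) _ F); exact: cF.
Qed.

End potts_main.

Unset Implicit Arguments.

Theorem theorem2p12 (R : realType) (q K L M : nat)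
    (hq : (2 <= q)%N) (hK : (2829 <= K)%N) (hKL : (K <= L)%N) (hLM : (L <= M)%N)
    (d : R -> measure_display) (Omega : forall b : R, measurableType (d b))
    (P : forall b : R, config q K L M -> probability (Omega b) R)
    (sigma : forall b : R, Omega b -> dpath R (config q K L M))
    (hsigma : forall (b : R) (s : config q K L M), 0 < b ->
       is_markov_chain (metropolis_rate b) (P b s) (sigma b) s) :
  (forall kappa : R, 0 < kappa -> eyring_kramers P sigma kappa ->
   forall (d' : measure_display) (Omega' : measurableType d')
     (Q : ground q K L M -> probability Omega' R)
     (X : Omega' -> dpath R (ground q K L M)),
   (forall s : ground q K L M,
      is_markov_chain (fun _ _ => kappa^-1) (Q s) X s) ->
   forall s : ground q K L M,
     cvg_in_law (fun b => P b (val s))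
       (fun b w => trace_path s (accelerated K L b (sigma b w))) (Q s) X)
  /\
  (forall t : R, 0 <= t ->
     (\big[maxe/-oo]_(s : ground q K L M)
        \int[P b (val s)]_w
          occupation [set z | ~~ is_ground z] (accelerated K L b (sigma b w)) t)%E
       @[b --> +oo] --> 0%E).
Proof.
have K0 : (0 < K)%N by apply: leq_trans hK.
have L0 : (0 < L)%N := leq_trans K0 hKL.
have M0 : (0 < M)%N := leq_trans L0 hLM.
split; last by move=> t t0; exact: (excited_time_cvg hq K0 L0 M0 hsigma).
move=> kappa kappa0 EK d' Omega' Q X HX s.
exact: (trace_law_cvg hq K0 L0 M0 hsigma kappa0 EK HX).
Qed.
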